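(* Let $\mu\in L^\infty(\mathbb{T}^d)$ with $\mu(y)\ge\mu_0>0$ a.e. Fix a direction $\hat\eta\in\mathbb{S}^{d-1}$ and let $\delta\mapsto\big(\lambda_{m,\hat\eta}(\delta),\phi_{m,\hat\eta}(\cdot;\delta),q_{m,\hat\eta}(\cdot;\delta),q_{0,m,\hat\eta}(\delta)\big)$, $m=1,\dots,d-1$, be the analytic Rellich branches of the Bloch spectral problem for the Stokes operator described in the context. Primes denote derivatives with respect to $\delta$. Then for each $m=1,\dots,d-1$: (i) $\lambda_{m,\hat\eta}(0)=0$, and the corresponding eigenfunction satisfies $q_{m,\hat\eta}(y;0)=0$, $q_{0,m,\hat\eta}(0)=0$ and $\phi_{m,\hat\eta}(y;0)=\phi^0_{m,\hat\eta}$, a (constant) unit vector orthogonal to $\hat\eta$. (ii) $\lambda'_{m,\hat\eta}(0)=0$ and $q'_{0,m,\hat\eta}(0)=0$. (iii) $\phi'_{m,\hat\eta}(y;0)=i\,\hat\eta_\alpha\,\chi^r_\alpha(y)\,(\phi^0_{m,\hat\eta})_r+\zeta_{m,\hat\eta}$, where $\zeta_{m,\hat\eta}\in\mathbb{C}^d$ is a constant vector (independent of $y$) orthogonal to $\hat\eta$. (iv) $q'_{m,\hat\eta}(y;0)=i\,\hat\eta_\alpha\,\pi^r_\alpha(y)\,(\phi^0_{m,\hat\eta})_r$. (v) The second derivatives of $\lambda_{m,\hat\eta}$ and $q_{0,m,\hat\eta}$ at $\delta=0$ satisfy $$\tfrac12\lambda''_{m,\hat\eta}(0)\,\phi^0_{m,\hat\eta}=\tfrac12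 q''_{0,m,\hat\eta}(0)\,\hat\eta+M(\hat\eta,A^{*})\,\phi^0_{m,\hat\eta},$$ where $M(\hat\eta,A^{*})$ is the symmetric matrix with entries $M(\hat\eta,A^{*})_{kl}=(A^{*})^{kl}_{\alpha\beta}\hat\eta_\alpha\hat\eta_\beta$.
   Context: Summation over repeated indices is used. $Y=]0,1[^d$, $\mathbb{T}^d$ is the unit torus, function spaces are complex valued, $L^2_0(\mathbb{T}^d)=\{q\in L^2(\mathbb{T}^d):\int_{\mathbb{T}^d}q=0\}$. For a vector field $v$, $(\nabla v)_{kl}=\partial v_l/\partial y_k$, the divergence of a matrix field acts on its columns, and $M:N=\sum_{k,l}M_{kl}N_{kl}$. For $\eta\in\mathbb{R}^d$, $D(\eta)=\nabla+i\eta$ is the shifted gradient: $(D(\eta)\phi)_{kl}=\partial_{y_k}\phi_l+i\eta_k\phi_l$, $D(\eta)\cdot\phi=\partial_{y_k}\phi_k+i\eta_k\phi_k$, and $D(\eta)\cdot$ of a matrix acts on its columns. Bloch spectral problem in direction $\hat\eta$: for real $\delta$, find $\lambda(\delta)\in\mathbb{R}$, $\phi(\cdot;\delta)\in H^1(\mathbb{T}^d)^d$, $q(\cdot;\delta)\in L^2_0(\mathbb{T}^d)$, $q_0(\delta)\in\mathbb{C}$ with $$-D(\delta\hat\eta)\cdot(\mu D(\delta\hat\eta)\phi)+D(\delta\hat\eta)q+q_0\hat\eta=\lambda\phi,\quad D(\delta\hat\eta)\cdot\phi=0\ \text{ in }\mathbb{T}^d,\quad \hat\eta\cdot\int_{\mathbb{T}^d}\phi\,dy=0,\quad\int_{\mathbb{T}^d}|\phi|^2dy=1.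 \quad ( * )$$ Rellich branches (existence is a known result): there are $\delta_0>0$ and exactly $d-1$ analytic functions $\delta\mapsto(\lambda_{m,\hat\eta}(\delta),\phi_{m,\hat\eta}(\cdot;\delta),q_{m,\hat\eta}(\cdot;\delta),q_{0,m,\hat\eta}(\delta))$ on $|\delta|\le\delta_0$, with values in $\mathbb{R}\times H^1(\mathbb{T}^d)^d\times L^2_0(\mathbb{T}^d)\times\mathbb{C}$, $m=1,\dots,d-1$, which solve $( * )$, are such that $\{\phi_{m,\hat\eta}(\cdot;\delta)\}_{m=1}^{d-1}$ is orthonormal in $L^2(\mathbb{T}^d)^d$, and at $\delta=0$ take the values $\lambda_{m,\hat\eta}(0)=0$, $\phi_{m,\hat\eta}(\cdot;0)=\phi^0_{m,\hat\eta}$, $q_{m,\hat\eta}(\cdot;0)=0$, $q_{0,m,\hat\eta}(0)=0$, where $\phi^0_{1,\hat\eta},\dots,\phi^0_{d-1,\hat\eta}$ are constant unit vectors of $\mathbb{R}^d$ forming with $\hat\eta$ an orthonormal basis of $\mathbb{R}^d$. For any interval whose closure contains $0$ and no other eigenvalue of $( * )$ at $\delta=0$, the $\lambda_{m,\hat\eta}(\delta)$ are the only eigenvalues of $( * )$ in it, counted with multiplicity ($\delta$ small). Cell problems: for $\alpha,k\in\{1,\dots,d\}$, $(\chi^k_\alpha,\pi^k_\alpha)\in H^1(\mathbb{T}^d)^d\times L^2(\mathbb{T}^d)$ is the unique solution of $-\nabla\cdot(\mu\nabla(\chi^k_\alpha+y_\alpha e_k))+\nabla\pi^k_\alpha=0$,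 $\nabla\cdot\chi^k_\alpha=0$ in $\mathbb{T}^d$, $\int_{\mathbb{T}^d}\chi^k_\alpha=0$, $\int_{\mathbb{T}^d}\pi^k_\alpha=0$. Homogenized tensor: $$(A^{*})^{kl}_{\alpha\beta}=\frac1{|\mathbb{T}^d|}\int_{\mathbb{T}^d}\mu\,\nabla(\chi^k_\alpha+y_\alpha e_k):\nabla(\chi^l_\beta+y_\beta e_l)\,dy.$$ *)

(* Defs.v *)
From HB Require Import structures.
From mathcomp Require Import all_boot all_order all_algebra complex.
From mathcomp Require Import all_classical all_reals all_analysis.

Set Implicit Arguments.
Unset Strict Implicit.
Unset Printing Implicit Defensive.

Import Order.TTheory GRing.Theory Num.Theory.
Import numFieldNormedType.Exports numFieldTopology.Exports.

Local Open Scope classical_set_scope.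
Local Open Scope ring_scope.
Local Open Scope complex_scope.

Notation torus R d := (d.-tuple (measurableTypeR R)).

Section torus_measure.
Variable R : realType.

Definition tcons (n : nat) (x : measurableTypeR R * n.-tuple (measurableTypeR R)) :
    n.+1.-tuple (measurableTypeR R) :=
  [the n.+1.-tuple (measurableTypeR R) of x.1 :: x.2].

Lemma measurable_tcons n : measurable_fun setT (@tcons n).
Proof. by apply: measurable_cons; [exact: measurable_fst|exact: measurable_snd]. Qed.

HB.instance Definition _ n :=
  isMeasurableFun.Build _ _ _ _ (@tcons n) (@measurable_tcons n).

(* A function on the torus is represented by a function on R^d, of which only
   the values in the unit cube matter.  The measure of the torus is the
   Lebesgue measure of the cube: the d-fold product of the uniform probability
   on [0, 1], i.e. of the Lebesgue measure restricted to [0, 1]. *)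
Fixpoint torus_measure (n : nat) : probability (torus R n) R :=
  match n with
  | 0 => [the probability _ _ of \d_ [tuple]]
  | n'.+1 => [the probability _ _ of
      distribution [the probability _ _ of
        (uniform_prob (@ltr01 R) \x torus_measure n')%E] (@tcons n')]
  end.

End torus_measure.
Arguments torus_measure {R} n.

Lemma torus_measure_box (R : realType) n (A : 'I_n -> set (measurableTypeR R)) :
  (forall i, measurable (A i)) ->
  torus_measure n [set y | forall i, A i (tnth y i)] =
  (\prod_(i < n) lebesgue_measure (A i `&` `[0%R, 1%R]))%E.
Proof.
elim: n A => [|n IH] A mA /=.
  by rewrite big_ord0 diracE mem_set// => -[].
rewrite /distribution /pushforward.
have -> : @tcons R n @^-1` [set y | forall i, A i (tnth y i)] =
  A ord0 `*` [set y : n.-tuple (measurableTypeR R) |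
    forall i, A (lift ord0 i) (tnth y i)].
  apply/seteqP; split => [[x y] /= H|[x y] /= [H0 H] i].
    split; first exact: (H ord0).
    by move=> i; have := H (lift ord0 i); rewrite tnthS.
  by case: (unliftP ord0 i) => [j|] -> //; rewrite tnthS.
rewrite product_measure1E//; last first.
  have -> : [set y : n.-tuple (measurableTypeR R) |
      forall i, A (lift ord0 i) (tnth y i)] =
    \bigcap_(i in [set: 'I_n]) ((fun y => tnth y i) @^-1` A (lift ord0 i)).
    by apply/seteqP; split => [y H i _|y H i]; [exact: H|exact: (H i)].
  apply: fin_bigcap_measurable => // i _.
  by rewrite -[X in measurable X]setTI; apply: measurable_tnth.
rewrite big_ord_recl; congr (_ * _)%E; last exact: IH.
rewrite -[LHS]/(\int[lebesgue_measure]_(x in A ord0)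
  (uniform_pdf 0 1 x)%:E)%E integral_uniform_pdf.
under eq_integral => x.
  rewrite inE /= in_itv /= => -[_ x01].
  rewrite /uniform_pdf x01 subr0 invr1; over.
by rewrite integral_cst ?mul1e//=; apply: measurableI.
Qed.

Section functions_on_the_torus.
Variables (R : realType) (d : nat).

Local Notation C := R[i].
Local Notation Td := (torus R d).
Local Notation P := (torus_measure d : {measure set Td -> \bar R}).

Definition cint (f : Td -> C) : C :=
  (\int[P]_y complex.Re (f y)) +i* (\int[P]_y complex.Im (f y)).

Definition L2 (f : Td -> C) : Prop :=
  (fun y => complex.Re (f y)) \in Lfun P 2%:E /\
  (fun y => complex.Im (f y)) \in Lfun P 2%:E.

Definition L2_0 (q : Td -> C) : Prop := L2 q /\ cint q = 0.

Definition L2norm (f : Td -> C) : R :=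
  Num.sqrt (\int[P]_y ComplexField.Normc.normc (f y) ^+ 2).

Definition partial (k : 'I_d) (psi : 'rV[R]_d -> R) : 'rV[R]_d -> R :=
  fun x => 'D_(delta_mx 0 k) psi x.

(* The real elements of C^oo(T^d): 1-periodic in each variable, and all the
   iterated partial derivatives are (Frechet) differentiable everywhere. *)
Definition test_function (psi : 'rV[R]_d -> R) : Prop :=
  (forall (k : 'I_d) x, psi (x + delta_mx 0 k) = psi x) /\
  (forall (s : seq 'I_d) x, differentiable (foldr partial psi s) x).

Definition point (y : Td) : 'rV[R]_d := \row_k tnth y k.

Definition is_wderiv (k : 'I_d) (f g : Td -> C) : Prop :=
  L2 g /\ forall psi, test_function psi ->
    cint (fun y => f y * (partial k psi (point y))%:C) =
    - cint (fun y => g y * (psi (point y))%:C).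

(* Determined almost everywhere when the weak derivative exists in L^2;
   the value is 0 otherwise. *)
Definition wderiv (k : 'I_d) (f : Td -> C) : Td -> C :=
  xget (fun=> 0) [set g | is_wderiv k f g].

Definition H1 (f : Td -> C) : Prop :=
  L2 f /\ forall k, exists g, is_wderiv k f g.

Definition comp (u : Td -> 'cV[C]_d) (l : 'I_d) : Td -> C := fun y => u y l 0.

Definition H1v (u : Td -> 'cV[C]_d) : Prop := forall l, H1 (comp u l).

Definition H1norm (u : Td -> 'cV[C]_d) : R :=
  Num.sqrt (\sum_l L2norm (comp u l) ^+ 2 +
            \sum_k \sum_l L2norm (wderiv k (comp u l)) ^+ 2).

Definition grad (u : Td -> 'cV[C]_d) (y : Td) : 'M[C]_d :=
  \matrix_(k, l) wderiv k (comp u l) y.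

Definition Dgrad (xi : 'cV[R]_d) (u : Td -> 'cV[C]_d) (y : Td) : 'M[C]_d :=
  \matrix_(k, l) (grad u y k l + 'i * (xi k 0)%:C * u y l 0).

Definition Ddiv (xi : 'cV[R]_d) (u : Td -> 'cV[C]_d) (y : Td) : C :=
  \sum_k (grad u y k k + 'i * (xi k 0)%:C * u y k 0).

(* Bilinear products; conjugations are written explicitly. *)
Definition dotv (u v : 'cV[C]_d) : C := \sum_k u k 0 * v k 0.
Definition ddot (M N : 'M[C]_d) : C := \sum_k \sum_l M k l * N k l.
Definition conjmx m n (M : 'M[C]_(m, n)) : 'M[C]_(m, n) := map_mx conjc M.
Definition cplx m n (M : 'M[R]_(m, n)) : 'M[C]_(m, n) :=
  map_mx (real_complex R) M.

(* The equation - D(xi) . sigma + D(xi) p + g = f in T^d, as an equality in the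
   dual of H^1(T^d)^d. Since xi is real, the formal adjoint of D(xi) is
   - D(xi) . for the sesquilinear L^2 pairing. *)
Definition weak_stokes (xi : 'cV[R]_d) (sigma : Td -> 'M[C]_d) (p : Td -> C)
    (g f : Td -> 'cV[C]_d) : Prop :=
  forall v, H1v v ->
    cint (fun y => ddot (sigma y) (conjmx (Dgrad xi v y)))
    - cint (fun y => p y * conjc (Ddiv xi v y))
    + cint (fun y => dotv (g y) (conjmx (v y)))
    = cint (fun y => dotv (f y) (conjmx (v y))).

Definition L2ip (u v : Td -> 'cV[C]_d) : C :=
  cint (fun y => dotv (u y) (conjmx (v y))).

Record bloch_solution (mu : Td -> R) (eta : 'cV[R]_d) (delta lambda : R)
    (phi : Td -> 'cV[C]_d) (q : Td -> C) (q0 : C) : Prop := BlochSolution {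
  bloch_phi_H1 : H1v phi;
  bloch_q_L2_0 : L2_0 q;
  bloch_momentum :
    weak_stokes (delta *: eta)
      (fun y => (mu y)%:C *: Dgrad (delta *: eta) phi y) q
      (fun=> q0 *: cplx eta) (fun y => lambda%:C *: phi y);
  bloch_divergence : {ae P, forall y, Ddiv (delta *: eta) phi y = 0};
  bloch_mean : \sum_k (eta k 0)%:C * cint (comp phi k) = 0;
  bloch_norm : L2ip phi phi = 1
}.

Definition orthonormal k (Phi : 'I_k -> Td -> 'cV[C]_d) : Prop :=
  forall a b, L2ip (Phi a) (Phi b) = (a == b)%:R.

Definition bloch_eigenfunction mu eta delta lambda phi : Prop :=
  exists q q0, bloch_solution mu eta delta lambda phi q q0.

Definition bloch_eigenvalue mu eta delta lambda : Prop :=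
  exists phi, bloch_eigenfunction mu eta delta lambda phi.

(* The dimension of the eigenspace in L^2(T^d)^d (functions being identified
   when they agree almost everywhere) is k; k = 0 when lambda is not an
   eigenvalue. *)
Definition bloch_multiplicity mu eta delta lambda (k : nat) : Prop :=
  let has_family j := exists Phi : 'I_j -> Td -> 'cV[C]_d,
    orthonormal Phi /\
    forall a, bloch_eigenfunction mu eta delta lambda (Phi a) in
  has_family k /\ ~ has_family k.+1.

(* Analyticity on D of a map from R to the elements of V satisfying mem, for
   the (semi)norm N on them: near each point of D the map is the sum of a power
   series with coefficients satisfying mem. *)
Definition analytic_on (V : lmodType C) (mem : V -> Prop) (N : V -> R)
    (D : set R) (f : R -> V) : Prop :=
  forall x, D x -> exists (r : R) (a : nat -> V),
    [/\ 0 < r, forall j, mem (a j) &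
      forall y, D y -> `|y - x| < r ->
        N (f y - \sum_(j < k) ((y - x) ^+ j)%:C *: a j) @[k --> \oo] --> (0 : R)].

Definition has_deriv (V : lmodType C) (N : V -> R) (f : R -> V) (x : R) (v : V)
    : Prop :=
  N ((h^-1)%:C *: (f (x + h) - f x) - v) @[h --> 0^'] --> (0 : R).

Definition is_cderive (f : R -> C) (x : R) (l : C) : Prop :=
  is_derive x 1 (fun t => complex.Re (f t)) (complex.Re l) /\
  is_derive x 1 (fun t => complex.Im (f t)) (complex.Im l).

Definition cderive1n (k : nat) (f : R -> C) (x : R) : C :=
  (derive1n k (fun t => complex.Re (f t)) x) +i*
  (derive1n k (fun t => complex.Im (f t)) x).

Local Notation normc := (@ComplexField.Normc.normc R).

Record rellich_branches (mu : Td -> R) (eta : 'cV[R]_d) (delta0 : R)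
    (lambda : 'I_d.-1 -> R -> R) (phi : 'I_d.-1 -> R -> Td -> 'cV[C]_d)
    (q : 'I_d.-1 -> R -> Td -> C) (q0 : 'I_d.-1 -> R -> C)
    (phi0 : 'I_d.-1 -> 'cV[R]_d) : Prop := RellichBranches {
  rellich_delta0 : 0 < delta0;
  rellich_lambda_analytic : forall m,
    analytic_on (V := C) (fun=> True) normc [set t | `|t| <= delta0]
      (fun t => (lambda m t)%:C);
  rellich_phi_analytic : forall m,
    analytic_on H1v H1norm [set t | `|t| <= delta0] (phi m);
  rellich_q_analytic : forall m,
    analytic_on (V := Td -> C) L2_0 L2norm [set t | `|t| <= delta0] (q m);
  rellich_q0_analytic : forall m,
    analytic_on (V := C) (fun=> True) normc [set t | `|t| <= delta0] (q0 m);
  rellich_solution : forall m t, `|t| <= delta0 ->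
    bloch_solution mu eta t (lambda m t) (phi m t) (q m t) (q0 m t);
  rellich_orthonormal : forall t, `|t| <= delta0 ->
    orthonormal (fun m => phi m t);
  rellich_lambda_at0 : forall m, lambda m 0 = 0;
  rellich_phi_at0 : forall m, {ae P, forall y, phi m 0 y = cplx (phi0 m)};
  rellich_q_at0 : forall m, {ae P, forall y, q m 0 y = 0};
  rellich_q0_at0 : forall m, q0 m 0 = 0;
  (* with |eta| = 1, eta and the phi0 m form an orthonormal basis of R^d *)
  rellich_phi0_orthonormal : forall m m',
    \sum_k phi0 m k 0 * phi0 m' k 0 = (m == m')%:R;
  rellich_phi0_eta : forall m, \sum_k phi0 m k 0 * eta k 0 = 0;
  (* The branches lying in I are all the eigenvalues in I. As 0 may be an
     end point of I, a branch need not take its values in I. *)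
  rellich_only_eigenvalues : forall I : interval R,
    closure [set` I] 0 ->
    (forall nu, closure [set` I] nu -> bloch_eigenvalue mu eta 0 nu -> nu = 0) ->
    exists2 delta1, 0 < delta1 & forall t nu, `|t| < delta1 -> nu \in I ->
      bloch_multiplicity mu eta t nu #|[set m | lambda m t == nu]|
}.

(* delta_mx alpha k is the gradient of y_alpha e_k, which is not periodic. *)
Definition cell_grad (alpha k : 'I_d) (chi : Td -> 'cV[C]_d) (y : Td)
    : 'M[C]_d := grad chi y + delta_mx alpha k.

Record cell_solution (mu : Td -> R) (alpha k : 'I_d) (chi : Td -> 'cV[C]_d)
    (pi : Td -> C) : Prop := CellSolution {
  cell_chi_H1 : H1v chi;
  cell_pi_L2 : L2 pi;
  cell_momentum :
    weak_stokes 0 (fun y => (mu y)%:C *: cell_grad alpha k chi y) pi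
      (fun=> 0) (fun=> 0);
  cell_divergence : {ae P, forall y, Ddiv 0 chi y = 0};
  cell_chi_mean : forall l, cint (comp chi l) = 0;
  cell_pi_mean : cint pi = 0
}.

(* Upper indices k, l and lower indices alpha, beta; chi alpha k stands for
   chi^k_alpha. *)
Definition hom_tensor (mu : Td -> R) (chi : 'I_d -> 'I_d -> Td -> 'cV[C]_d)
    (k l alpha beta : 'I_d) : C :=
  ((fine (P setT))^-1)%:C *
  cint (fun y => (mu y)%:C *
    ddot (cell_grad alpha k (chi alpha k) y) (cell_grad beta l (chi beta l) y)).

Definition Mmx (eta : 'cV[R]_d) (A : 'I_d -> 'I_d -> 'I_d -> 'I_d -> C)
    : 'M[C]_d :=
  \matrix_(k, l) \sum_alpha \sum_beta
    A k l alpha beta * (eta alpha 0)%:C * (eta beta 0)%:C.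

End functions_on_the_torus.

(* Main.v *)
Require Import Defs.
From HB Require Import structures.
From mathcomp Require Import all_boot all_order all_algebra complex.
From mathcomp Require Import all_classical all_reals all_analysis.
From mathcomp Require Import measurable_realfun ess_sup_inf.
From mathcomp Require Import ring lra.

Set Implicit Arguments.
Unset Strict Implicit.
Unset Printing Implicit Defensive.

Import Order.TTheory GRing.Theory Num.Theory.
Import numFieldNormedType.Exports numFieldTopology.Exports.

Local Open Scope classical_set_scope.
Local Open Scope ring_scope.
Local Open Scope complex_scope.

(** The derivatives of a Bloch branch at the origin are read off the weak
    equation divided by t and by t ^ 2, as t tends to 0.

    An analytic family has a derivative at 0 in the norm of the space
    ([analytic_has_deriv]).  Let a1 and b1 be the derivatives of the
    eigenfunction and of the pressure.  At t = 0 the eigenfunction is the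
    constant phi0, and the pressure, the eigenvalue and the multiplier q0 vanish,
    so that the whole equation is divisible by t.  In the limit, for every test
    field v,

      (mu psi0, grad v) - (b1, div v) + q0'(0) (eta, v) = lambda'(0) (phi0, v)

    with psi0 = grad a1 + i eta phi0^T ([first_order]).  A constant v removes the
    first two terms, and since eta and phi0 are orthonormal both lambda'(0) and
    q0'(0) vanish ([first_derivatives]).  What is left is the combination of the
    cell problems with coefficients i eta_alpha (phi0)_r.  The difference W of a1
    and the combined correctors is divergence free and solves the homogeneous
    Stokes system: its gradient vanishes by the energy estimate
    ([stokes_energy]), so that W is constant ([grad0_cst]), and the difference of
    the pressures vanishes too ([pressure_unique]).  The mean condition makes the
    constant orthogonal to eta ([mean_a1]).

    With a constant test field w, the shifted gradient of w is itself of order t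
    and the equation is divisible by t ^ 2 once the first derivatives vanish.
    The limit ([second_order]) involves only the mean of mu psi0, and
    [mean_corrector_stress] recognizes M phi0 in it: in the homogenized tensor one
    of the two correctors drops out, by testing a cell problem with the corrector
    of another one ([hom_tensorE]).

    All this presupposes that weak gradients behave like gradients.  Two facts
    about the torus suffice.  The integral of a partial derivative of a periodic
    function vanishes ([integral_partial_eq0], by Fubini and the fundamental
    theorem of calculus), so that constants and trigonometric functions have the
    expected weak derivatives.  The trigonometric functions are total
    ([trig_total]), so that weak derivatives are unique almost everywhere, hence
    linear, and a function with a vanishing weak gradient is constant, every
    nonconstant trigonometric function being a derivative ([ae_cst]). *)

(** * Complex valued integrals *)

Section complex_integrals.
Variables (R : realType) (d : nat).

Local Notation C := R[i].
Local Notation Td := (torus R d).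
Local Notation P := (torus_measure d : {measure set Td -> \bar R}).
Local Notation normc := (@ComplexField.Normc.normc R).
Implicit Types (f g h : Td -> C) (u v : Td -> R).

Lemma cReD (a b : C) : complex.Re (a + b) = complex.Re a + complex.Re b.
Proof. by case: a b => ? ? []. Qed.
Lemma cImD (a b : C) : complex.Im (a + b) = complex.Im a + complex.Im b.
Proof. by case: a b => ? ? []. Qed.
Lemma cReM (a b : C) : complex.Re (a * b) =
  complex.Re a * complex.Re b - complex.Im a * complex.Im b.
Proof. by case: a b => ? ? []. Qed.
Lemma cImM (a b : C) : complex.Im (a * b) =
  complex.Re a * complex.Im b + complex.Im a * complex.Re b.
Proof. by case: a b => ? ? []. Qed.
Lemma cReN (a : C) : complex.Re (- a) = - complex.Re a.
Proof. by case: a. Qed.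
Lemma cImN (a : C) : complex.Im (- a) = - complex.Im a.
Proof. by case: a. Qed.
Lemma cReJ (a : C) : complex.Re (conjc a) = complex.Re a.
Proof. by case: a. Qed.
Lemma cImJ (a : C) : complex.Im (conjc a) = - complex.Im a.
Proof. by case: a. Qed.
Lemma realcM (x y : R) : (x * y)%:C = x%:C * y%:C.
Proof. exact: rmorphM. Qed.
Lemma realc_sum n (a : 'I_n -> R) : (\sum_i a i)%:C = \sum_i (a i)%:C.
Proof. exact: rmorph_sum. Qed.
Lemma conjcD (a b : C) : conjc (a + b) = conjc a + conjc b.
Proof. exact: rmorphD. Qed.
Lemma conjcM (a b : C) : conjc (a * b) = conjc a * conjc b.
Proof. exact: rmorphM. Qed.
Definition ReImE := (cReD, cImD, cReM, cImM, cReN, cImN, cReJ, cImJ).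

Lemma complexP (a b : C) :
  complex.Re a = complex.Re b -> complex.Im a = complex.Im b -> a = b.
Proof. by case: a b => ? ? [? ?] /= -> ->. Qed.

Lemma normc_sqr (a : C) : normc a ^+ 2 = complex.Re a ^+ 2 + complex.Im a ^+ 2.
Proof. by case: a => x y /=; rewrite sqr_sqrtr// addr_ge0// sqr_ge0. Qed.

Lemma normc_ge0 (a : C) : 0 <= normc a.
Proof. by case: a => x y /=; exact: sqrtr_ge0. Qed.

Lemma normc_real (x : R) : normc x%:C = `|x|.
Proof. by rewrite /= expr0n/= addr0 sqrtr_sqr. Qed.

Definition Cintegrable f :=
  P.-integrable setT (EFin \o (fun y => complex.Re (f y))) /\
  P.-integrable setT (EFin \o (fun y => complex.Im (f y))).

Lemma integrable_add u v : P.-integrable setT (EFin \o u) ->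
  P.-integrable setT (EFin \o v) ->
  P.-integrable setT (EFin \o (fun y => u y + v y)).
Proof.
move=> iu iv; rewrite [X in integrable _ _ X](_ : _ =
  (EFin \o u) \+ (EFin \o v))%E//; exact: integrableD.
Qed.

Lemma integrable_scale (c : R) u : P.-integrable setT (EFin \o u) ->
  P.-integrable setT (EFin \o (fun y => c * u y)).
Proof.
move=> iu; rewrite [X in integrable _ _ X](_ : _ =
  (fun y => c%:E * (EFin \o u) y)%E)//; exact: integrableZl.
Qed.

Lemma integrable_opp u : P.-integrable setT (EFin \o u) ->
  P.-integrable setT (EFin \o (fun y => - u y)).
Proof.
move=> /(@integrable_scale (-1)); apply: eq_integrable => // y _ /=.
by rewrite mulN1r.
Qed.

Lemma CintegrableD f g :
  Cintegrable f -> Cintegrable g -> Cintegrable (fun y => f y + g y).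
Proof.
move=> [fr fi] [gr gi]; split.
- under [X in integrable _ _ X]eq_fun do rewrite /= cReD; exact: integrable_add.
- under [X in integrable _ _ X]eq_fun do rewrite /= cImD; exact: integrable_add.
Qed.

Lemma CintegrableZ (c : C) f : Cintegrable f -> Cintegrable (fun y => c * f y).
Proof.
move=> [fr fi]; split.
- under [X in integrable _ _ X]eq_fun do rewrite /= cReM.
  by apply: integrable_add; [|apply: integrable_opp]; exact: integrable_scale.
- under [X in integrable _ _ X]eq_fun do rewrite /= cImM.
  by apply: integrable_add; exact: integrable_scale.
Qed.

Lemma Cintegrable_sum n (F : 'I_n -> Td -> C) :
  (forall i, Cintegrable (F i)) -> Cintegrable (fun y => \sum_i F i y).
Proof.
elim: n F => [|n IH] F iF.
  under [X in Cintegrable X]eq_fun do rewrite big_ord0.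
  by split; exact: integrable0.
under [X in Cintegrable X]eq_fun do rewrite big_ord_recl.
by apply: CintegrableD => //; apply: IH.
Qed.

Lemma cintD f g : Cintegrable f -> Cintegrable g ->
  cint (fun y => f y + g y) = cint f + cint g.
Proof.
move=> [fr fi] [gr gi]; rewrite /cint; apply: complexP => /=.
- by rewrite -RintegralD//; apply: eq_Rintegral => y _; rewrite cReD.
- by rewrite -RintegralD//; apply: eq_Rintegral => y _; rewrite cImD.
Qed.

Lemma cintZ (c : C) f : Cintegrable f ->
  cint (fun y => c * f y) = c * cint f.
Proof.
move=> [fr fi]; rewrite /cint; apply: complexP; rewrite ?(cReM,cImM) /=.
- rewrite -!RintegralZl// -RintegralB//; try exact: integrable_scale.
  by apply: eq_Rintegral => y _; rewrite cReM.
- rewrite -!RintegralZl// -RintegralD//; try exact: integrable_scale.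
  by apply: eq_Rintegral => y _; rewrite cImM.
Qed.

Lemma cint_conj f : Cintegrable f -> cint (fun y => conjc (f y)) = conjc (cint f).
Proof.
move=> [fr fi]; rewrite /cint; apply: complexP; rewrite ?(cReJ,cImJ) /=.
- by apply: eq_Rintegral => y _; rewrite cReJ.
- rewrite -mulN1r -RintegralZl//.
  by apply: eq_Rintegral => y _; rewrite cImJ mulN1r.
Qed.

Lemma cint_sum n (F : 'I_n -> Td -> C) :
  (forall i, Cintegrable (F i)) ->
  cint (fun y => \sum_i F i y) = \sum_i cint (F i).
Proof.
elim: n F => [|n IH] F iF.
  rewrite big_ord0; under [X in cint X]eq_fun do rewrite big_ord0.
  rewrite /cint; apply: complexP => /=; rewrite Rintegral_cst//= mul0r//.
under [X in cint X]eq_fun do rewrite big_ord_recl.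
by rewrite cintD// ?IH ?big_ord_recl//; exact: Cintegrable_sum.
Qed.

Lemma cint_ae f g : Cintegrable f -> Cintegrable g ->
  {ae P, forall y, f y = g y} -> cint f = cint g.
Proof.
move=> [fr fi] [gr gi] fg.
have aeE (u v : Td -> R) : P.-integrable setT (EFin \o u) ->
    P.-integrable setT (EFin \o v) -> {ae P, forall y, u y = v y} ->
    \int[P]_y u y = \int[P]_y v y.
  move=> /measurable_int mu /measurable_int mv uv; rewrite /Rintegral; congr fine.
  apply: ae_eq_integral => //.
  by apply: filterS uv => y /= -> _.
by rewrite /cint; apply: complexP => /=; apply: aeE => //;
  apply: filterS fg => y /= ->.
Qed.

(** * The Hilbert space of complex square integrable functions *)

Local Notation RL2 := (Lfun P 2%:E).

Lemma RL2D u v : u \in RL2 -> v \in RL2 -> (fun y => u y + v y) \in RL2.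
Proof. exact: (Lfun_addr_closed P (lee1n 2)).2. Qed.

Lemma RL2Z (c : R) u : u \in RL2 -> (fun y => c * u y) \in RL2.
Proof.
move=> ul2; have := Lfun_scale c (ler1n _ 2) ul2.
by rewrite (_ : c \o* u = fun y => c * u y)//; apply/funext => y /=; rewrite mulrC.
Qed.

Lemma RL2N u : u \in RL2 -> (fun y => - u y) \in RL2.
Proof.
move=> /(@RL2Z (-1)); rewrite (_ : (fun y => -1 * u y) = fun y => - u y)//.
by apply/funext => y; rewrite mulN1r.
Qed.

Lemma RL2_measurable u : u \in RL2 -> measurable_fun setT u.
Proof. by rewrite inE => /andP[]; rewrite inE. Qed.

Lemma RL2_mul_integrable u v : u \in RL2 -> v \in RL2 ->
  P.-integrable setT (EFin \o (fun y => u y * v y)).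
Proof. by move=> ul2 vl2; apply/Lfun1_integrable/Lfun2_mul_Lfun1. Qed.

Lemma torus_measure_setT : P setT = 1%E.
Proof. exact: (probability_setT (torus_measure d)). Qed.

Lemma RL2_integrable u : u \in RL2 -> P.-integrable setT (EFin \o u).
Proof. by move=> ul2; apply/Lfun1_integrable/(Lfun_subset12 _ ul2); rewrite torus_measure_setT. Qed.

(** Square integrability only sees a measurable majorant up to a null set,
    which is what lets bounded coefficients act. *)
Lemma RL2_le u v : measurable_fun setT u -> v \in RL2 ->
  {ae P, forall y, `|u y| <= `|v y|} -> u \in RL2.
Proof.
move=> mu vl2 uv; rewrite inE; apply/andP; split; rewrite inE//=.
rewrite /finite_norm unlock; apply: poweR_lty.
have /(Lfun_integrable (ler1n _ 2))/integrable_lty := vl2.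
move=> /(_ measurableT) /=.
apply: le_lt_trans; apply: ae_ge0_le_integral => //=.
- apply/measurable_EFinP.
  apply: (@measurableT_comp _ _ _ _ _ _ (@powR R ^~ 2)) => //.
  exact: measurableT_comp.
- apply/measurable_EFinP.
  apply: (@measurableT_comp _ _ _ _ _ _ (@powR R ^~ 2)) => //.
  by apply: measurableT_comp => //; exact: RL2_measurable.
- by apply: filterS uv => y /= uvy _; rewrite lee_fin ge0_ler_powR// nnegrE.
Qed.

Definition essbounded u :=
  measurable_fun setT u /\ exists M : R, {ae P, forall y, `|u y| <= M}.

Lemma RL2_bounded u : essbounded u -> u \in RL2.
Proof.
move=> [mu [M uM]]; apply: (RL2_le mu (Lfun_cst P M 2)).
by apply: filterS uM => y /= /le_trans; apply; exact: ler_norm.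
Qed.

Lemma RL2M u v : essbounded u -> v \in RL2 -> (fun y => u y * v y) \in RL2.
Proof.
move=> [mu [M uM]] vl2; apply: (@RL2_le _ (fun y => M * v y)).
- by apply: measurable_funM => //; exact: RL2_measurable.
- exact: RL2Z.
- apply: filterS uM => y /= uM; rewrite !normrM ler_wpM2r//.
  by rewrite (le_trans uM)// ler_norm.
Qed.

Lemma essbounded_Lfun u : u \in Lfun P +oo%E -> essbounded u.
Proof.
rewrite inE => /andP[]; rewrite !inE /finite_norm unlock => mu.
rewrite torus_measure_setT lte01 => /ess_supr_bounded[M uM].
by split=> //; exists M.
Qed.

Lemma L2D f g : L2 f -> L2 g -> L2 (fun y => f y + g y).
Proof.
move=> [fr fi] [gr gi]; split.
- by under eq_fun do rewrite cReD; exact: RL2D.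
- by under eq_fun do rewrite cImD; exact: RL2D.
Qed.

Lemma L2Z (c : C) f : L2 f -> L2 (fun y => c * f y).
Proof.
move=> [fr fi]; split.
- by under eq_fun do rewrite cReM; apply: RL2D; [|apply: RL2N]; exact: RL2Z.
- by under eq_fun do rewrite cImM; apply: RL2D; exact: RL2Z.
Qed.

Lemma L2N f : L2 f -> L2 (fun y => - f y).
Proof. by move=> /(@L2Z (-1)); congr L2; apply/funext => y; rewrite mulN1r. Qed.

Lemma L2B f g : L2 f -> L2 g -> L2 (fun y => f y - g y).
Proof. by move=> lf lg; apply: L2D => //; exact: L2N. Qed.

Lemma L2J f : L2 f -> L2 (fun y => conjc (f y)).
Proof.
move=> [fr fi]; split.
- by under eq_fun do rewrite cReJ.
- by under eq_fun do rewrite cImJ; exact: RL2N.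
Qed.

Lemma L2_cst (c : C) : L2 ((fun=> c) : Td -> C).
Proof. by split; exact: Lfun_cst. Qed.

Lemma L2_real u : u \in RL2 -> L2 (fun y => (u y)%:C).
Proof. by split => //=; exact: Lfun_cst. Qed.

Lemma L2M u f : essbounded u -> L2 f -> L2 (fun y => (u y)%:C * f y).
Proof.
move=> bu [fr fi]; split.
- by under eq_fun do rewrite cReM /= mul0r subr0; exact: RL2M.
- by under eq_fun do rewrite cImM /= mul0r addr0; exact: RL2M.
Qed.

Lemma L2_sum n (F : 'I_n -> Td -> C) :
  (forall i, L2 (F i)) -> L2 (fun y => \sum_i F i y).
Proof.
elim: n F => [|n IH] F lF.
  by under eq_fun do rewrite big_ord0; exact: L2_cst.
by under eq_fun do rewrite big_ord_recl; apply: L2D => //; exact: IH.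
Qed.

Lemma L2_Cintegrable f : L2 f -> Cintegrable f.
Proof. by move=> [fr fi]; split; exact: RL2_integrable. Qed.

Lemma L2_mul_Cintegrable f g : L2 f -> L2 g -> Cintegrable (fun y => f y * g y).
Proof.
move=> [fr fi] [gr gi]; split.
- under [X in integrable _ _ X]eq_fun do rewrite /= cReM.
  by apply: integrable_add; [|apply: integrable_opp]; exact: RL2_mul_integrable.
- under [X in integrable _ _ X]eq_fun do rewrite /= cImM.
  by apply: integrable_add; exact: RL2_mul_integrable.
Qed.

Definition ip f g : C := cint (fun y => f y * conjc (g y)).

Lemma ip_Cintegrable f g : L2 f -> L2 g -> Cintegrable (fun y => f y * conjc (g y)).
Proof. by move=> lf lg; apply: L2_mul_Cintegrable => //; exact: L2J. Qed.

Lemma ipDl f f' g : L2 f -> L2 f' -> L2 g ->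
  ip (fun y => f y + f' y) g = ip f g + ip f' g.
Proof.
move=> lf lf' lg; rewrite /ip -cintD//; try exact: ip_Cintegrable.
by congr cint; apply/funext => y; rewrite mulrDl.
Qed.

Lemma ipZl (c : C) f g : L2 f -> L2 g -> ip (fun y => c * f y) g = c * ip f g.
Proof.
move=> lf lg; rewrite /ip -cintZ//; try exact: ip_Cintegrable.
by congr cint; apply/funext => y; rewrite mulrA.
Qed.

Lemma ipC f g : L2 f -> L2 g -> ip g f = conjc (ip f g).
Proof.
move=> lf lg; rewrite /ip -cint_conj; last exact: ip_Cintegrable.
by congr cint; apply/funext => y; rewrite conjcM conjcK mulrC.
Qed.

Lemma ipDr f g g' : L2 f -> L2 g -> L2 g' ->
  ip f (fun y => g y + g' y) = ip f g + ip f g'.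
Proof.
move=> lf lg lg'; rewrite ipC//; last exact: L2D.
by rewrite ipDl// conjcD -!ipC.
Qed.

Lemma ipZr (c : C) f g : L2 f -> L2 g ->
  ip f (fun y => c * g y) = conjc c * ip f g.
Proof.
move=> lf lg; rewrite ipC//; last exact: L2Z.
by rewrite ipZl// conjcM -!ipC.
Qed.

Lemma ip_sumr n f (G : 'I_n -> Td -> C) : L2 f -> (forall i, L2 (G i)) ->
  ip f (fun y => \sum_i G i y) = \sum_i ip f (G i).
Proof.
move=> lf lG; rewrite /ip -cint_sum; last by move=> i; exact: ip_Cintegrable.
by congr cint; apply/funext => y; rewrite rmorph_sum mulr_sumr.
Qed.

Lemma ipNl f g : L2 f -> L2 g -> ip (fun y => - f y) g = - ip f g.
Proof.
move=> lf lg; rewrite -mulN1r -ipZl//.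
by congr ip; apply/funext => y; rewrite mulN1r.
Qed.

Lemma ipBl f f' g : L2 f -> L2 f' -> L2 g ->
  ip (fun y => f y - f' y) g = ip f g - ip f' g.
Proof. by move=> lf lf' lg; rewrite ipDl// ?ipNl//; exact: L2N. Qed.

Lemma eq_ip_ae f f' g g' : L2 f -> L2 f' -> L2 g -> L2 g' ->
  {ae P, forall y, f y = f' y} -> {ae P, forall y, g y = g' y} ->
  ip f g = ip f' g'.
Proof.
move=> lf lf' lg lg' ff' gg'; apply: cint_ae; try exact: ip_Cintegrable.
by apply: filterS2 ff' gg' => y -> ->.
Qed.

Lemma ip1r f : ip f (fun=> 1) = cint f.
Proof. by congr cint; apply/funext => y; rewrite rmorph1 mulr1. Qed.

Lemma sqr_normc_conj (a : C) : a * conjc a = (normc a ^+ 2)%:C.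
Proof. by rewrite normc_sqr; case: a => x y; apply: complexP => /=; ring. Qed.

Lemma ipxx f : ip f f = (L2norm f ^+ 2)%:C.
Proof.
rewrite /L2norm sqr_sqrtr; last by apply: Rintegral_ge0 => y _; exact: sqr_ge0.
rewrite /ip /cint; apply: complexP => /=.
- by apply: eq_Rintegral => y _; rewrite sqr_normc_conj.
- rewrite -[RHS](mul0r (fine (P setT))) -Rintegral_cst//.
  by apply: eq_Rintegral => y _; rewrite sqr_normc_conj.
Qed.

Lemma L2norm_ge0 f : 0 <= L2norm f. Proof. exact: sqrtr_ge0. Qed.

Lemma L2norm_eq0 f : L2 f -> L2norm f = 0 -> {ae P, forall y, f y = 0}.
Proof.
move=> [fr fi] f0.
have i2 : P.-integrable setT (EFin \o (fun y => normc (f y) ^+ 2)).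
  under [X in integrable _ _ X]eq_fun do rewrite /= normc_sqr !expr2.
  by apply: integrable_add; exact: RL2_mul_integrable.
have : (\int[P]_y (normc (f y) ^+ 2)%:E = 0)%E.
  move: f0 => /eqP; rewrite /L2norm sqrtr_eq0 => f0.
  have {f0} : \int[P]_y (normc (f y) ^+ 2) = 0.
    by apply/eqP; rewrite eq_le f0/= Rintegral_ge0// => y _; exact: sqr_ge0.
  rewrite /Rintegral => f0; rewrite -[LHS]fineK ?f0//.
  exact: integrable_fin_num.
rewrite (eq_integral (fun y => `|(normc (f y) ^+ 2)%:E|)%E); last first.
  by move=> y _; rewrite /= ger0_norm// sqr_ge0.
move/ae_eq_integral_abs => /(_ measurableT (measurable_int _ i2)).
apply: filterS => y /(_ I) /= [/eqP]; rewrite sqrf_eq0 => /eqP.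
exact: ComplexField.Normc.eq0_normc.
Qed.

Lemma normc_ge_ReIm (a : C) : `|complex.Re a| <= normc a /\ `|complex.Im a| <= normc a.
Proof.
by case: a => x y /=; split; rewrite -sqrtr_sqr ler_wsqrtr// ?lerDl ?lerDr sqr_ge0.
Qed.

Lemma Re_le_normc (a : C) : complex.Re a <= normc a.
Proof. exact: le_trans (ler_norm _) (normc_ge_ReIm a).1. Qed.

(** The squared norm of f - s z g, with z the pairing of f and g and s real, is a
    nonnegative polynomial in s. *)
Lemma Cauchy_Schwarz f g : L2 f -> L2 g -> normc (ip f g) <= L2norm f * L2norm g.
Proof.
move=> lf lg; set z := ip f g.
have pos (s : R) : 0 <= L2norm f ^+ 2 - 2 * s * normc z ^+ 2
    + s ^+ 2 * normc z ^+ 2 * L2norm g ^+ 2.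
  pose w := s%:C * z.
  have := sqr_ge0 (L2norm (fun y => f y - w * g y)).
  rewrite (_ : (fun y => f y - w * g y) = fun y => f y + (- w) * g y); last first.
    by apply/funext => y; rewrite mulNr.
  have lwg : L2 (fun y => - w * g y) by exact: L2Z.
  have := ipxx (fun y => f y + (- w) * g y).
  rewrite ipDl ?ipDr//; try exact: L2D.
  rewrite !ipZl// !ipZr// !ipxx (ipC lf lg) -/z /w.
  rewrite {}/w in lwg *; move: z {lwg} => z /(congr1 (@complex.Re R)); rewrite !ReImE /= => <-.
  by congr (0 <= _); rewrite normc_sqr; ring.
have z0 := normc_ge0 z; have f0 := L2norm_ge0 f; have g0 := L2norm_ge0 g.
rewrite -(@ler_pXn2r _ 2)// ?nnegrE ?mulr_ge0// exprMn.
have [g00|gn0] := eqVneq (L2norm g) 0.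
  rewrite g00 expr0n/= mulr0.
  rewrite leNgt; apply/negP => zp.
  (* the polynomial is then affine with a negative slope *)
  have := pos ((L2norm f ^+ 2 + 1) / normc z ^+ 2).
  by rewrite g00 expr0n/= mulr0 addr0 mulrA divfK ?gt_eqF//; nra.
have gp : 0 < L2norm g ^+ 2 by rewrite exprn_gt0// lt_neqAle eq_sym gn0.
(* the minimum of the polynomial *)
have := pos (L2norm g ^+ 2)^-1.
move=> H; rewrite -ler_pdivrMr// -subr_ge0; apply: le_trans H _.
by rewrite le_eqVlt; apply/orP; left; apply/eqP; field; exact: gn0.
Qed.

Lemma L2normD f g : L2 f -> L2 g ->
  L2norm (fun y => f y + g y) <= L2norm f + L2norm g.
Proof.
move=> lf lg; rewrite -(@ler_pXn2r _ 2)// ?nnegrE ?addr_ge0 ?L2norm_ge0//.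
have := ipxx (fun y => f y + g y).
rewrite ipDl ?ipDr//; try exact: L2D.
rewrite !ipxx (ipC lf lg) => /(congr1 (@complex.Re R)).
have := le_trans (Re_le_normc _) (Cauchy_Schwarz lf lg).
by move: (ip f g) => z; rewrite !ReImE /= => ? <-; nra.
Qed.

Lemma L2normZ (c : C) f : L2 f -> L2norm (fun y => c * f y) = normc c * L2norm f.
Proof.
move=> lf; apply/eqP; rewrite -(@eqrXn2 _ 2)// ?mulr_ge0 ?L2norm_ge0 ?normc_ge0//.
apply/eqP; have := ipxx (fun y => c * f y).
rewrite ipZl// ?ipZr//; last exact: L2Z.
rewrite mulrA sqr_normc_conj ipxx exprMn => /(congr1 (@complex.Re R)) /= <-.
by rewrite mul0r subr0.
Qed.
End complex_integrals.

(** * Integration by parts on the torus *)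

Section slices.
Variable R : realType.
Local Notation U := (uniform_prob (@ltr01 R)).

Definition upd n (k : 'I_n) (s : R) (y : torus R n) : torus R n :=
  [tuple (if i == k then s else tnth y i) | i < n].

Lemma upd_head n s x (y : torus R n) :
  upd ord0 s (tcons (x, y)) = tcons (s, y).
Proof.
apply: eq_from_tnth => i; rewrite tnth_mktuple.
by case: (unliftP ord0 i) => [j ->|->]; rewrite ?eqxx // eq_sym (negbTE (neq_lift _ _)) !tnthS.
Qed.

Lemma upd_tail n (k : 'I_n) s x (y : torus R n) :
  upd (lift ord0 k) s (tcons (x, y)) = tcons (x, upd k s y).
Proof.
apply: eq_from_tnth => i; rewrite tnth_mktuple.
case: (unliftP ord0 i) => [j ->|->]; last by rewrite (negbTE (neq_lift _ _)).
by rewrite (inj_eq lift_inj) !tnthS tnth_mktuple.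
Qed.

(** Fubini's theorem.  The product measure being built one coordinate at a time,
    the direction k is moved to the head of the tuple by induction. *)
Lemma integral_slices_eq0 n (k : 'I_n) (f : torus R n -> R) :
  measurable_fun setT f ->
  (torus_measure n).-integrable setT (EFin \o f) ->
  (forall y, \int[U]_s (f (upd k s y))%:E = 0)%E ->
  (\int[torus_measure n]_y (f y)%:E = 0)%E.
Proof.
elim: n k f => [[]//|n IH] k f mf intf f0.
have mF : measurable_fun setT (f \o @tcons R n).
  by apply: measurableT_comp => //; exact: measurable_tcons.
have intF : (U \x torus_measure n)%E.-integrable setT
    ((EFin \o f) \o @tcons R n).
  apply/integrableP; split; first exact/measurable_EFinP.
  move/integrableP : intf => [_]; rewrite /=.
  by rewrite ge0_integral_distribution//; do 2 apply: measurableT_comp => //.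
transitivity (\int[(U \x torus_measure n)%E]_z (f (tcons z))%:E)%E.
  rewrite [LHS]integral_distribution//; first exact/measurable_EFinP.
case: (unliftP ord0 k) => [j kj|k0].
- rewrite -integral12_prod_meas1//.
  rewrite -[RHS](integral0 U setT).
  apply: ae_eq_integral => //; first exact: (measurable_fubini_F intF).
  have := ae_integrable1 intF; apply: filterS => x /= intx _.
  rewrite /fubini_F (IH j (fun y => f (tcons (x, y))))//.
  + have /measurable_EFinP := measurable_int _ intx; exact.
  + by move=> y; rewrite -[RHS](f0 (tcons (x, y))) kj; under [RHS]eq_integral do rewrite upd_tail.
- rewrite -integral21_prod_meas1// -[RHS](integral0 (torus_measure n) setT).
  apply: eq_integral => y _; rewrite /fubini_G.
  rewrite -[RHS](f0 (tcons (0, y))) k0.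
  by under [RHS]eq_integral do rewrite upd_head.
Qed.

Lemma integral_uniformE (f : R -> R) : measurable_fun setT f ->
  (\int[U]_s (f s)%:E = \int[lebesgue_measure]_(s in `[0%R, 1%R]) (f s)%:E)%E.
Proof.
move=> mf; rewrite integralE [RHS]integralE.
have mf' : measurable_fun setT (EFin \o f) by exact/measurable_EFinP.
rewrite !integral_uniform ?subr0 ?invr1 ?mul1e//.
- exact: measurable_funeneg.
- exact: measurable_funepos.
Qed.

End slices.

Section integration_by_parts.
Variables (R : realType) (d : nat).
Local Notation Td := (torus R d).
Local Notation P := (torus_measure d : {measure set Td -> \bar R}).
Local Notation C := R[i].

Local Notation point := (@Defs.point R d).

Lemma point_upd (k : 'I_d) s (y : Td) :
  point (upd k s y) = point (upd k 0 y) + s *: delta_mx 0 k.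
Proof.
apply/rowP => i; rewrite !mxE !tnth_mktuple eqxx/=.
by case: (eqVneq i k) => [E|_]; rewrite ?mulr1 ?mulr0 ?add0r ?addr0.
Qed.

(** A partial derivative is an ordinary derivative along a line, to which the
    fundamental theorem of calculus applies. *)
Lemma is_derive_line (F : 'rV[R]_d -> R) x v (s : R) :
  differentiable F (x + s *: v) ->
  is_derive s 1 (fun s => F (x + s *: v)) ('D_v F (x + s *: v)).
Proof.
move=> dF.
have E : (fun h : R => h^-1 *: (((fun s => F (x + s *: v)) \o shift s) (h *: 1) - F (x + s *: v)))
   = (fun h => h^-1 *: ((F \o shift (x + s *: v)) (h *: v) - F (x + s *: v))).
  apply/funext => h /=; congr (_ *: (F _ - _)).
  rewrite [h%:A]mulr1 scalerDl. by rewrite addrCA.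
have := @diff_derivable _ _ _ _ _ v dF.
by split; rewrite /derivable /derive E.
Qed.

(** A continuous function of the coordinates is a limit of functions constant
    on the cells of finer and finer grids. *)
Lemma measurable_continuous_point (F : 'rV[R]_d -> R) : continuous F ->
  measurable_fun setT (fun y : Td => F (point y)).
Proof.
move=> cF.
pose grid (n : nat) (y : Td) : 'rV[int]_d := \row_i Num.floor (n.+1%:R * tnth y i).
pose pt (n : nat) (z : 'rV[int]_d) : 'rV[R]_d := \row_i ((z 0 i)%:~R / n.+1%:R).
apply: (@measurable_fun_cvg _ _ _ _ (fun n y => F (pt n (grid n y)))).
  move=> n _ A mA; rewrite setTI.
  rewrite (_ : _ @^-1` _ = \bigcup_(z : 'rV[int]_d)
     ([set y | grid n y = z] `&` [set y | A (F (pt n z))])); last first.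
    apply/seteqP; split => [y Ay|y [z _ [/= <-]]]//.
    by exists (grid n y).
  apply: countable_bigcupT_measurable; first exact: countableP.
  move=> z; have [Az|nAz] := pselect (A (F (pt n z))); last first.
    rewrite (_ : _ `&` _ = set0)//; last by apply/seteqP; split => // y [].
  rewrite (_ : _ `&` _ = \bigcap_(i in [set: 'I_d])
    ((fun y => tnth y i) @^-1` `[(z 0 i)%:~R / n.+1%:R, (z 0 i + 1)%:~R / n.+1%:R[%classic)).
    apply: fin_bigcap_measurable => // i _.
    by rewrite -[X in measurable X]setTI; apply: measurable_tnth.
  have n0 : (0 : R) < n.+1%:R by [].
  apply/seteqP; split => [y [/= <- _] i _ /=|y H].
    rewrite in_itv/= !mxE ler_pdivrMr// ltr_pdivlMr// mulrC.
    by rewrite floor_le_tmp ?floorD1_gt.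
  split => //=; apply/rowP => i; rewrite mxE.
  have := H i I; rewrite /= in_itv/= ler_pdivrMr// ltr_pdivlMr// mulrC => H'.
  exact: floor_def.
move=> y _; apply: (@cvg_comp _ _ _ (fun n => pt n (grid n y)) F); last exact: cF.
apply/cvgrPdist_le => e e0.
near=> n.
rewrite /Num.norm/= mx_normrE; apply/bigmax_leP; split; first exact: ltW.
move=> [i j] _ /=; rewrite ord1 !mxE.
have n0 : (0 : R) < n.+1%:R by [].
have /andP[fl fu] : (Num.floor (n.+1%:R * tnth y j))%:~R <= n.+1%:R * tnth y j
    < (Num.floor (n.+1%:R * tnth y j))%:~R + 1.
  by rewrite floor_le_tmp -[X in _ + X]/(1%:~R) -intrD floorD1_gt.
rewrite -(@ler_pM2l _ n.+1%:R)// -{1}(ger0_norm (ltW n0)) -normrM mulrBr mulrCA divff ?gt_eqF// mulr1.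
apply: (@le_trans _ _ 1).
  by rewrite ger0_norm ?subr_ge0// lerBlDl ltW.
rewrite -ler_pdivrMr// (@le_trans _ _ n%:R) ?ler_nat//.
by near: n; exact: nbhs_infty_ger.
Unshelve. all: by end_near.
Qed.

(** The boundary of the cube, where the coordinates of the torus are not
    injective, is negligible. *)
Lemma torus_cube : {ae P, forall y : Td, forall i, 0 < tnth y i < 1}.
Proof.
pose Q := [set y : Td | forall i, `]0%R, 1%R[%classic (tnth y i)].
have mQ : measurable Q.
  rewrite (_ : Q = \bigcap_(i in [set: 'I_d]) ((fun y => tnth y i) @^-1` `]0%R, 1%R[%classic)).
    apply: fin_bigcap_measurable => // i _.
    by rewrite -[X in measurable X]setTI; apply: measurable_tnth.
  by apply/seteqP; split => [y H i _|y H i]; [exact: H|exact: (H i)].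
have PQ : P Q = 1%E.
  rewrite [LHS](@torus_measure_box R d (fun=> `]0%R, 1%R[%classic))// big1// => i _.
  rewrite (_ : _ `&` _ = `]0%R, 1%R[%classic); last first.
    apply/setIidl => x /=; rewrite !in_itv/= => /andP[? ?]; apply/andP; split; exact: ltW.
  by rewrite lebesgue_measure_itv/= lte01 sube0.
exists (~` Q); split; first exact: measurableC.
- have := probability_setC (torus_measure d) mQ; rewrite [X in (_ - X)%E]PQ subee// => ->.
- by move=> y /= H Qy; apply: H => i; have := Qy i; rewrite /= in_itv.
Qed.

(** On the unit cube the function is bounded by compactness, and the cube has
    full measure. *)
Lemma essbounded_continuous_point (F : 'rV[R]_d -> R) : continuous F ->
  essbounded (fun y : Td => F (point y)).
Proof.
move=> cF; split; first exact: measurable_continuous_point.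
have : compact (F @` [set v : 'rV[R]_d | forall i, `[0%R, 1%R]%classic (v ord0 i)]).
  apply: continuous_compact; first exact: continuous_subspaceT.
  by apply: (@rV_compact R d (fun=> `[0%R, 1%R]%classic)) => i; exact: segment_compact.
move=> /compact_bounded [M [_ MF]]; exists (M + 1).
have M1 : M < M + 1 by rewrite ltrDl.
apply: filterS torus_cube => y y01; apply: (MF _ M1) => /=.
exists (point y) => // i; rewrite /= mxE in_itv/=.
by have /andP[/ltW -> /ltW ->] := y01 i.
Qed.

(** The fundamental theorem of calculus along each circle in the direction k:
    the increment of a periodic function over a period is zero. *)
Lemma integral_partial_eq0 (k : 'I_d) (F : 'rV[R]_d -> R) :
  (forall x, F (x + delta_mx 0 k) = F x) ->
  (forall x, differentiable F x) -> continuous (partial k F) ->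
  (\int[P]_y (partial k F (point y))%:E = 0)%E.
Proof.
move=> perF dF cF.
have bF := essbounded_continuous_point cF.
apply: (@integral_slices_eq0 _ _ k); first exact: bF.1.
  exact: RL2_integrable (RL2_bounded bF).
move=> y; set x := point (upd k 0 y).
have cline : continuous (fun s : R => x + s *: (delta_mx 0 k : 'rV[R]_d)).
  by move=> s; apply: cvgD; [exact: cvg_cst|apply: cvgZl; exact: cvg_id].
have cg : continuous (fun s : R => partial k F (x + s *: delta_mx 0 k)).
  by move=> s; apply: continuous_comp; [exact: cline|exact: cF].
under eq_integral do rewrite point_upd -/x.
rewrite integral_uniformE; last exact: continuous_measurable_fun.
have dl (s : R) := is_derive_line (v := delta_mx 0 k) (dF (x + s *: delta_mx 0 k)).
rewrite (@continuous_FTC2 _ _ (fun s : R => F (x + s *: delta_mx 0 k)))//.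
- by rewrite scale1r perF scale0r addr0 subee.
- exact: continuous_subspaceT.
- have cF' : continuous (fun s : R => F (x + s *: delta_mx 0 k)).
    move=> s; apply: differentiable_continuous; apply/derivable1_diffP.
    exact: ex_derive.
  split.
  + by move=> s _; exact: ex_derive.
  + exact: cvg_at_right_filter (cF' _).
  + exact: cvg_at_left_filter (cF' _).
- by move=> s _; rewrite derive1E derive_val.
Qed.

End integration_by_parts.

(** * Trigonometric test functions *)

Section trigonometric_functions.
Variables (R : realType) (d : nat).
Local Notation Td := (torus R d).
Local Notation P := (torus_measure d : {measure set Td -> \bar R}).
Local Notation point := (@Defs.point R d).

(** The phase c makes the family stable, up to real factors, under both partial
    derivatives and products, with no separate treatment of sines. *)
Definition trig (n : 'I_d -> int) (c : R) (x : 'rV[R]_d) : R :=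
  cos ((pi *+ 2) * (\sum_i (n i)%:~R * x 0 i) + c).

Lemma cosD2pi_int (x : R) (n : int) : cos (x + (pi *+ 2) *~ n) = cos x.
Proof.
case: n => n; first by rewrite -pmulrn (periodicn (@cosD2pi R)).
by rewrite NegzE mulrNz -pmulrn -[LHS](periodicn (@cosD2pi R) n.+1) subrK.
Qed.

Lemma trig_periodic n c k x : trig n c (x + delta_mx 0 k) = trig n c x.
Proof.
rewrite /trig (_ : \sum_i _ = (\sum_i (n i)%:~R * x 0 i) + (n k)%:~R); last first.
  under eq_bigr do rewrite !mxE mulrDr eqxx/=.
  rewrite big_split/=; congr (_ + _).
  rewrite (bigD1 k)//= eqxx mulr1 big1 ?addr0// => i /negbTE ->.
  by rewrite mulr0.
by rewrite mulrDr addrAC mulrzr cosD2pi_int.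
Qed.

Lemma trigM n m c e x : trig n c x * trig m e x =
  2^-1 * (trig (fun i => n i + m i) (c + e) x + trig (fun i => n i - m i) (c - e) x).
Proof.
rewrite /trig.
rewrite (_ : \sum_i (n i + m i)%:~R * x 0 i =
  \sum_i (n i)%:~R * x 0 i + \sum_i (m i)%:~R * x 0 i); last first.
  by rewrite -big_split/=; apply: eq_bigr => i _; rewrite intrD mulrDl.
rewrite (_ : \sum_i (n i - m i)%:~R * x 0 i =
  \sum_i (n i)%:~R * x 0 i - \sum_i (m i)%:~R * x 0 i); last first.
  by rewrite -sumrB; apply: eq_bigr => i _; rewrite intrD mulrNz mulrDl mulNr.
set a := \sum_i (n i)%:~R * _; set b := \sum_i (m i)%:~R * _.
rewrite (_ : _ * (a + b) + (c + e) = (pi *+ 2 * a + c) + (pi *+ 2 * b + e)); last by ring.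
rewrite (_ : _ * (a - b) + (c - e) = (pi *+ 2 * a + c) - (pi *+ 2 * b + e)); last by ring.
set p := _ + c; set q := _ + e; by rewrite (cosD p) cosB; field.
Qed.

Lemma differentiable_phase n c (x : 'rV[R]_d) :
  differentiable (fun x : 'rV[R]_d => (pi *+ 2) * (\sum_i (n i)%:~R * x 0 i) + c : R) x.
Proof.
apply: differentiableD; last exact: differentiable_cst.
apply: differentiableZ.
rewrite (_ : (fun x : 'rV[R]_d => _) = \sum_(i < d) (fun x : 'rV[R]_d => (n i)%:~R * x 0 i : R)); last first.
  by apply/funext => z; rewrite fct_sumE.
apply: differentiable_sum => i; apply: differentiableZ.
exact: differentiable_coord.
Qed.

Lemma differentiable_trig n c x : differentiable (trig n c) x.
Proof.
apply: (@differentiable_comp _ _ _ _ _ cos); first exact: differentiable_phase.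
by apply/derivable1_diffP; exact: ex_derive.
Qed.

Lemma trig_line n c k (x : 'rV[R]_d) (s : R) : trig n c (x + s *: delta_mx 0 k) =
  cos ((pi *+ 2) * (n k)%:~R * s + (pi *+ 2 * (\sum_i (n i)%:~R * x 0 i) + c)).
Proof.
rewrite /trig addrA -mulrA -mulrDr; congr (cos (_ * _ + _)).
under eq_bigr do rewrite !mxE mulrDr eqxx/=.
rewrite big_split/= addrC; congr (_ + _).
rewrite (bigD1 k)//= eqxx mulr1 big1 ?addr0// => i /negbTE ->.
by rewrite !mulr0.
Qed.

Lemma partial_trig k n c :
  partial k (trig n c) = (fun x => (pi *+ 2) * (n k)%:~R * trig n (c + pi / 2) x).
Proof.
apply/funext => x; rewrite /partial.
have := is_derive_line (v := delta_mx 0 k) (s := 0) (differentiable_trig n c (x + 0 *: delta_mx 0 k)).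
rewrite scale0r addr0 => /@derive_val <-.
have -> : (fun s => trig n c (x + s *: delta_mx 0 k)) =
    cos \o (fun s => (pi *+ 2) * (n k)%:~R * s + (pi *+ 2 * (\sum_i (n i)%:~R * x 0 i) + c)).
  by apply/funext => s; exact: trig_line.
set b := _ + c; set a := _ * _.
have H1 : is_derive (0 : R) 1 (fun s => a * s + b) a.
  have -> : (fun s => a * s + b) = (a *: (@id R)) + cst b by apply/funext.
  by apply: is_derive_eq; rewrite addr0 [_%:A]mulr1.
have := @is_derive1_comp R cos _ 0 _ _ (is_derive_cos _) H1.
move=> /@derive_val ->; rewrite mulr0 add0r mulrC; congr (_ * _).
by rewrite /trig addrA cosDpihalf.
Qed.

(** Every derivation shifts the phase by a quarter of a period. *)
Lemma foldr_partial_trig s a n c : exists a' c',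
  foldr (@partial R d) (fun x => a * trig n c x) s = (fun x => a' * trig n c' x).
Proof.
elim: s a c => [|k s IH] a c; first by exists a, c.
have [a' [c' /= ->]] := IH a c.
exists (a' * ((pi *+ 2) * (n k)%:~R)), (c' + pi / 2).
apply/funext => x; rewrite -[RHS]mulrA -[X in _ = a' * X](congr1 (fun f => f x) (partial_trig k n c')).
by rewrite /partial (@deriveZ _ _ _ (trig n c') a')//; apply: diff_derivable; exact: differentiable_trig.
Qed.

Lemma test_function_trig a n c : test_function (fun x => a * trig n c x).
Proof.
split=> [k x|s x]; first by rewrite trig_periodic.
have [a' [c' ->]] := foldr_partial_trig s a n c.
by apply: differentiableZ; exact: differentiable_trig.
Qed.

Lemma continuous_trig n c : continuous (trig n c).
Proof. by move=> x; apply: differentiable_continuous; exact: differentiable_trig. Qed.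

Lemma trig0 : trig (fun=> 0) 0 = (fun=> 1).
Proof.
by apply/funext => x; rewrite /trig big1 ?mulr0 ?addr0 ?cos0// => i _; rewrite mul0r.
Qed.

End trigonometric_functions.

Section totality.
Variables (R : realType) (d : nat).
Local Notation Td := (torus R d).
Local Notation P := (torus_measure d : {measure set Td -> \bar R}).
Local Notation point := (@Defs.point R d).

Definition incube (y : Td) := forall i, 0 < tnth y i < 1.

(** The bounded measurable functions generated by the trigonometric functions
    under linear combinations and bounded pointwise limits.  Whatever is
    orthogonal to the trigonometric functions is orthogonal to this class, by
    dominated convergence, and the class turns out to contain every indicator
    function.  The limits are only required in the open cube, where the
    coordinates are determined by their cosines and sines. *)
Inductive trig_class : (Td -> R) -> Prop :=
| trig_class_trig n c : trig_class (fun y => trig n c (point y))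
| trig_classD u v : trig_class u -> trig_class v -> trig_class (fun y => u y + v y)
| trig_classZ a u : trig_class u -> trig_class (fun y => a * u y)
| trig_class_lim (u_ : nat -> Td -> R) (u : Td -> R) (M : R) :
    (forall n, trig_class (u_ n)) -> (forall n y, `|u_ n y| <= M) ->
    measurable_fun setT u -> (forall y, `|u y| <= M) ->
    (forall y, incube y -> u_ n y @[n --> \oo] --> u y) -> trig_class u.

Lemma trig_class_bounded u : trig_class u ->
  measurable_fun setT u /\ exists M, forall y, `|u y| <= M.
Proof.
elim=> {u} [n c|u v _ [mu [M uM]] _ [mv [N vN]]|a u _ [mu [M uM]]|u_ u M _ _ _ mu uM _].
- split; first by apply: measurable_continuous_point; exact: continuous_trig.
  by exists 1 => y; rewrite ler_norml cos_geN1 cos_le1.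
- split; first exact: measurable_funD.
  by exists (M + N) => y; rewrite (le_trans (ler_normD _ _))// lerD.
- split; first exact: measurable_funM.
  by exists (`|a| * M) => y; rewrite normrM ler_wpM2l.
- by split=> //; exists M.
Qed.

(** The product formula for cosines settles the generators; the other
    constructors commute with the multiplication by a bounded function, so that
    an induction on each factor suffices. *)
Lemma trig_classM u v : trig_class u -> trig_class v -> trig_class (fun y => u y * v y).
Proof.
move=> hu; elim: hu v => {u} [n c|u u' _ IHu _ IHu'|a u _ IHu|u_ u M uc IHu uM mu uM' ul] v hv.
- elim: hv => {v} [m e|v v' _ IHv _ IHv'|a v _ IHv|v_ v M vc IHv vM mv vM' vl].
  + rewrite (_ : (fun y => _) = (fun y => 2^-1 * (trig (fun i => n i + m i) (c + e) (point y)
      + trig (fun i => n i - m i) (c - e) (point y)))); last first.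
      by apply/funext => y; rewrite trigM.
    by apply/trig_classZ/trig_classD; exact: trig_class_trig.
  + under eq_fun do rewrite mulrDr; exact: trig_classD.
  + under eq_fun do rewrite mulrCA; exact: trig_classZ.
  + have t1 y : `|trig n c (point y)| <= 1 by rewrite ler_norml cos_geN1 cos_le1.
    apply: (trig_class_lim (M := M) IHv).
    * by move=> k y; rewrite normrM -[M]mul1r ler_pM.
    * by apply: measurable_funM => //; apply: measurable_continuous_point; exact: continuous_trig.
    * by move=> y; rewrite normrM -[M]mul1r ler_pM.
    * by move=> y yQ; apply: cvgM (vl y yQ); exact: cvg_cst.
- under eq_fun do rewrite mulrDl; apply: trig_classD; [exact: IHu|exact: IHu'].
- under eq_fun do rewrite -mulrA; apply: trig_classZ; exact: IHu.
- have [mv [N vN]] := trig_class_bounded hv.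
  apply: (trig_class_lim (M := M * N) (fun n => IHu n v hv)).
  + by move=> k y; rewrite normrM ler_pM.
  + exact: measurable_funM.
  + by move=> y; rewrite normrM ler_pM.
  + by move=> y yQ; apply: cvgM (ul y yQ) _; exact: cvg_cst.
Qed.

Lemma trig_class_cst a : trig_class (fun=> a).
Proof.
rewrite (_ : (fun=> a) = fun y : Td => a * trig (fun=> 0) 0 (point y)).
  by apply: trig_classZ; exact: trig_class_trig.
by apply/funext => y; rewrite trig0 mulr1.
Qed.

Lemma trig_classX u k : trig_class u -> trig_class (fun y => u y ^+ k).
Proof.
move=> uc; elim: k => [|k IH]; first exact: trig_class_cst.
by under eq_fun do rewrite exprS; exact: trig_classM.
Qed.

(** The partial sums of the exponential series are polynomials in u, and they
    are bounded by the exponential of a bound of u. *)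
Lemma trig_class_exp u : trig_class u -> trig_class (fun y => expR (u y)).
Proof.
move=> uc; have [mu [M uM]] := trig_class_bounded uc.
have eM (x : R) n : `|x| <= M -> `|series (exp_coeff x) n| <= expR M.
  move=> xM; have M0 : 0 <= M by exact: le_trans xM.
  rewrite (le_trans (ler_norm_sum _ _ _))//.
  apply: (@le_trans _ _ (series (exp_coeff M) n)).
    apply: ler_sum => i _; rewrite /exp_coeff/= normrM normrX.
    by rewrite [`|_^-1|]ger0_norm// ler_wpM2r// lerXn2r// nnegrE.
  apply: nondecreasing_cvgn_le; last exact: is_cvg_series_exp_coeff.
  by apply: nondecreasing_series => i _ _; rewrite /exp_coeff/= divr_ge0// exprn_ge0.
apply: (trig_class_lim (u_ := fun n y => series (exp_coeff (u y)) n) (M := expR M)).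
- elim=> [|n IH].
    by under eq_fun do rewrite /series/= big_geq//; exact: trig_class_cst.
  under eq_fun do rewrite seriesSr /exp_coeff/= mulrC.
  by apply: trig_classD => //; apply: trig_classZ; exact: trig_classX.
- by move=> n y; exact: eM.
- exact: measurableT_comp.
- by move=> y; rewrite ger0_norm ?expR_ge0// ler_expR (le_trans (ler_norm _)).
- by move=> y _; exact: is_cvg_series_exp_coeff.
Qed.

Lemma trig_class_eq (u v : Td -> R) : trig_class u -> measurable_fun setT v ->
  (exists M, forall y, `|v y| <= M) -> (forall y, incube y -> u y = v y) -> trig_class v.
Proof.
move=> uc mv [M vM] uv; have [mu [N uN]] := trig_class_bounded uc.
apply: (trig_class_lim (u_ := fun=> u) (M := Num.max N M)) => //.
- by move=> _ y; rewrite le_max uN.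
- by move=> y; rewrite le_max vM orbT.
- by move=> y yQ; rewrite -uv//; exact: cvg_cst.
Qed.

(** The indicator of a superlevel set is reached in two limits: exp(-exp(-np))
    tends to 1, 1/e or 0 according to the sign of p, and the powers of that
    limit keep the value 1 only. *)
Lemma trig_class_pos p : trig_class p -> trig_class (fun y => ((0 < p y)%R)%:R).
Proof.
move=> pc; have [mp _] := trig_class_bounded pc.
pose L (y : Td) : R := if 0 < p y then 1 else if p y < 0 then 0 else expR (- 1).
have e1 : `|expR (- 1) : R| < 1 by rewrite ger0_norm ?expR_ge0// expR_lt1 oppr_lt0.
have L01 y : 0 <= L y <= 1.
  by rewrite /L; case: ifP => _; [|case: ifP => _]; rewrite ?ler01 ?lexx// expR_ge0/= expR_le1 oppr_le0.
have mpos : measurable [set y | 0 < p y].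
  by have := mp measurableT _ (measurable_itv `]0%R, +oo[); rewrite setTI; congr measurable;
     apply/seteqP; split => y; rewrite /= in_itv/= andbT.
have mneg : measurable [set y | p y < 0].
  by have := mp measurableT _ (measurable_itv `]-oo, 0%R[); rewrite setTI; congr measurable;
     apply/seteqP; split => y; rewrite /= in_itv/=.
have mL : measurable_fun setT L.
  apply: measurable_fun_ifT => //=.
    by apply: (measurable_fun_bool true); rewrite setTI; move: mpos; congr measurable;
       apply/seteqP; split => y /=.
  apply: measurable_fun_ifT => //=.
  by apply: (measurable_fun_bool true); rewrite setTI; move: mneg; congr measurable;
     apply/seteqP; split => y /=.
have Lc : trig_class L.
  apply: (trig_class_lim (u_ := fun n y => expR (- 1 * expR (- n%:R * p y))) (M := 1)) => //.
  - by move=> n; apply/trig_class_exp/trig_classZ/trig_class_exp/trig_classZ.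
  - by move=> n y; rewrite ger0_norm ?expR_ge0// expR_le1 mulN1r oppr_le0 expR_ge0.
  - by move=> y; have /andP[? ?] := L01 y; rewrite ger0_norm.
  - move=> y _; under eq_fun do rewrite mulN1r mulNr -mulrN expRM_natl.
    rewrite /L; case: ltrgtP => p0.
    + have zc : - expR (- p y) ^+ n @[n --> \oo] --> (0 : R).
        rewrite -oppr0; apply: cvgN.
        by apply: cvg_expr; rewrite ger0_norm ?expR_ge0// expR_lt1 oppr_lt0.
      by have := cvg_comp _ _ zc (@continuous_expR R 0); rewrite expR0.
    + apply: (@squeeze_cvgr _ _ _ _ (cst 0) (fun n => expR (p y) ^+ n)).
      * apply: nearW => n; rewrite expR_ge0/= -[X in expR (- X)]invrK -exprVn -expRN opprK.
        set z := _ ^+ n; have z0 : 0 < z by rewrite exprn_gt0// expR_gt0.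
        rewrite expRN -[leRHS]invrK lef_pV2 ?posrE ?invr_gt0 ?expR_gt0//.
        by apply: le_trans (expR_ge1Dx _); rewrite lerDr.
      * exact: cvg_cst.
      * by apply: cvg_expr; rewrite ger0_norm ?expR_ge0// expR_lt1.
    + rewrite -p0 oppr0 expR0.
      by under eq_fun do rewrite expr1n; exact: cvg_cst.
apply: (trig_class_lim (u_ := fun n y => L y ^+ n) (M := 1)).
- by move=> n; exact: trig_classX.
- by move=> n y; have /andP[? ?] := L01 y; rewrite normrX ger0_norm// exprn_ile1.
- have -> : (fun y => ((0 < p y)%R)%:R) = \1_[set y | 0 < p y] :> (Td -> R).
    by apply/funext => y; rewrite indicE; congr (nat_of_bool _)%:R; apply/idP/idP; rewrite inE.
  exact: measurable_indic.
- by move=> y; case: (0 < p y); rewrite ?normr1 ?normr0.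
- move=> y _; rewrite /L; case: ltrgtP => p0 /=.
  + by under eq_fun do rewrite expr1n; exact: cvg_cst.
  + by apply: cvg_expr; rewrite normr0.
  + exact: cvg_expr.
Qed.

Definition trig_set (A : set Td) := measurable A /\ trig_class (\1_A).

Lemma indic_bounded (A : set Td) : exists M : R, forall y, `|\1_A y| <= M.
Proof. by exists 1 => y; rewrite indicE; case: (_ \in _); rewrite ?normr1 ?normr0. Qed.

Lemma trig_setC (A : set Td) : trig_set A -> trig_set (~` A).
Proof.
move=> [mA tA]; split; first exact: measurableC.
rewrite (_ : \1_(~` A) = fun y => 1 + -1 * \1_A y).
  by apply: trig_classD; [exact: trig_class_cst|exact: trig_classZ].
by apply/funext => y; rewrite !indicE in_setC; case: (_ \in _); rewrite /= ?mulr1 ?mulr0 ?addr0 ?subrr.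
Qed.

(** At a given point the finite products of indicators are eventually
    constant. *)
Lemma trig_set_bigcap (A : nat -> set Td) :
  (forall n, trig_set (A n)) -> trig_set (\bigcap_n A n).
Proof.
move=> tA; have mA : measurable (\bigcap_n A n).
  by apply: bigcapT_measurable => n; exact: (tA n).1.
split=> //.
have bnd n y : `|\prod_(k < n) \1_(A k) y : R| <= 1.
  rewrite normr_prod; apply: prodr_ile1 => k _.
  by rewrite indicE; case: (_ \in _); rewrite ?normr1 ?normr0 ?lexx ?ler01.
apply: (trig_class_lim (u_ := fun n y => \prod_(k < n) \1_(A k) y) (M := 1)).
- elim=> [|n IH].
    by under eq_fun do rewrite big_ord0; exact: trig_class_cst.
  by under eq_fun do rewrite big_ord_recr/=; apply: trig_classM => //; exact: (tA n).2.
- exact: bnd.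
- exact: measurable_indic.
- by move=> y; rewrite indicE; case: (_ \in _); rewrite ?normr1 ?normr0.
- move=> y _; have [yA|nyA] := pselect ((\bigcap_n A n) y).
    rewrite indicE mem_set//; apply: cvg_near_cst; apply: nearW => n.
    by rewrite big1// => k _; rewrite indicE mem_set//; exact: yA.
  rewrite indicE memNset//; apply: cvg_near_cst.
  have [k nAk] : exists k, ~ A k y.
    by apply: contrapT => H; apply: nyA => k _; apply: contrapT => nA; apply: H; exists k.
  exists k.+1 => // n /= kn.
  by rewrite (bigD1 (Ordinal kn))//= indicE memNset// mul0r.
Qed.

Lemma trig_set_cst (A : set Td) : measurable A ->
  (forall y, incube y -> A y) -> trig_set A.
Proof.
move=> mA QA; split=> //; apply: (trig_class_eq (trig_class_cst 1)).
- exact: measurable_indic.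
- exact: indic_bounded.
- by move=> y /QA Ay; rewrite indicE mem_set.
Qed.

(** For x in ]0, 1[ and 0 < a < 1,
    cos (2 pi x - pi a) - cos (pi a) = 2 sin (pi x) sin (pi (a - x))
    has the sign of a - x, so that the interval ]0, a[ is a superlevel set of a
    trigonometric function. *)
Lemma trig_set_ray i (a : R) : trig_set [set y : Td | tnth y i < a].
Proof.
have mray : measurable [set y : Td | tnth y i < a].
  have := @measurable_tnth _ (measurableTypeR R) d i measurableT _ (measurable_itv `]-oo, a[).
  by rewrite setTI; congr measurable; apply/seteqP; split => y; rewrite /= in_itv.
have [a0|a0] := leP a 0.
  rewrite (_ : mkset _ = ~` [set y : Td | a <= tnth y i]); last first.
    by apply/seteqP; split => y /=; rewrite ltNge => /negP.
  apply: trig_setC; apply: trig_set_cst.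
    have := measurableC mray; congr measurable; apply/seteqP; split => y /=.
      by move=> /negP; rewrite -leNgt.
    by rewrite leNgt => /negP.
  by move=> y yQ /=; rewrite (le_trans a0)//; have /andP[/ltW] := yQ i.
have [a1|a1] := leP 1 a.
  by apply: trig_set_cst => // y yQ /=; rewrite (lt_le_trans _ a1)//; have /andP[] := yQ i.
split=> //.
pose n (j : 'I_d) : int := (j == i)%:R.
apply: (trig_class_eq (u := fun y =>
    (0 < trig n (- (pi * a)) (point y) + - cos (pi * a))%R%:R)).
- by apply: trig_class_pos; apply: trig_classD; [exact: trig_class_trig|exact: trig_class_cst].
- exact: measurable_indic.
- exact: indic_bounded.
move=> y /(_ i) /andP[y0 y1]; rewrite indicE; congr (nat_of_bool _)%:R.
rewrite /trig (_ : \sum_j _ = tnth y i); last first.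
  rewrite (bigD1 i)//= /n eqxx mul1r mxE big1 ?addr0// => j /negbTE ->.
  by rewrite mul0r.
set x := tnth y i in y0 y1 *.
have -> : cos (pi *+ 2 * x - pi * a) - cos (pi * a) = 2 * sin (pi * x) * sin (pi * (a - x)).
  rewrite (_ : pi *+ 2 * x - pi * a = pi * x - pi * (a - x)); last by ring.
  rewrite [in X in _ - X](_ : pi * a = pi * x + pi * (a - x)); last by ring.
  by rewrite cosB cosD; ring.
have spos (z : R) : 0 < z < 1 -> 0 < sin (pi * z).
  move=> /andP[z0 z1]; apply: sin_gt0_pi.
  by rewrite mulr_gt0 ?pi_gt0//= -[ltRHS]mulr1 ltr_pM2l ?pi_gt0.
rewrite pmulr_rgt0; last by rewrite mulr_gt0// spos// y0.
apply/idP/idP; rewrite inE /= -/x => H.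
  rewrite ltNge; apply/negP => ax; move: H; rewrite -opprB mulrN sinN oppr_gt0 ltNge => /negP; apply.
  move: ax; rewrite le_eqVlt => /orP[/eqP ->|ax]; first by rewrite subrr mulr0 sin0.
  by apply/ltW/spos; rewrite subr_gt0 ax/=; lra.
by apply: spos; rewrite subr_gt0 H/=; lra.
Qed.

Lemma trig_set_sigma : sigma_algebra setT trig_set.
Proof.
split.
- by rewrite -setCT; apply: trig_setC; exact: trig_set_cst.
- by move=> A; rewrite setTD; exact: trig_setC.
- move=> A tA; rewrite -[X in trig_set X]setCK setC_bigcup.
  by apply/trig_setC/trig_set_bigcap => n; apply: trig_setC.
Qed.

(** The sets with indicator in the class form a sigma-algebra, and the
    measurable sets of the torus are generated by the rays of the coordinates. *)
Lemma trig_set_measurable (A : set Td) : measurable A -> trig_set A.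
Proof.
suff H : forall i, preimage_set_system setT (fun y : Td => tnth y i) measurable `<=` trig_set.
  move: A; apply: smallest_sub; first exact: trig_set_sigma.
apply: (big_ind (fun B => B `<=` trig_set)) => // B C HB HC.
  by rewrite subUset.
move=> i _ [B mB <-]; rewrite setTI.
suff : <<s RGenInftyO.G (R := R) >> `<=` [set B | trig_set ((fun y : Td => tnth y i) @^-1` B)].
  by apply; rewrite -[X in X B]RGenInftyO.measurableE.
apply: smallest_sub.
  have [t0 tC tU] := trig_set_sigma.
  split => [|C|C tC']; rewrite /= ?preimage_set0// ?setTD.
    by rewrite preimage_setC; exact: trig_setC.
  by rewrite preimage_bigcup; exact: tU.
move=> _ [a ->] /=; have := trig_set_ray i a; congr trig_set.
Qed.

(** The sign of h belongs to [trig_class], and the pairing of h with its sign is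
    the integral of |h|. *)
Lemma trig_total (h : Td -> R) : P.-integrable setT (EFin \o h) ->
  (forall n c, \int[P]_y (h y * trig n c (point y))%:E = 0)%E ->
  {ae P, forall y, h y = 0}.
Proof.
move=> ih h0.
have mh : measurable_fun setT h by apply/measurable_EFinP; exact: measurable_int ih.
have ihu u : trig_class u -> P.-integrable setT (EFin \o (fun y => h y * u y)).
  move=> /trig_class_bounded[mu [M uM]].
  apply: (@le_integrable _ _ _ P setT measurableT _
    (EFin \o (fun y => `|M| * `|h y|))).
  - by apply/measurable_EFinP; exact: measurable_funM.
  - move=> y _ /=; rewrite lee_fin !normrM !normr_id mulrC ler_wpM2r//.
    by rewrite (le_trans (uM y))// ler_norm.
  - exact: (integrable_scale `|M| (integrable_norm ih)).
have orth u : trig_class u -> (\int[P]_y (h y * u y)%:E = 0)%E.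
  elim=> {u} [n c|u v uc IHu vc IHv|a u uc IHu|u_ u M uc IHu uM mu uM' ul]; first exact: h0.
  - under eq_integral do rewrite mulrDr EFinD.
    rewrite integralD//; [|exact: ihu|exact: ihu].
    by rewrite IHu IHv adde0.
  - under eq_integral do rewrite mulrCA EFinM.
    rewrite integralZl//; last exact: ihu.
    by rewrite IHu mule0.
  - have [] := @dominated_convergence _ _ R P setT measurableT
      (fun n y => (h y * u_ n y)%:E) (fun y => (h y * u y)%:E)
      (fun y => (M * `|h y|)%:E).
    + by move=> n; apply: measurable_int (ihu _ (uc n)).
    + by apply/measurable_EFinP; exact: measurable_funM.
    + apply: filterS (@torus_cube R d) => y yQ _.
      apply: cvg_EFin; first exact: nearW.
      by apply: cvgM; [exact: cvg_cst|exact: ul].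
    + exact: (integrable_scale M (integrable_norm ih)).
    + apply: nearW => y n _; rewrite lee_fin normrM mulrC ler_wpM2r//.
    + move=> _ _; rewrite /= (_ : (fun n => _) = cst 0%E); last first.
        by apply/funext => n; exact: IHu.
      by move=> /(cvg_lim (@ereal_hausdorff _)) <-; rewrite lim_cst.
pose A := [set y | 0 < h y].
have mA : measurable A.
  by have := mh measurableT _ (measurable_itv `]0%R, +oo[); rewrite setTI; congr measurable;
     apply/seteqP; split => y; rewrite /= in_itv/= andbT.
have tA : trig_class (fun y => 2 * \1_A y + -1).
  by apply: trig_classD; [apply: trig_classZ; exact: (trig_set_measurable mA).2|exact: trig_class_cst].
have := orth _ tA.
rewrite (eq_integral (fun y => `|(h y)%:E|)%E); last first.
  move=> y _; rewrite /= indicE; congr EFin.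
  have [Ay|nAy] := pselect (A y).
    by rewrite mem_set//= gtr0_norm//; ring.
  rewrite memNset//= ler0_norm; first by ring.
  by rewrite leNgt; apply/negP.
move/ae_eq_integral_abs => /(_ measurableT (measurable_int _ ih)).
by apply: filterS => y /(_ I) /= [].
Qed.

End totality.

(** * Weak derivatives *)

Section weak_derivatives.
Variables (R : realType) (d : nat).
Local Notation C := R[i].
Local Notation Td := (torus R d).
Local Notation P := (torus_measure d : {measure set Td -> \bar R}).
Local Notation point := (@Defs.point R d).
Local Notation comp := (@Defs.comp R d).
Implicit Types (f g h : Td -> C) (psi : 'rV[R]_d -> R) (k l : 'I_d).

Lemma test_function_diff psi x : test_function psi -> differentiable psi x.
Proof. by move=> [_ /(_ [::])]. Qed.

Lemma essbounded_test psi : test_function psi -> essbounded (fun y : Td => psi (point y)).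
Proof.
move=> tpsi; apply: essbounded_continuous_point => x.
exact/differentiable_continuous/test_function_diff.
Qed.

Lemma continuous_partial psi k : test_function psi -> continuous (partial k psi).
Proof. by move=> [_ /(_ [:: k]) dpsi] x; exact: differentiable_continuous. Qed.

Lemma essbounded_partial psi k : test_function psi ->
  essbounded (fun y : Td => partial k psi (point y)).
Proof. by move=> tpsi; apply: essbounded_continuous_point; exact: continuous_partial. Qed.

Lemma test_function_trig1 n c : test_function (@trig R d n c).
Proof. by have := @test_function_trig R d 1 n c; under eq_fun do rewrite mul1r. Qed.

Lemma L2_mul_bounded f (u : Td -> R) : L2 f -> essbounded u ->
  Cintegrable (fun y => f y * (u y)%:C).
Proof.
move=> lf bu; apply: L2_mul_Cintegrable => //.
by apply: L2_real; exact: RL2_bounded.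
Qed.

Lemma cint_real (u : Td -> R) : cint (fun y => (u y)%:C) = (\int[P]_y u y)%:C.
Proof.
apply: complexP => //=; rewrite Rintegral_cst//= mul0r//.
Qed.

Lemma is_wderivD k f f' g g' : L2 f -> L2 f' ->
  is_wderiv k f g -> is_wderiv k f' g' ->
  is_wderiv k (fun y => f y + f' y) (fun y => g y + g' y).
Proof.
move=> lf lf' [lg fg] [lg' fg']; split; first exact: L2D.
move=> psi tpsi.
have bp := essbounded_partial k tpsi; have bt := essbounded_test tpsi.
under [in LHS]eq_fun do rewrite mulrDl.
under [in RHS]eq_fun do rewrite mulrDl.
rewrite !cintD; try exact: L2_mul_bounded.
by rewrite fg// fg'// opprD.
Qed.

Lemma is_wderivZ k (c : C) f g : L2 f ->
  is_wderiv k f g -> is_wderiv k (fun y => c * f y) (fun y => c * g y).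
Proof.
move=> lf [lg fg]; split; first exact: L2Z.
move=> psi tpsi.
have bp := essbounded_partial k tpsi; have bt := essbounded_test tpsi.
under [in LHS]eq_fun do rewrite -mulrA.
under [in RHS]eq_fun do rewrite -mulrA.
rewrite !cintZ; try exact: L2_mul_bounded.
by rewrite fg// mulrN.
Qed.

Lemma is_wderivJ k f g : L2 f ->
  is_wderiv k f g -> is_wderiv k (fun y => conjc (f y)) (fun y => conjc (g y)).
Proof.
move=> lf [lg fg]; split; first exact: L2J.
move=> psi tpsi.
have bp := essbounded_partial k tpsi; have bt := essbounded_test tpsi.
under [in LHS]eq_fun do rewrite -[X in _ * X]conjc_real -conjcM.
under [in RHS]eq_fun do rewrite -[X in _ * X]conjc_real -conjcM.
rewrite !cint_conj; try exact: L2_mul_bounded.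
by rewrite fg// rmorphN.
Qed.

Lemma is_wderiv_ae k f f' g : L2 f -> L2 f' -> {ae P, forall y, f y = f' y} ->
  is_wderiv k f g -> is_wderiv k f' g.
Proof.
move=> lf lf' ff' [lg fg]; split => // psi tpsi.
rewrite -fg//; have bp := essbounded_partial k tpsi.
apply: cint_ae; try exact: L2_mul_bounded.
by apply: filterS ff' => y ->.
Qed.

(** Since the test functions are periodic, the integral of their derivatives
    vanishes. *)
Lemma is_wderiv_cst k (c : C) : is_wderiv k ((fun=> c) : Td -> C) (fun=> 0).
Proof.
split; first exact: L2_cst.
move=> psi tpsi; have bp := essbounded_partial k tpsi.
have lp : Cintegrable (fun y : Td => (partial k psi (point y))%:C).
  by apply/L2_Cintegrable/L2_real/RL2_bounded.
rewrite cintZ// cint_real /Rintegral integral_partial_eq0//=.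
- rewrite mulr0; under eq_fun do rewrite mul0r.
  by rewrite cint_real Rintegral_cst//= mul0r oppr0.
- by have [/(_ k)] := tpsi.
- by move=> x; exact: test_function_diff.
- exact: continuous_partial.
Qed.

(** The product with a test function is periodic, so that the integral of its
    derivative vanishes. *)
Lemma is_wderiv_trig k n c :
  is_wderiv k (fun y : Td => (trig n c (point y))%:C)
              (fun y => (partial k (trig n c) (point y))%:C).
Proof.
have te := test_function_trig1 n c.
have bpe := essbounded_partial k te; have be := essbounded_test te.
split; first by apply/L2_real/RL2_bounded.
move=> psi tpsi; have bp := essbounded_partial k tpsi; have bt := essbounded_test tpsi.
have pM x : partial k (trig n c * psi) x =
    trig n c x * partial k psi x + partial k (trig n c) x * psi x.
  rewrite /partial deriveM; try exact/diff_derivable/test_function_diff.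
  by rewrite /GRing.scale/= [X in _ + X]mulrC.
have int1 : P.-integrable setT (EFin \o (fun y => trig n c (point y) * partial k psi (point y))).
  by apply/RL2_integrable/RL2M => //; exact: RL2_bounded.
have int2 : P.-integrable setT (EFin \o (fun y => partial k (trig n c) (point y) * psi (point y))).
  by apply/RL2_integrable/RL2M => //; exact: RL2_bounded.
under [in LHS]eq_fun do rewrite -rmorphM.
under [in RHS]eq_fun do rewrite -rmorphM.
rewrite !cint_real -rmorphN; congr (_%:C); apply/eqP; rewrite -addr_eq0 -RintegralD//.
rewrite /Rintegral; under eq_integral do rewrite -pM.
rewrite integral_partial_eq0//.
- by move=> x; have [/(_ k x) px _] := tpsi; rewrite /GRing.mul/= px trig_periodic.
- by move=> x; apply: differentiableM; exact: test_function_diff.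
- rewrite (_ : partial k _ = (fun x => trig n c x * partial k psi x + partial k (trig n c) x * psi x)); last first.
    by apply/funext => x; rewrite pM.
  move=> x.
  have H1 := cvgM (@continuous_trig R d n c x) (@continuous_partial psi k tpsi x).
  have H2 := cvgM (@continuous_partial _ k te x) (differentiable_continuous (test_function_diff x tpsi)).
  exact: cvgD (H1 _) (H2 _).
Qed.

Lemma trig_total_complex f : L2 f ->
  (forall n c, cint (fun y => f y * (trig n c (point y))%:C) = 0) ->
  {ae P, forall y, f y = 0}.
Proof.
move=> [fr fi] f0.
have H (h : Td -> R) : h \in Lfun P 2%:E ->
    (forall n c, \int[P]_y (h y * trig n c (point y)) = 0) -> {ae P, forall y, h y = 0}.
  move=> lh h0; apply: trig_total => [|n c]; first exact: RL2_integrable.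
  have := h0 n c; rewrite /Rintegral => H0; rewrite -[LHS]fineK ?H0//.
  apply: integrable_fin_num => //.
  apply: RL2_mul_integrable => //; apply: RL2_bounded.
  by apply: essbounded_continuous_point; exact: continuous_trig.
have Hr : {ae P, forall y, complex.Re (f y) = 0}.
  apply: H fr _ => n c; rewrite -[RHS](congr1 (@complex.Re R) (f0 n c)).
  by apply: eq_Rintegral => y _; rewrite cReM /= mulr0 subr0.
have Hi : {ae P, forall y, complex.Im (f y) = 0}.
  apply: H fi _ => n c; rewrite -[RHS](congr1 (@complex.Im R) (f0 n c)).
  by apply: eq_Rintegral => y _; rewrite cImM /= mulr0 add0r.
by apply: filterS2 Hr Hi => y ? ?; exact: complexP.
Qed.

(** Two weak derivatives have the same pairing with every trigonometric
    function. *)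
Lemma is_wderiv_unique k f g g' : is_wderiv k f g -> is_wderiv k f g' ->
  {ae P, forall y, g y = g' y}.
Proof.
move=> [lg fg] [lg' fg'].
have : {ae P, forall y, g y - g' y = 0}.
  apply: trig_total_complex => [|n c]; first exact: L2B.
  have te := test_function_trig1 n c.
  under eq_fun do rewrite mulrBl -mulNr.
  have be := essbounded_test te.
  rewrite cintD; [|exact: L2_mul_bounded|by apply: L2_mul_bounded => //; exact: L2N].
  under [X in _ + cint X]eq_fun do rewrite mulNr -mulN1r.
  rewrite cintZ; last exact: L2_mul_bounded.
  by apply: oppr_inj; rewrite opprD mulN1r opprK -fg// fg'// addNr oppr0.
by apply: filterS => y /eqP; rewrite subr_eq0 => /eqP.
Qed.

(** Every nonconstant trigonometric function is, up to a factor, a partial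
    derivative of another one, so that f minus its mean is orthogonal to all of
    them. *)
Lemma ae_cst f : L2 f ->
  (forall k n c, cint (fun y => f y * (partial k (trig n c) (point y))%:C) = 0) ->
  {ae P, forall y, f y = cint f}.
Proof.
move=> lf f0.
have : {ae P, forall y, f y - cint f = 0}.
  have lc : L2 ((fun=> cint f) : Td -> C) by exact: L2_cst.
  apply: trig_total_complex => [|n c]; first exact: L2B.
  have te e := test_function_trig1 n e.
  have be e := essbounded_test (te e).
  have [n0|[k nk]] : (n = fun=> 0) \/ exists k, n k != 0.
    have [[k nk]|H] := pselect (exists k, n k != 0); first by right; exists k.
    by left; apply/funext => k; apply/eqP/negP => /negP nk; apply: H; exists k.
  - rewrite n0.
    have tc (x : 'rV[R]_d) : trig (fun=> 0) c x = cos c.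
      by rewrite /trig big1 ?mulr0 ?add0r// => i _; rewrite mul0r.
    under eq_fun do rewrite tc mulrC.
    rewrite cintZ; last exact/L2_Cintegrable/L2B.
    under eq_fun do rewrite -[X in _ - X]mulr1 -mulNr.
    rewrite cintD; [|exact: L2_Cintegrable|by apply/L2_Cintegrable/L2Z; exact: L2_cst].
    rewrite cintZ; last by apply: L2_Cintegrable; exact: L2_cst.
    rewrite (_ : cint (fun=> 1) = 1) ?mulr1 ?subrr ?mulr0//.
    rewrite (_ : (fun=> 1) = (fun y : Td => ((fun=> 1 : R) y)%:C))//.
    by rewrite cint_real Rintegral_cst//= (probability_setT (torus_measure d)) mulr1.
  - have bpe := essbounded_partial k (te (c - pi / 2)).
    have pne0 : (pi *+ 2) * (n k)%:~R != 0 :> R.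
      by rewrite mulf_neq0 ?intr_eq0// mulrn_eq0/= gt_eqF// pi_gt0.
    have tE x : trig n c x = ((pi *+ 2) * (n k)%:~R)^-1 * partial k (trig n (c - pi / 2)) x.
      by rewrite partial_trig subrK mulKf.
    under eq_fun do rewrite tE realcM mulrCA.
    rewrite cintZ; last by apply: L2_mul_bounded => //; exact: L2B.
    under eq_fun do rewrite mulrBl -[- (cint f * _)]mulNr.
    rewrite cintD; [|exact: L2_mul_bounded|by apply: L2_mul_bounded => //; exact: L2_cst].
    rewrite f0 add0r.
    have [_ /(_ _ (te (c - pi / 2))) ->] := is_wderiv_cst k (- cint f).
    under eq_fun do rewrite mul0r.
    by rewrite (cint_real (fun=> 0)) Rintegral_cst//= mul0r oppr0 mulr0.
by apply: filterS => y /eqP; rewrite subr_eq0 => /eqP.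
Qed.

Lemma is_wderiv_sum k n (F G : 'I_n -> Td -> C) : (forall i, L2 (F i)) ->
  (forall i, is_wderiv k (F i) (G i)) ->
  is_wderiv k (fun y => \sum_i F i y) (fun y => \sum_i G i y).
Proof.
elim: n F G => [|n IH] F G lF FG.
  under eq_fun do rewrite big_ord0.
  under [X in is_wderiv _ _ X]eq_fun do rewrite big_ord0.
  exact: is_wderiv_cst.
under eq_fun do rewrite big_ord_recl.
under [X in is_wderiv _ _ X]eq_fun do rewrite big_ord_recl.
by apply: is_wderivD => //; [exact: L2_sum|exact: IH].
Qed.

Lemma wderivP k f : H1 f -> is_wderiv k f (wderiv k f).
Proof. by move=> [_ /(_ k)[g fg]]; exact: (xgetPex _ (ex_intro _ g fg)). Qed.

Lemma wderivE k f g : is_wderiv k f g -> {ae P, forall y, wderiv k f y = g y}.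
Proof.
by move=> fg; apply: is_wderiv_unique (fg); exact: (xgetPex _ (ex_intro _ g fg)).
Qed.

Lemma L2_wderiv k f : H1 f -> L2 (wderiv k f).
Proof. by move=> /(wderivP k)[]. Qed.

Implicit Types u v w : Td -> 'cV[C]_d.

Lemma H1v_L2 u l : H1v u -> L2 (comp u l).
Proof. by move=> /(_ l)[]. Qed.

Lemma H1v_wderiv u k l : H1v u -> L2 (wderiv k (comp u l)).
Proof. by move=> /(_ l); exact: L2_wderiv. Qed.

Lemma comp_add u v l : comp (fun y => u y + v y) l = (fun y => comp u l y + comp v l y).
Proof. by apply/funext => y; rewrite /comp mxE. Qed.

Lemma comp_scale (c : C) u l : comp (fun y => c *: u y) l = (fun y => c * comp u l y).
Proof. by apply/funext => y; rewrite /comp mxE. Qed.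

Lemma comp_sum n (F : 'I_n -> Td -> 'cV[C]_d) l :
  comp (fun y => \sum_i F i y) l = (fun y => \sum_i comp (F i) l y).
Proof. by apply/funext => y; rewrite /comp summxE. Qed.

Lemma H1D f f' : H1 f -> H1 f' -> H1 (fun y => f y + f' y).
Proof.
move=> hf hf'; split; first exact: L2D hf.1 hf'.1.
move=> k; exists (fun y => wderiv k f y + wderiv k f' y).
by apply: is_wderivD; [exact: hf.1|exact: hf'.1|exact: wderivP|exact: wderivP].
Qed.

Lemma H1Z (c : C) f : H1 f -> H1 (fun y => c * f y).
Proof.
move=> hf; split; first exact: L2Z hf.1.
move=> k; exists (fun y => c * wderiv k f y).
by apply: is_wderivZ; [exact: hf.1|exact: wderivP].
Qed.

Lemma H1_cst (c : C) : H1 ((fun=> c) : Td -> C).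
Proof. by split; [exact: L2_cst|move=> k; eexists; exact: is_wderiv_cst]. Qed.

Lemma H1_conj f : H1 f -> H1 (fun y => conjc (f y)).
Proof.
move=> hf; split; first exact: L2J hf.1.
by move=> k; eexists; apply: is_wderivJ; [exact: hf.1|exact: wderivP].
Qed.

Lemma H1vD u v : H1v u -> H1v v -> H1v (fun y => u y + v y).
Proof. by move=> hu hv l; rewrite comp_add; exact: H1D. Qed.

Lemma H1vZ (c : C) u : H1v u -> H1v (fun y => c *: u y).
Proof. by move=> hu l; rewrite comp_scale; exact: H1Z. Qed.

Lemma H1v_cst (c : 'cV[C]_d) : H1v ((fun=> c) : Td -> 'cV[C]_d).
Proof. by move=> l; exact: H1_cst. Qed.

Lemma H1v_sum n (F : 'I_n -> Td -> 'cV[C]_d) :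
  (forall i, H1v (F i)) -> H1v (fun y => \sum_i F i y).
Proof.
elim: n F => [|n IH] F hF.
  by under eq_fun do rewrite big_ord0; exact: H1v_cst.
by under eq_fun do rewrite big_ord_recl; apply: H1vD => //; exact: IH.
Qed.

Lemma wderivD k f f' : H1 f -> H1 f' ->
  {ae P, forall y, wderiv k (fun y => f y + f' y) y = wderiv k f y + wderiv k f' y}.
Proof.
by move=> hf hf'; apply: wderivE; apply: is_wderivD;
  [exact: hf.1|exact: hf'.1|exact: wderivP|exact: wderivP].
Qed.

Lemma wderivZ k (c : C) f : H1 f ->
  {ae P, forall y, wderiv k (fun y => c * f y) y = c * wderiv k f y}.
Proof. by move=> hf; apply: wderivE; apply: is_wderivZ; [exact: hf.1|exact: wderivP]. Qed.

Lemma wderiv_cst k (c : C) : {ae P, forall y : Td, wderiv k (fun=> c) y = 0}.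
Proof. by apply: wderivE; exact: is_wderiv_cst. Qed.

Lemma grad0_cst f : H1 f -> (forall k, {ae P, forall y, wderiv k f y = 0}) ->
  {ae P, forall y, f y = cint f}.
Proof.
move=> hf df0; apply: ae_cst; first exact: hf.1.
move=> k n c; have [lg] := wderivP k hf.
have te := test_function_trig1 n c.
have be := essbounded_test te.
move=> /(_ _ te) ->.
rewrite (_ : cint _ = 0) ?oppr0//.
rewrite (@cint_ae _ _ _ (fun=> 0)).
- by rewrite (cint_real (fun=> 0)) Rintegral_cst//= mul0r.
- exact: L2_mul_bounded.
- by apply: L2_Cintegrable; exact: L2_cst.
- by apply: filterS (df0 k) => y ->; rewrite mul0r.
Qed.

End weak_derivatives.

(** * Power series expansions *)

Section analytic_functions.
Variable R : realType.
Local Notation C := R[i].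
Local Notation normc := (@ComplexField.Normc.normc R).

Section seminorm.
Variables (V : lmodType C) (mem : V -> Prop) (N : V -> R).
Hypotheses (memD : forall u v, mem u -> mem v -> mem (u + v))
  (memZ : forall c u, mem u -> mem (c *: u))
  (N_ge0 : forall u, 0 <= N u)
  (ND : forall u v, mem u -> mem v -> N (u + v) <= N u + N v)
  (NZ : forall c u, mem u -> N (c *: u) = normc c * N u).

Lemma mem_opp u : mem u -> mem (- u).
Proof. by rewrite -scaleN1r; exact: memZ. Qed.

Lemma seminormN u : mem u -> N (- u) = N u.
Proof.
move=> mu; rewrite -scaleN1r NZ// (_ : -1 = (-1)%:C); last by rewrite rmorphN1.
by rewrite normc_real normrN normr1 mul1r.
Qed.

Lemma mem_sum (a : nat -> V) (t : R) k : mem (a 0%N) -> (forall j, mem (a j)) ->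
  mem (\sum_(j < k) (t ^+ j)%:C *: a j).
Proof.
move=> m0 ma; elim: k => [|k IH].
  by rewrite big_ord0 -(scale0r (a 0%N)); exact: memZ.
by rewrite big_ord_recr; apply: memD => //; exact: memZ.
Qed.

(** The terms of a series converging at t0 are bounded there, so that for t
    twice closer to 0 the tails are dominated by a geometric series. *)
Lemma analytic_taylor (delta : R) (f : R -> V) : 0 < delta ->
  (forall t, `|t| <= delta -> mem (f t)) ->
  analytic_on mem N [set t | `|t| <= delta] f ->
  exists a : nat -> V, [/\ forall j, mem (a j),
    exists2 r, 0 < r & forall t, `|t| < r ->
      N (f t - \sum_(j < k) (t ^+ j)%:C *: a j) @[k --> \oo] --> (0 : R) &
    forall n, exists K r, 0 < r /\ forall t, `|t| < r ->
      N (f t - \sum_(j < n) (t ^+ j)%:C *: a j) <= K * `|t| ^+ n].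
Proof.
move=> delta0 mf /(_ 0); rewrite /= normr0 => /(_ (ltW delta0)) [r [a [r0 ma fa]]].
exists a.
pose S k t := \sum_(j < k) (t ^+ j)%:C *: a j.
have mS k t : mem (S k t) by exact: mem_sum.
have {}fa t : `|t| <= delta -> `|t| < r -> N (f t - S k t) @[k --> \oo] --> (0 : R).
  move=> td tr; have := fa t td; rewrite subr0 => /(_ tr).
  by under eq_fun do under eq_bigr do rewrite ?subr0.
split=> //.
  exists (Num.min delta r); first by rewrite lt_min delta0.
  by move=> t; rewrite lt_min => /andP[/ltW td tr]; exact: fa.
move=> n; pose t0 := Num.min delta r / 2.
have m0 : 0 < Num.min delta r by rewrite lt_min delta0.
have t00 : 0 < t0 by rewrite divr_gt0.
have t0m : t0 < Num.min delta r by rewrite ltr_pdivrMr// ltr_pMr// ltr1n.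
have [t0d t0r] : t0 < delta /\ t0 < r by move: t0m; rewrite lt_min => /andP[].
have at0 : `|t0| = t0 by rewrite gtr0_norm.
have msub u v : mem u -> mem v -> mem (u - v).
  by move=> mu mv; apply: memD => //; exact: mem_opp.
have Nsub u v : mem u -> mem v -> N (u - v) <= N u + N v.
  by move=> mu mv; rewrite (le_trans (ND mu (mem_opp mv)))// seminormN.
have [k0 Hk0] : exists k0, forall k, (k0 <= k)%N -> N (f t0 - S k t0) <= 1.
  have /cvgr_dist_le/(_ _ ltr01) : N (f t0 - S k t0) @[k --> \oo] --> (0 : R).
    by apply: fa; rewrite at0// ltW.
  move=> [k0 _ H]; exists k0 => k /H /=; rewrite sub0r normrN.
  by apply: le_trans; exact: ler_norm.
have mft0 : mem (f t0) by apply: mf; rewrite at0 ltW.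
pose A := 2 + \sum_(j < k0) t0 ^+ j * N (a j).
have A0 : 0 <= A.
  by rewrite addr_ge0// sumr_ge0// => j _; rewrite mulr_ge0// exprn_ge0// ltW.
have NtaE t j : N ((t ^+ j)%:C *: a j) = `|t| ^+ j * N (a j).
  by rewrite NZ// normc_real normrX.
have HA j : t0 ^+ j * N (a j) <= A.
  have [jk|kj] := ltnP j k0.
    rewrite /A (bigD1 (Ordinal jk))//= addrCA lerDl addr_ge0// sumr_ge0// => i _.
    by rewrite mulr_ge0// exprn_ge0// ltW.
  apply: (@le_trans _ _ 2); last first.
    by rewrite lerDl sumr_ge0// => i _; rewrite mulr_ge0// exprn_ge0// ltW.
  rewrite -[X in X ^+ _]at0 -NtaE.
  rewrite (_ : _ *: _ = (f t0 - S j t0) - (f t0 - S j.+1 t0)); last first.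
    by rewrite opprB addrC addrA subrK /S big_ord_recr/= addrAC subrr add0r.
  rewrite (le_trans (Nsub _ _ _ _))//; try exact: msub.
  have := Hk0 _ kj; have := Hk0 _ (leqW kj); lra.
exists (2 * A / t0 ^+ n), (t0 / 2); split; first exact: divr_gt0.
move=> t tt0.
have tt0' : `|t| < t0 by rewrite (lt_trans tt0)// ltr_pdivrMr// ltr_pMr// ltr1n.
pose x := `|t| / t0.
have x0 : 0 <= x by rewrite divr_ge0// ltW.
have x12 : x <= 2^-1 by rewrite ler_pdivrMr// mulrC ltW.
have tail m : N (S (n + m)%N t - S n t) <= 2 * A * x ^+ n * (1 - 2^-1 ^+ m).
  elim: m => [|m IH].
    rewrite addn0 !subrr mulr0 -(scale0r (a 0%N)) NZ//.
    by rewrite (_ : normc 0 = 0) ?mul0r// ComplexField.Normc.normc0.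
  rewrite addnS /S big_ord_recr/= -/(S _ _) addrAC.
  rewrite (le_trans (ND (msub _ _ (mS _ _) (mS _ _)) (memZ _ (ma _))))//.
  rewrite NtaE.
  have : `|t| ^+ (n + m) * N (a (n + m)%N) <= A * (x ^+ n * 2^-1 ^+ m).
    have -> : `|t| ^+ (n + m) * N (a (n + m)%N) = x ^+ (n + m) * (t0 ^+ (n + m) * N (a (n + m)%N)).
      by rewrite mulrA -exprMn /x divfK// gt_eqF.
    rewrite mulrC ler_pM//; [|by rewrite exprn_ge0|].
      by rewrite mulr_ge0// exprn_ge0// ltW.
    by rewrite exprD ler_wpM2l ?exprn_ge0// lerXn2r// nnegrE.
  move: IH; rewrite exprS; set y := 2^-1 ^+ m; set z := x ^+ n.
  by move: (N _) (_ * N _) => b c; nra.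
have tail' m : N (S (n + m)%N t - S n t) <= 2 * A * x ^+ n.
  apply: le_trans (tail m) _; rewrite -[leRHS]mulr1 ler_wpM2l ?gerBl ?exprn_ge0//.
  by rewrite !mulr_ge0// exprn_ge0.
have -> : 2 * A / t0 ^+ n * `|t| ^+ n = 2 * A * x ^+ n.
  by rewrite /x [X in _ = _ * X]expr_div_n; ring.
have mft : mem (f t) by apply: mf; rewrite ltW// (lt_trans tt0').
apply/ler_addgt0Pr => e e0.
have /cvgr_dist_le/(_ _ e0) : N (f t - S k t) @[k --> \oo] --> (0 : R).
  by apply: fa; [rewrite ltW// (lt_trans tt0')|rewrite (lt_trans tt0')].
move=> [k1 _ /(_ (n + k1)%N (leq_addl _ _))]; rewrite /= sub0r normrN => H.
rewrite (_ : f t - _ = (f t - S (n + k1)%N t) + (S (n + k1)%N t - S n t)); last first.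
  by rewrite addrA subrK.
rewrite (le_trans (ND _ _))//; try exact: msub.
by rewrite addrC lerD// (le_trans (ler_norm _)).
Qed.

(** The expansions of order 1 and 2 give a difference quotient at distance
    O(h) from the coefficient of order 1. *)
Lemma analytic_has_deriv (delta : R) (f : R -> V) : 0 < delta ->
  (forall t, `|t| <= delta -> mem (f t)) ->
  analytic_on mem N [set t | `|t| <= delta] f ->
  exists2 v, mem v & has_deriv N f 0 v.
Proof.
move=> delta0 mf af; have [a [ma _ Ha]] := analytic_taylor delta0 mf af.
exists (a 1%N) => //; rewrite /has_deriv.
have [K1 [r1 [r10 /(_ 0)]]] := Ha 1%N; rewrite normr0 => /(_ r10).
rewrite big_ord1 expr0 expr1 mulr0 scale1r => N0.
have [K [r [r0 HK]]] := Ha 2%N.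
have mf0 : mem (f 0) by apply: mf; rewrite normr0 ltW.
apply: (@squeeze_cvgr _ _ _ _ (cst 0) (fun h => K * `|h|)).
- near=> h; rewrite N_ge0/= add0r.
  have h0 : h != 0 by near: h; exact: nbhs_dnbhs_neq.
  have hr : `|h| < r by near: h; exact: dnbhs0_lt.
  have hd : `|h| <= delta by near: h; exact: dnbhs0_le.
  have := HK h hr; rewrite big_ord_recr big_ord1/= expr0 scale1r expr1 => HKh.
  have mU : mem (f h - (a 0%N + h%:C *: a 1%N)).
    by apply: memD; [exact: mf|apply/mem_opp/memD => //; exact: memZ].
  have mW : mem (- (f 0 - a 0%N)).
    by apply/mem_opp/memD => //; exact: mem_opp.
  rewrite (_ : _ - a 1%N = (h^-1)%:C *: ((f h - (a 0%N + h%:C *: a 1%N)) + - (f 0 - a 0%N))); last first.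
    rewrite opprD opprB [a 0%N - f 0]addrC addrACA [- a 0%N - _ + _]addrAC addNr add0r.
    by rewrite [in RHS]scalerBr scalerA -rmorphM mulVf// scale1r.
  rewrite NZ; last exact: memD.
  rewrite normc_real normfV ler_pdivrMl ?normr_gt0//.
  rewrite (le_trans (ND mU mW))// (seminormN (memD mf0 (mem_opp (ma 0%N)))).
  by move: HKh N0; rewrite expr2; nra.
- exact: cvg_cst.
- rewrite -[X in _ --> X](mulr0 K); apply: cvgM; first exact: cvg_cst.
  have := @norm_continuous _ R 0; rewrite /continuous_at normr0.
  by apply: cvg_trans; apply: cvg_app; exact: nbhs_dnbhs.
Unshelve. all: by end_near.
Qed.

End seminorm.

Section real_power_series.
Variables (c : nat -> R) (r : R).
Hypothesis r0 : 0 < r.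

Lemma pseries_at0 (u : nat -> R) : limn (pseries u 0) = u 0%N.
Proof.
apply: cvg_lim => //; apply: cvg_near_cst; exists 1%N => // -[//|n] _.
rewrite /pseries /series/= big_nat_recl//= expr0 mulr1 big1 ?addr0// => i _.
by rewrite expr0n/= mulr0.
Qed.

(** Term by term differentiation keeps the disc of convergence: by Bernoulli's
    inequality the factor i + 1 is absorbed in a slightly larger radius. *)
Lemma is_cvg_pseries_diffs (u : nat -> R) :
  (forall t, `|t| < r -> cvgn (pseries u t)) ->
  forall t, `|t| < r -> cvgn (pseries (pseries_diffs u) t).
Proof.
move=> cu t tr.
pose K := (`|t| + r) / 2; pose rho := (K + r) / 2.
have t0 := normr_ge0 t.
have K0 : 0 < K by rewrite divr_gt0// ltr_wpDl.
have Kr : K < r by rewrite ltr_pdivrMr//; lra.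
have tK : `|t| < K by rewrite ltr_pdivlMr//; lra.
have Krho : K < rho by rewrite ltr_pdivlMr//; lra.
have rhor : rho < r by rewrite ltr_pdivrMr//; lra.
have rho0 : 0 < rho := lt_trans K0 Krho.
suff cK : cvgn (pseries (pseries_diffs u) K).
  have := @is_cvg_pseries_inside _ _ _ t cK; rewrite (gtr0_norm K0) => H.
  exact (H tK).
apply: (@normed_cvg _ _ (fun i => pseries_diffs u i * K ^+ i)).
pose s := rho / K - 1.
have s0 : 0 < s by rewrite subr_gt0 ltr_pdivlMr// mul1r.
pose m := Num.min 1 s.
have m0 : 0 < m by rewrite lt_min ltr01.
have bern i : i.+1%:R * m <= (rho / K) ^+ i.
  have -> : rho / K = 1 + s by rewrite /s addrC subrK.
  elim: i => [|i IH]; first by rewrite mul1r expr0 ge_min lexx.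
  have : 1 <= (1 + s) ^+ i by rewrite exprn_ege1// lerDl ltW.
  have ms : m <= s by rewrite ge_min lexx orbT.
  rewrite exprS -(@natr1 R i.+1); nra.
have cr : cvgn (pseries (fun i => `|u i|) rho).
  apply: (@is_cvg_pseries_inside_norm _ _ ((rho + r) / 2)).
    by apply: cu; rewrite gtr0_norm ?divr_gt0 ?addr_gt0// ltr_pdivrMr//; lra.
  by rewrite !gtr0_norm ?divr_gt0 ?addr_gt0// ltr_pdivlMr//; lra.
have cr' : cvgn (series ((m * rho)^-1 *: (fun i => `|u i.+1| * rho ^+ i.+1))).
  apply: is_cvg_seriesZ.
  move/cvg_ex : cr => [l Hl]; apply/cvg_ex; exists (l - `|u 0%N|).
  rewrite (_ : series _ = fun n => pseries (fun i => `|u i|) rho n.+1 - `|u 0%N|); last first.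
    apply/funext => n; rewrite /pseries /series/= big_nat_recl//= expr0 mulr1.
    by rewrite addrAC subrr add0r.
  by apply: cvgB; [rewrite cvg_shiftS|exact: cvg_cst].
apply: (@series_le_cvg _ _ (fun i => (m * rho)^-1 * (`|u i.+1| * rho ^+ i.+1)) _ _ _ cr') => [i|i|i] //=.
- apply: mulr_ge0; first by rewrite invr_ge0 ltW// mulr_gt0.
  by rewrite mulr_ge0// exprn_ge0// ltW.
- rewrite /pseries_diffs !normrM normrX (gtr0_norm K0) ger0_norm//.
  have -> : (m * rho)^-1 * (`|u i.+1| * rho ^+ i.+1) = `|u i.+1| * ((rho / K) ^+ i / m * K ^+ i).
    rewrite exprS [(rho / K) ^+ i]expr_div_n; field.
    by rewrite !gt_eqF//= exprn_gt0.
  rewrite mulrAC mulrC ler_wpM2l// ler_wpM2r ?exprn_ge0 ?(ltW K0)//.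
  by rewrite ler_pdivlMr.
Qed.

Lemma is_derive_pseries (u : nat -> R) (t : R) :
  (forall t, `|t| < r -> cvgn (pseries u t)) -> `|t| < r ->
  is_derive t (1 : R) (fun x => limn (pseries u x)) (limn (pseries (pseries_diffs u) t)).
Proof.
move=> cu tr; pose K := (`|t| + r) / 2.
have t0 := normr_ge0 t.
have K0 : 0 < K by rewrite divr_gt0// ltr_wpDl.
have Kr : `|K| < r by rewrite (gtr0_norm K0) ltr_pdivrMr//; lra.
have tK : `|t| < `|K| by rewrite (gtr0_norm K0) ltr_pdivlMr//; lra.
have cd := is_cvg_pseries_diffs cu.
apply: (@pseries_snd_diffs _ _ K) => //; first exact: cu.
  exact: cd.
exact: is_cvg_pseries_diffs cd _ Kr.
Qed.

Lemma is_derive_near (f g : R -> R) (x l : R) : (\forall y \near x, g y = f y) ->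
  is_derive x 1 f l -> is_derive x 1 g l.
Proof.
move=> gf [df fl]; split.
  by apply: near_eq_derivable df; apply: filterS gf => y ->.
by rewrite (near_eq_derive _ gf).
Qed.

(** The sum of the series is differentiated twice term by term, inside the disc
    of convergence. *)
Lemma power_series_derivatives (f : R -> R) :
  (forall t, `|t| < r -> \sum_(j < k) t ^+ j * c j @[k --> \oo] --> f t) ->
  is_derive (0 : R) 1 f (c 1%N) /\ derive1n 2 f 0 = 2 * c 2%N.
Proof.
move=> fc.
have pE t : pseries c t = fun k => \sum_(j < k) t ^+ j * c j.
  apply/funext => k; rewrite /pseries /series/= big_mkord.
  by apply: eq_bigr => j _; rewrite mulrC.
have fE t : `|t| < r -> f t = limn (pseries c t).
  by move=> tr; apply/esym/cvg_lim => //; rewrite pE; exact: fc.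
have cc t : `|t| < r -> cvgn (pseries c t).
  by move=> tr; apply/cvg_ex; exists (f t); rewrite pE; exact: fc.
have nearE (x : R) : `|x| < r -> \forall y \near x, f y = limn (pseries c y).
  move=> xr; have /cvgr_lt/(_ _ xr) := @norm_continuous _ R x; apply: filterS => y yr; exact: fE.
have d1 (t : R) : `|t| < r -> is_derive t 1 f (limn (pseries (pseries_diffs c) t)).
  by move=> tr; apply: is_derive_near (nearE _ tr) _; exact: is_derive_pseries.
have zr : `|0 : R| < r by rewrite normr0.
split.
  by have := d1 0 zr; rewrite pseries_at0 /pseries_diffs mul1r.
rewrite derive1nS derive1n1 derive1E.
have := is_derive_pseries (is_cvg_pseries_diffs cc) zr.
have cE : pseries_diffs (pseries_diffs c) 0 = 2 * c 2%N.
  by rewrite /pseries_diffs mul1r.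
rewrite pseries_at0 cE => H.
have [_ ->] : is_derive (0 : R) 1 (f^`()%classic) (2 * c 2%N).
  apply: is_derive_near H; apply: filterS (nbhs0_lt r0) => y yr.
  by rewrite derive1E (@derive_val _ _ _ _ _ _ _ (d1 y yr)).
by [].
Qed.

End real_power_series.
End analytic_functions.

(** * Limits at the origin *)

Section limits.
Variables (R : realType) (d : nat).
Local Notation C := R[i].
Local Notation Td := (torus R d).
Local Notation P := (torus_measure d : {measure set Td -> \bar R}).
Local Notation normc := (@ComplexField.Normc.normc R).
Local Notation comp := (@Defs.comp R d).
Implicit Types (F G : R -> C) (c : C).

(** Limits at 0 of complex valued functions of a real variable, outside 0 so
    that difference quotients may be used. *)
Definition ctends F c :=
  (complex.Re (F t) @[t --> 0^'] --> complex.Re c) /\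
  (complex.Im (F t) @[t --> 0^'] --> complex.Im c).

Lemma dnbhs_le (delta : R) : 0 < delta -> \forall t \near (0 : R)^', t != 0 /\ `|t| <= delta.
Proof.
move=> delta0; near=> t; split; near: t; first exact: nbhs_dnbhs_neq.
exact: dnbhs0_le.
Unshelve. all: by end_near.
Qed.

Lemma cvg_dnbhs_id : (t : R) @[t --> (0 : R)^'] --> (0 : R).
Proof. exact: nbhs_dnbhs. Qed.

Lemma cvg0_le (T : Type) (F : set_system T) {FF : Filter F} (f g : T -> R) :
  (\forall t \near F, 0 <= f t <= g t) -> g t @[t --> F] --> (0 : R) ->
  f t @[t --> F] --> (0 : R).
Proof. by move=> fg g0; apply: (@squeeze_cvgr _ _ _ _ (cst 0) g) => //; exact: cvg_cst. Qed.

Lemma normc_ctends F c : normc (F t - c) @[t --> 0^'] --> (0 : R) -> ctends F c.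
Proof.
move=> Fc.
have H (p : C -> R) : (forall a b, p (a - b) = p a - p b) -> (forall a, `|p a| <= normc a) ->
    p (F t) @[t --> 0^'] --> p c.
  move=> pB ple; apply: cvg_zero.
  apply/norm_cvg0P; apply: cvg0_le Fc; apply: nearW => t.
  by rewrite normr_ge0/= [X in `|X|](_ : _ = p (F t - c))//= pB.
split; apply: H => [a b|a].
- by rewrite cReD cReN.
- exact: (normc_ge_ReIm a).1.
- by rewrite cImD cImN.
- exact: (normc_ge_ReIm a).2.
Qed.

Lemma ctendsD F G c e : ctends F c -> ctends G e -> ctends (fun t => F t + G t) (c + e).
Proof.
move=> [Fr Fi] [Gr Gi]; split; rewrite ?cReD ?cImD.
- by under eq_cvg do rewrite cReD; exact: cvgD.
- by under eq_cvg do rewrite cImD; exact: cvgD.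
Qed.

Lemma ctendsM F G c e : ctends F c -> ctends G e -> ctends (fun t => F t * G t) (c * e).
Proof.
move=> [Fr Fi] [Gr Gi]; split; rewrite ?cReM ?cImM.
- by under eq_cvg do rewrite cReM; apply: cvgB; exact: cvgM.
- by under eq_cvg do rewrite cImM; apply: cvgD; exact: cvgM.
Qed.

Lemma ctends_cst c : ctends (fun=> c) c.
Proof. by split; exact: cvg_cst. Qed.

Lemma ctendsZ c F e : ctends F e -> ctends (fun t => c * F t) (c * e).
Proof. by apply: ctendsM; exact: ctends_cst. Qed.

Lemma ctendsN F e : ctends F e -> ctends (fun t => - F t) (- e).
Proof.
move=> /(ctendsZ (-1)); rewrite mulN1r; congr ctends.
by apply/funext => t; rewrite mulN1r.
Qed.

Lemma ctendsB F G c e : ctends F c -> ctends G e -> ctends (fun t => F t - G t) (c - e).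
Proof. by move=> Fc Ge; apply: ctendsD => //; exact: ctendsN. Qed.

Lemma ctends_sum n (F : 'I_n -> R -> C) (c : 'I_n -> C) :
  (forall i, ctends (F i) (c i)) -> ctends (fun t => \sum_i F i t) (\sum_i c i).
Proof.
elim: n F c => [|n IH] F c Fc.
  by under eq_fun do rewrite big_ord0; rewrite big_ord0; exact: ctends_cst.
under eq_fun do rewrite big_ord_recl; rewrite big_ord_recl.
by apply: ctendsD => //; exact: IH.
Qed.

Lemma ctends_id : ctends (fun t => t%:C) 0.
Proof. by split; [exact: cvg_dnbhs_id|exact: cvg_cst]. Qed.

Lemma ctends_unique F G c e : ctends F c -> ctends G e ->
  (\forall t \near 0^', F t = G t) -> c = e.
Proof.
move=> [Fr Fi] [Gr Gi] FG.
have H (f g : R -> R) (a b : R) : f t @[t --> 0^'] --> a -> g t @[t --> 0^'] --> b ->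
    (\forall t \near 0^', f t = g t) -> a = b.
  move=> fa gb fg; rewrite -[LHS](cvg_lim (@norm_hausdorff _ _) fa).
  apply: cvg_lim; first exact: norm_hausdorff.
  by apply: cvg_trans gb; apply: near_eq_cvg; apply: filterS fg => t ->.
by apply: complexP; [apply: H Fr Gr _|apply: H Fi Gi _]; apply: filterS FG => t ->.
Qed.

Lemma normcZ_cvg0 (u : R -> R) : u t @[t --> 0^'] --> (0 : R) ->
  forall M, M * u t @[t --> 0^'] --> (0 : R).
Proof. by move=> u0 M; rewrite -[X in _ --> X](mulr0 M); exact: cvgM (cvg_cst M) u0. Qed.

(** ** Strong limits in the space of square integrable functions *)

Lemma L2norm_ae (f g : Td -> C) : L2 f -> L2 g -> {ae P, forall y, f y = g y} ->
  L2norm f = L2norm g.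
Proof.
move=> lf lg fg; apply/eqP; rewrite -(@eqrXn2 _ 2)// ?L2norm_ge0//; apply/eqP.
by have := eq_ip_ae lf lg lf lg fg fg; rewrite !ipxx => /(congr1 (@complex.Re R)).
Qed.

Lemma L2norm0 : L2norm ((fun=> 0) : Td -> C) = 0.
Proof.
have := @L2normZ R d 0 (fun=> 0) (@L2_cst R d 0).
by under eq_fun do rewrite mul0r; rewrite ComplexField.Normc.normc0 mul0r.
Qed.

Definition L2tends (F : R -> Td -> C) (f : Td -> C) :=
  [/\ \forall t \near 0^', L2 (F t), L2 f &
      L2norm (fun y => F t y - f y) @[t --> 0^'] --> (0 : R)].

Lemma L2tends_ae (F G : R -> Td -> C) (f : Td -> C) : L2tends F f ->
  (\forall t \near 0^', L2 (G t) /\ {ae P, forall y, F t y = G t y}) -> L2tends G f.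
Proof.
move=> [LF lf Ff] FG; split => //; first by apply: filterS FG => t [].
apply: cvg_trans Ff; apply: near_eq_cvg.
apply: filterS2 LF FG => t lFt [lGt FGt]; apply: L2norm_ae; try exact: L2B.
by apply: filterS FGt => y ->.
Qed.

Lemma L2tendsD (F G : R -> Td -> C) (f g : Td -> C) : L2tends F f -> L2tends G g ->
  L2tends (fun t y => F t y + G t y) (fun y => f y + g y).
Proof.
move=> [LF lf Ff] [LG lg Gg]; split; [|exact: L2D|].
- by apply: filterS2 LF LG => t; exact: L2D.
- have : L2norm (fun y => F t y - f y) + L2norm (fun y => G t y - g y) @[t --> 0^'] --> (0 : R).
    by rewrite -[X in _ --> X](addr0 0); exact: cvgD.
  apply: cvg0_le.
  apply: filterS2 LF LG => t lFt lGt; rewrite L2norm_ge0/=.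
  rewrite (_ : (fun y => _) = (fun y => (F t y - f y) + (G t y - g y))).
    by apply: L2normD; exact: L2B.
  by apply/funext => y; rewrite opprD addrACA.
Qed.

Lemma L2tendsZ (c : C) (F : R -> Td -> C) (f : Td -> C) : L2tends F f ->
  L2tends (fun t y => c * F t y) (fun y => c * f y).
Proof.
move=> [LF lf Ff]; split; [|exact: L2Z|].
- by apply: filterS LF => t; exact: L2Z.
- have := normcZ_cvg0 Ff (normc c); apply: cvg0_le.
  apply: filterS LF => t lFt; rewrite L2norm_ge0/=.
  rewrite (_ : (fun y => _) = (fun y => c * (F t y - f y))).
    by rewrite L2normZ//; exact: L2B.
  by apply/funext => y; rewrite mulrBr.
Qed.

Lemma L2tends_sum n (F : 'I_n -> R -> Td -> C) (f : 'I_n -> Td -> C) :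
  (forall i, L2tends (F i) (f i)) ->
  L2tends (fun t y => \sum_i F i t y) (fun y => \sum_i f i y).
Proof.
elim: n F f => [|n IH] F f Ff.
  under eq_fun do under eq_fun do rewrite big_ord0.
  under [X in L2tends _ X]eq_fun do rewrite big_ord0.
  split; [by apply: nearW => _; exact: L2_cst|exact: L2_cst|].
  under eq_fun do under eq_fun do rewrite subrr.
  by rewrite L2norm0; exact: cvg_cst.
under eq_fun do under eq_fun do rewrite big_ord_recl.
under [X in L2tends _ X]eq_fun do rewrite big_ord_recl.
by apply: L2tendsD => //; exact: IH.
Qed.

Lemma L2tends_cst (f : Td -> C) : L2 f -> L2tends (fun=> f) f.
Proof.
move=> lf; split => //; first exact: nearW.
under eq_fun do under eq_fun do rewrite subrr.
by rewrite L2norm0; exact: cvg_cst.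
Qed.

(** A convergent family is bounded near 0. *)
Lemma L2tends_mulX (F : R -> Td -> C) (f : Td -> C) : L2tends F f ->
  L2tends (fun t y => t%:C * F t y) (fun=> 0).
Proof.
move=> [LF lf Ff]; split; [|exact: L2_cst|].
- by apply: filterS LF => t; exact: L2Z.
- have n0 : `|t| @[t --> (0 : R)^'] --> (0 : R).
    have := @norm_continuous _ R 0; rewrite /continuous_at normr0.
    by apply: cvg_trans; apply: cvg_app; exact: nbhs_dnbhs.
  have : `|t| * (L2norm (fun y => F t y - f y) + L2norm f) @[t --> 0^'] --> (0 : R).
    rewrite -[X in _ --> X](mul0r (0 + L2norm f)); apply: cvgM n0 _.
    exact: cvgD Ff (cvg_cst _).
  apply: cvg0_le.
  apply: filterS LF => t lFt; rewrite L2norm_ge0/=.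
  under eq_fun do rewrite subr0.
  rewrite L2normZ// normc_real ler_wpM2l//.
  apply: le_trans (L2normD (L2B lFt lf) lf); rewrite le_eqVlt; apply/orP; left.
  by apply/eqP; congr L2norm; apply/funext => y; rewrite subrK.
Qed.

Lemma L2tends_ip (F : R -> Td -> C) (f g : Td -> C) : L2tends F f -> L2 g ->
  ctends (fun t => ip (F t) g) (ip f g).
Proof.
move=> [LF lf Ff] lg; apply: normc_ctends.
have := normcZ_cvg0 Ff (L2norm g); apply: cvg0_le.
apply: filterS LF => t lFt; rewrite normc_ge0 andTb -ipBl// mulrC.
by apply: Cauchy_Schwarz => //; exact: L2B.
Qed.

(** ** A seminorm equivalent to the norm of H^1 *)

(** The sum of the norms of the components and of their derivatives is a
    seminorm by the triangle inequality in each summand. *)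
Definition H1sum (u : Td -> 'cV[C]_d) : R :=
  \sum_l L2norm (comp u l) + \sum_k \sum_l L2norm (wderiv k (comp u l)).

Lemma H1sum_ge0 u : 0 <= H1sum u.
Proof.
rewrite addr_ge0 ?sumr_ge0// => [l _|k _]; first exact: L2norm_ge0.
by rewrite sumr_ge0// => l _; exact: L2norm_ge0.
Qed.

Lemma ler_sum_term n (a : 'I_n -> R) i : (forall j, 0 <= a j) -> a i <= \sum_j a j.
Proof. by move=> a0; rewrite (bigD1 i)//= lerDl sumr_ge0. Qed.

Lemma L2norm_le_H1sum u l : L2norm (comp u l) <= H1sum u.
Proof.
apply: (le_trans (ler_sum_term l (fun j => L2norm_ge0 (comp u j)))).
by rewrite lerDl sumr_ge0// => k _; rewrite sumr_ge0// => j _; exact: L2norm_ge0.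
Qed.

Lemma wderiv_le_H1sum u k l : L2norm (wderiv k (comp u l)) <= H1sum u.
Proof.
apply: (le_trans (ler_sum_term l (fun j => L2norm_ge0 (wderiv k (comp u j))))).
apply: (@le_trans _ _ (\sum_k \sum_l L2norm (wderiv k (comp u l)))).
  by apply: (ler_sum_term k) => i; rewrite sumr_ge0// => j _; exact: L2norm_ge0.
by rewrite lerDr sumr_ge0// => j _; exact: L2norm_ge0.
Qed.

Lemma H1norm_le_H1sum u : H1norm u <= H1sum u.
Proof.
have sq n (a : 'I_n -> R) : (forall i, 0 <= a i) -> \sum_i a i ^+ 2 <= (\sum_i a i) ^+ 2.
  elim: n a => [|n IH] a a0; first by rewrite !big_ord0 expr0n.
  rewrite !big_ord_recl sqrrD.
  have := IH (fun i => a (lift ord0 i)) (fun i => a0 _).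
  have : 0 <= a ord0 * \sum_(i < n) a (lift ord0 i) by rewrite mulr_ge0// sumr_ge0.
  lra.
rewrite -[leRHS]ger0_norm ?H1sum_ge0// -sqrtr_sqr ler_wsqrtr//.
rewrite /H1sum sqrrD.
have := sq d (fun l => L2norm (comp u l)) (fun l => L2norm_ge0 _).
have : \sum_k \sum_l L2norm (wderiv k (comp u l)) ^+ 2 <=
    (\sum_k \sum_l L2norm (wderiv k (comp u l))) ^+ 2.
  apply: le_trans (sq _ _ _) => [|k]; last by rewrite sumr_ge0// => l _; exact: L2norm_ge0.
  by apply: ler_sum => k _; apply: sq => l; exact: L2norm_ge0.
have : 0 <= (\sum_l L2norm (comp u l)) * \sum_k \sum_l L2norm (wderiv k (comp u l)).
  by rewrite mulr_ge0// sumr_ge0// => k _; rewrite ?sumr_ge0// => *; exact: L2norm_ge0.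
lra.
Qed.

Lemma H1sum_le_H1norm u : H1sum u <= (d%:R + d%:R * d%:R) * H1norm u.
Proof.
have S0 : 0 <= \sum_l L2norm (comp u l) ^+ 2 by rewrite sumr_ge0// => l _; exact: sqr_ge0.
have S1 : 0 <= \sum_k \sum_l L2norm (wderiv k (comp u l)) ^+ 2.
  by rewrite sumr_ge0// => k _; rewrite sumr_ge0// => l _; exact: sqr_ge0.
have c1 l : L2norm (comp u l) <= H1norm u.
  rewrite -[leLHS]ger0_norm ?L2norm_ge0// -sqrtr_sqr ler_wsqrtr//.
  apply: (le_trans (ler_sum_term l (fun j => sqr_ge0 (L2norm (comp u j))))).
  by rewrite lerDl.
have c2 k l : L2norm (wderiv k (comp u l)) <= H1norm u.
  rewrite -[leLHS]ger0_norm ?L2norm_ge0// -sqrtr_sqr ler_wsqrtr//.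
  apply: (le_trans (ler_sum_term l (fun j => sqr_ge0 (L2norm (wderiv k (comp u j)))))).
  apply: (@le_trans _ _ (\sum_k \sum_l L2norm (wderiv k (comp u l)) ^+ 2)).
    by apply: (ler_sum_term k) => i; rewrite sumr_ge0// => j _; exact: sqr_ge0.
  by rewrite lerDr.
rewrite mulrDl; apply: lerD.
  apply: (@le_trans _ _ (\sum_(l < d) H1norm u)); first exact: ler_sum.
  by rewrite sumr_const card_ord mulr_natl.
apply: (@le_trans _ _ (\sum_(k < d) \sum_(l < d) H1norm u)).
  by apply: ler_sum => k _; exact: ler_sum.
by rewrite !sumr_const card_ord -mulrnA -natrM mulr_natl.
Qed.

Lemma H1sumD u v : H1v u -> H1v v -> H1sum (u + v) <= H1sum u + H1sum v.
Proof.
move=> hu hv; rewrite /H1sum addrACA; apply: lerD.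
  rewrite -big_split/=; apply: ler_sum => l _; rewrite (comp_add u v); apply: L2normD; exact: H1v_L2.
rewrite -big_split/=; apply: ler_sum => k _; rewrite -big_split/=; apply: ler_sum => l _.
rewrite (comp_add u v) (@L2norm_ae _ (fun y => wderiv k (comp u l) y + wderiv k (comp v l) y)).
- by apply: L2normD; exact: H1v_wderiv.
- by apply: L2_wderiv; apply: H1D; [exact: hu|exact: hv].
- by apply: L2D; exact: H1v_wderiv.
- by apply: wderivD; [exact: hu|exact: hv].
Qed.

Lemma H1sumZ (c : C) u : H1v u -> H1sum (c *: u) = normc c * H1sum u.
Proof.
move=> hu; rewrite /H1sum mulrDr !mulr_sumr; congr (_ + _).
  by apply: eq_bigr => l _; rewrite (comp_scale c u) L2normZ//; exact: H1v_L2.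
apply: eq_bigr => k _; rewrite mulr_sumr; apply: eq_bigr => l _.
rewrite (comp_scale c u) (@L2norm_ae _ (fun y => c * wderiv k (comp u l) y)).
- by apply: L2normZ; exact: H1v_wderiv.
- by apply: L2_wderiv; apply: H1Z; exact: hu.
- by apply: L2Z; exact: H1v_wderiv.
- by apply: wderivZ; exact: hu.
Qed.

Lemma H1sum_eq0 u : H1v u -> (forall l, {ae P, forall y, comp u l y = 0}) ->
  (forall k l, {ae P, forall y, wderiv k (comp u l) y = 0}) -> H1sum u = 0.
Proof.
move=> hu u0 du0; rewrite /H1sum !big1 ?addr0// => [k _|l _].
  rewrite big1// => l _; transitivity (L2norm ((fun=> 0) : Td -> C)); last exact: L2norm0.
  apply: L2norm_ae; [exact: H1v_wderiv|exact: L2_cst|exact: (du0 k l)].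
transitivity (L2norm ((fun=> 0) : Td -> C)); last exact: L2norm0.
apply: L2norm_ae; [exact: H1v_L2|exact: L2_cst|exact: u0].
Qed.

Lemma analytic_on_le (V : lmodType C) (mem : V -> Prop) (N N' : V -> R) (D : set R)
    (f : R -> V) (c : R) :
  (forall u, 0 <= N' u) -> (forall u, N' u <= c * N u) ->
  analytic_on mem N D f -> analytic_on mem N' D f.
Proof.
move=> N'0 N'N af x Dx; have [r [a [r0 ma fa]]] := af x Dx.
exists r, a; split => // y Dy yx; have := fa y Dy yx.
move=> /(cvgM (cvg_cst c)); rewrite mulr0; apply: cvg0_le.
by apply: nearW => k; rewrite N'0/=; exact: N'N.
Qed.

(** ** Scalar analytic functions *)

(** Real and imaginary parts are sums of real power series, which yields the
    derivatives; the Taylor estimates identify the coefficients with the limits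
    of the quotients by t and by t ^ 2. *)
Lemma analytic_scalar (delta : R) F : 0 < delta ->
  analytic_on (V := C) (fun=> True) normc [set t | `|t| <= delta] F ->
  exists c : nat -> C, [/\ is_cderive F 0 (c 1%N),
    cderive1n 2 F 0 = 2 * c 2%N,
    F 0 = 0 -> ctends (fun t => (t^-1)%:C * F t) (c 1%N) &
    F 0 = 0 -> c 1%N = 0 -> ctends (fun t => (t^-1)%:C * ((t^-1)%:C * F t)) (c 2%N)].
Proof.
move=> delta0 aF.
have [//|//|u|u v _ _|c u _|t _|c [_ [r r0 Hr] HT]] :=
  @analytic_taylor R C (fun=> True) normc _ _ _ _ _ delta F delta0 _ aF => //.
- exact: normc_ge0.
- exact: complex.le_normcD.
- exact: ComplexField.Normc.normcM.
exists c.
have scaleE (x : R) (z : C) : x%:C *: z = x%:C * z by [].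
have F0 : F 0 = c 0%N.
  have [K [r1 [r10 /(_ 0)]]] := HT 1%N; rewrite normr0 => /(_ r10).
  rewrite expr1 mulr0 big_ord1 expr0 scale1r => H.
  apply/eqP; rewrite -subr_eq0; apply/eqP/ComplexField.Normc.eq0_normc/eqP.
  by rewrite eq_le H normc_ge0.
have sumE (p : C -> R) (t : R) k : (forall a b, p (a + b) = p a + p b) -> p 0 = 0 ->
    (forall (x : R) z, p (x%:C * z) = x * p z) ->
    p (\sum_(j < k) (t ^+ j)%:C *: c j) = \sum_(j < k) t ^+ j * p (c j).
  move=> pD p0 pZ; rewrite (big_morph p pD p0); apply: eq_bigr => j _.
  by rewrite scaleE pZ.
have part (p : C -> R) : (forall a b, p (a + b) = p a + p b) -> p 0 = 0 ->
    (forall (x : R) z, p (x%:C * z) = x * p z) -> (forall a, `|p a| <= normc a) ->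
    is_derive (0 : R) 1 (fun t => p (F t)) (p (c 1%N)) /\
    derive1n 2 (fun t => p (F t)) 0 = 2 * p (c 2%N).
  move=> pD p0 pZ ple.
  apply: (power_series_derivatives (c := fun j => p (c j)) r0) => t tr.
  under eq_fun do rewrite -sumE//.
  have := Hr t tr => H; apply: cvg_zero; apply/norm_cvg0P.
  apply: cvg0_le H.
  apply: nearW => k; rewrite normr_ge0 andTb.
  have pN z : p (- z) = - p z.
    by apply/eqP; rewrite -subr_eq0 opprK -pD addNr p0.
  rewrite [X in `|X|](_ : _ = - p (F t - \sum_(j < k) (t ^+ j)%:C *: c j)) ?normrN//.
  by rewrite pD pN opprD opprK addrC.
have [R1 R2] : is_derive (0 : R) 1 (fun t => complex.Re (F t)) (complex.Re (c 1%N)) /\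
    derive1n 2 (fun t => complex.Re (F t)) 0 = 2 * complex.Re (c 2%N).
  apply: part => [||x z|a] //; [exact: cReD|by rewrite cReM/= mul0r subr0|].
  exact: (normc_ge_ReIm a).1.
have [I1 I2] : is_derive (0 : R) 1 (fun t => complex.Im (F t)) (complex.Im (c 1%N)) /\
    derive1n 2 (fun t => complex.Im (F t)) 0 = 2 * complex.Im (c 2%N).
  apply: part => [||x z|a] //; [exact: cImD|by rewrite cImM/= mul0r addr0|].
  exact: (normc_ge_ReIm a).2.
have n0 : `|t| @[t --> (0 : R)^'] --> (0 : R).
  have := @norm_continuous _ R 0; rewrite /continuous_at normr0.
  by apply: cvg_trans; apply: cvg_app; exact: nbhs_dnbhs.
split => //.
- rewrite /cderive1n R2 I2; apply: complexP; rewrite ?cReM ?cImM /=; ring.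
- move=> F00; have [K [r2 [r20 HK]]] := HT 2%N.
  apply: normc_ctends; have := normcZ_cvg0 n0 K; apply: cvg0_le.
  near=> t; rewrite normc_ge0/=.
  have t0 : t != 0 by near: t; exact: nbhs_dnbhs_neq.
  have tr : `|t| < r2 by near: t; exact: dnbhs0_lt.
  have := HK t tr; rewrite big_ord_recr big_ord1/= -F0 F00 scaler0 add0r expr1 scaleE.
  rewrite (_ : _ - c 1%N = (t^-1)%:C * (F t - t%:C * c 1%N)); last first.
    by rewrite mulrBr mulrA -realcM mulVf// mul1r.
  rewrite ComplexField.Normc.normcM normc_real normfV ler_pdivrMl ?normr_gt0//.
  by rewrite expr2 mulrCA.
- move=> F00 c10; have [K [r2 [r20 HK]]] := HT 3%N.
  apply: normc_ctends; have := normcZ_cvg0 n0 K; apply: cvg0_le.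
  near=> t; rewrite normc_ge0/=.
  have t0 : t != 0 by near: t; exact: nbhs_dnbhs_neq.
  have tr : `|t| < r2 by near: t; exact: dnbhs0_lt.
  have := HK t tr; rewrite !big_ord_recr big_ord0/= -F0 F00 c10 !scaler0 !add0r scaleE.
  rewrite (_ : _ - c 2%N = (t^-1)%:C * ((t^-1)%:C * (F t - (t ^+ 2)%:C * c 2%N))); last first.
    rewrite !mulrBr; congr (_ - _); rewrite !mulrA -!realcM.
    by rewrite (_ : t^-1 * t^-1 * t ^+ 2 = 1) ?mul1r//; field.
  rewrite !ComplexField.Normc.normcM !normc_real !normfV ler_pdivrMl ?normr_gt0//.
  rewrite ler_pdivrMl ?normr_gt0//.
  by rewrite !exprS expr0 mulr1; congr (_ <= _); ring.
Unshelve. all: by end_near.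
Qed.

End limits.

(** * The Stokes system in terms of components *)

Section weak_forms.
Variables (R : realType) (d : nat).
Local Notation C := R[i].
Local Notation Td := (torus R d).
Local Notation P := (torus_measure d : {measure set Td -> \bar R}).
Local Notation point := (@Defs.point R d).
Local Notation comp := (@Defs.comp R d).
Local Notation conjmx := Defs.conjmx.
Local Notation normc := (@ComplexField.Normc.normc R).
Implicit Types (u v : Td -> 'cV[C]_d) (sigma : 'I_d -> 'I_d -> Td -> C) (p : Td -> C).

Definition Dcomp (xi : 'cV[R]_d) u (k l : 'I_d) (y : Td) : C :=
  wderiv k (comp u l) y + 'i * (xi k 0)%:C * comp u l y.

Lemma L2_Dcomp xi u k l : H1v u -> L2 (Dcomp xi u k l).
Proof. by move=> hu; apply: L2D; [exact: H1v_wderiv|apply: L2Z; exact: H1v_L2]. Qed.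

Lemma Dgrad_comp xi u y k l : Dgrad xi u y k l = Dcomp xi u k l y.
Proof. by rewrite !mxE. Qed.

Lemma Ddiv_comp xi u y : Ddiv xi u y = \sum_k Dcomp xi u k k y.
Proof. by apply: eq_bigr => k _; rewrite mxE. Qed.

Lemma ip_cst_imag (x : R) (f g : Td -> C) : L2 f -> L2 g ->
  ip f (fun y => 'i * x%:C * g y) = - ('i * x%:C) * ip f g.
Proof.
move=> lf lg; rewrite ipZr//; congr (_ * _).
by apply: complexP; rewrite ?cReJ ?cImJ ?cReN ?cImN ?cReM ?cImM /=; ring.
Qed.

Lemma ip_Dcomp xi u k l f : H1v u -> L2 f ->
  ip f (Dcomp xi u k l) = ip f (wderiv k (comp u l)) - ('i * (xi k 0)%:C) * ip f (comp u l).
Proof.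
move=> hu lf; rewrite ipDr//; [|exact: H1v_wderiv|by apply: L2Z; exact: H1v_L2].
by rewrite ip_cst_imag ?mulNr//; exact: H1v_L2.
Qed.

(** The weak equation as a sum of scalar pairings, each of which is linear and
    continuous in the unknowns. *)
Lemma weak_stokesE (xi : 'cV[R]_d) (sigma : Td -> 'M[C]_d) p (g f v : Td -> 'cV[C]_d) :
  (forall k l, L2 (fun y => sigma y k l)) -> L2 p -> (forall k, L2 (comp g k)) ->
  (forall k, L2 (comp f k)) -> weak_stokes xi sigma p g f -> H1v v ->
  \sum_k \sum_l ip (fun y => sigma y k l) (Dcomp xi v k l)
  - \sum_k ip p (Dcomp xi v k k) + \sum_k ip (comp g k) (comp v k)
  = \sum_k ip (comp f k) (comp v k).
Proof.
move=> lsig lp lg lf weak hv; have := weak v hv.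
have dotE (w : Td -> 'cV[C]_d) : (forall k, L2 (comp w k)) ->
    cint (fun y => dotv (w y) (conjmx (v y))) = \sum_k ip (comp w k) (comp v k).
  move=> lw; rewrite -cint_sum; last by move=> k; apply: ip_Cintegrable => //; exact: H1v_L2.
  by congr cint; apply/funext => y; apply: eq_bigr => k _; rewrite mxE.
rewrite !dotE//.
rewrite (_ : cint _ = \sum_k \sum_l ip (fun y => sigma y k l) (Dcomp xi v k l)); last first.
  transitivity (\sum_k cint (fun y => \sum_l sigma y k l * conjc (Dcomp xi v k l y))).
    rewrite -cint_sum; last first.
      by move=> k; apply: Cintegrable_sum => l; apply: ip_Cintegrable => //; exact: L2_Dcomp.
    congr cint; apply/funext => y; apply: eq_bigr => k _; apply: eq_bigr => l _.
    by rewrite mxE Dgrad_comp.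
  apply: eq_bigr => k _; rewrite cint_sum// => l.
  by apply: ip_Cintegrable => //; exact: L2_Dcomp.
rewrite (_ : cint (fun y => p y * _) = \sum_k ip p (Dcomp xi v k k))//.
rewrite -ip_sumr//; last by move=> k; exact: L2_Dcomp.
by congr cint; apply/funext => y; rewrite Ddiv_comp.
Qed.

Definition stokes_form (mu : Td -> R) sigma p v : C :=
  \sum_k \sum_l ip (fun y => (mu y)%:C * sigma k l y) (wderiv k (comp v l))
  - \sum_k ip p (wderiv k (comp v k)).

Lemma stokes_form_eq mu sigma sigma' p v : essbounded mu ->
  (forall k l, L2 (sigma k l)) -> (forall k l, L2 (sigma' k l)) -> H1v v ->
  (forall k l, {ae P, forall y, sigma k l y = sigma' k l y}) ->
  stokes_form mu sigma p v = stokes_form mu sigma' p v.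
Proof.
move=> bmu ls ls' hv ss'; congr (_ - _).
apply: eq_bigr => k _; apply: eq_bigr => l _.
have lv := H1v_wderiv k l hv.
apply: eq_ip_ae => //; [exact: L2M|exact: L2M| |exact: nearW].
by apply: filterS (ss' k l) => y ->.
Qed.

Lemma stokes_formD mu sigma sigma' p p' v : essbounded mu ->
  (forall k l, L2 (sigma k l)) -> (forall k l, L2 (sigma' k l)) ->
  L2 p -> L2 p' -> H1v v ->
  stokes_form mu (fun k l y => sigma k l y + sigma' k l y) (fun y => p y + p' y) v =
  stokes_form mu sigma p v + stokes_form mu sigma' p' v.
Proof.
move=> bmu ls ls' lp lp' hv; rewrite /stokes_form.
under eq_bigr do under eq_bigr do under eq_fun do rewrite mulrDr.
have E k l : ip (fun y => (mu y)%:C * sigma k l y + (mu y)%:C * sigma' k l y)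
    (wderiv k (comp v l)) = ip (fun y => (mu y)%:C * sigma k l y) (wderiv k (comp v l))
    + ip (fun y => (mu y)%:C * sigma' k l y) (wderiv k (comp v l)).
  by rewrite ipDl//; [exact: L2M|exact: L2M|exact: H1v_wderiv].
under eq_bigr do under eq_bigr do rewrite E.
have E' k : ip (fun y => p y + p' y) (wderiv k (comp v k)) =
    ip p (wderiv k (comp v k)) + ip p' (wderiv k (comp v k)).
  by rewrite ipDl//; exact: H1v_wderiv.
under [X in _ - X]eq_bigr do rewrite E'.
under eq_bigr do rewrite big_split/=.
by rewrite !big_split/= opprD addrACA.
Qed.

Lemma stokes_formZ mu sigma p v (c : C) : essbounded mu ->
  (forall k l, L2 (sigma k l)) -> L2 p -> H1v v ->
  stokes_form mu (fun k l y => c * sigma k l y) (fun y => c * p y) v =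
  c * stokes_form mu sigma p v.
Proof.
move=> bmu ls lp hv; rewrite /stokes_form mulrBr; apply: (congr2 (fun a b : C => a - b)).
  rewrite mulr_sumr; apply: eq_bigr => k _; rewrite mulr_sumr; apply: eq_bigr => l _.
  by under eq_fun do rewrite mulrCA; rewrite ipZl//; [exact: L2M|exact: H1v_wderiv].
by rewrite mulr_sumr; apply: eq_bigr => k _; rewrite ipZl//; exact: H1v_wderiv.
Qed.

Lemma stokes_form_sum mu v n (sigma : 'I_n -> 'I_d -> 'I_d -> Td -> C) (p : 'I_n -> Td -> C) :
  essbounded mu -> (forall i k l, L2 (sigma i k l)) -> (forall i, L2 (p i)) -> H1v v ->
  stokes_form mu (fun k l y => \sum_i sigma i k l y) (fun y => \sum_i p i y) v =
  \sum_i stokes_form mu (sigma i) (p i) v.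
Proof.
move=> bmu + + hv; elim: n sigma p => [|n IH] sigma p ls lp.
  rewrite big_ord0.
  under [X in stokes_form _ X _ _]eq_fun do under eq_fun do under eq_fun do rewrite big_ord0 -(mul0r 0).
  under [X in stokes_form _ _ X _]eq_fun do rewrite big_ord0 -(mul0r 0).
  by rewrite (stokes_formZ 0 bmu) ?mul0r// => *; exact: L2_cst.
under [X in stokes_form _ X _ _]eq_fun do under eq_fun do under eq_fun do rewrite big_ord_recl.
under [X in stokes_form _ _ X _]eq_fun do rewrite big_ord_recl.
rewrite stokes_formD//; first by rewrite big_ord_recl IH.
- by move=> k l; exact: L2_sum.
- exact: L2_sum.
Qed.

(** Coercivity: the viscosity may be replaced by a pointwise majorant of mu0
    which agrees with it almost everywhere. *)
Lemma ip_mu_ge (mu : Td -> R) (mu0 : R) (f : Td -> C) : essbounded mu ->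
  {ae P, forall y, mu0 <= mu y} -> L2 f ->
  mu0 * L2norm f ^+ 2 <= complex.Re (ip (fun y => (mu y)%:C * f y) f).
Proof.
move=> bmu mu0mu lf; pose nu y := Num.max mu0 (mu y).
have mnu : {ae P, forall y, mu y = nu y}.
  by apply: filterS mu0mu => y my; rewrite /nu (max_idPr my).
have bnu : essbounded nu.
  have [mmu [M muM]] := bmu; split; first exact: measurable_maxr.
  by exists M; apply: filterS2 mnu muM => y <-.
rewrite (@eq_ip_ae _ _ _ (fun y => (nu y)%:C * f y) f f)//; try exact: L2M; last 2 first.
- by apply: filterS mnu => y ->.
- exact: nearW.
have i1 := ip_Cintegrable lf lf; have i2 := ip_Cintegrable (L2M bnu lf) lf.
have : mu0 * complex.Re (ip f f) <= complex.Re (ip (fun y => (nu y)%:C * f y) f).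
  rewrite /ip /cint/= -RintegralZl//; last exact: i1.1.
  apply: le_Rintegral => //; [exact: integrable_scale i1.1|exact: i2.1|].
  move=> y _; rewrite -mulrA sqr_normc_conj -realcM/=.
  by rewrite ler_wpM2r ?sqr_ge0// le_max lexx.
by rewrite ipxx.
Qed.

(** The solution itself is the test field: its pressure term vanishes with its
    divergence, and the viscous term dominates the norm of the gradient. *)
Lemma stokes_energy (mu : Td -> R) (mu0 : R) p u : essbounded mu -> 0 < mu0 ->
  {ae P, forall y, mu0 <= mu y} -> L2 p -> H1v u ->
  {ae P, forall y, \sum_k wderiv k (comp u k) y = 0} ->
  stokes_form mu (fun k l => wderiv k (comp u l)) p u = 0 ->
  forall k l, {ae P, forall y, wderiv k (comp u l) y = 0}.
Proof.
move=> bmu mu00 mu0mu lp hu divu.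
have lu k l := H1v_wderiv k l hu.
have pdiv : \sum_k ip p (wderiv k (comp u k)) = 0.
  rewrite -(@ip_sumr _ _ _ p (fun k => wderiv k (comp u k)))//.
  rewrite (@eq_ip_ae _ _ p p _ (fun=> 0))//; [|exact: L2_sum|exact: L2_cst|exact: nearW].
  have := @ipZr R d 0 p (fun=> 0) lp (@L2_cst R d 0).
  by under eq_fun do rewrite mul0r; rewrite conjc0 mul0r.
rewrite /stokes_form [X in _ - X]pdiv subr0 => S0 k l; apply: L2norm_eq0; first exact: lu.
pose e k l := complex.Re (ip (fun y => (mu y)%:C * wderiv k (comp u l) y) (wderiv k (comp u l))).
have e_ge k' l' : mu0 * L2norm (wderiv k' (comp u l')) ^+ 2 <= e k' l' by exact: ip_mu_ge.
have e0 k' l' : 0 <= e k' l'.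
  by apply: le_trans (e_ge k' l'); rewrite mulr_ge0 ?sqr_ge0// ltW.
have sume : \sum_k \sum_l e k l = 0.
  rewrite -[RHS](congr1 (@complex.Re R) S0) (big_morph (@complex.Re R) (@cReD R) (erefl : complex.Re (0 : C) = 0)).
  apply: eq_bigr => k' _; rewrite (big_morph (@complex.Re R) (@cReD R) (erefl : complex.Re (0 : C) = 0)).
  by [].
have ekl : e k l = 0.
  apply/eqP; rewrite eq_le e0 andbT -sume.
  apply: (le_trans (ler_sum_term l (fun j => e0 k j))).
  by apply: (ler_sum_term (a := fun i => \sum_j e i j) k) => i; exact: sumr_ge0.
apply/eqP; rewrite -sqrf_eq0 eq_le sqr_ge0 andbT.
by have := e_ge k l; rewrite ekl pmulr_rle0.
Qed.

(** The pressure is tested against trigonometric fields in the coordinate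
    directions, which makes it constant by [ae_cst]. *)
Lemma pressure_unique p : L2_0 p ->
  (forall v, H1v v -> \sum_k ip p (wderiv k (comp v k)) = 0) ->
  {ae P, forall y, p y = 0}.
Proof.
move=> [lp p0] pv; rewrite -p0; apply: ae_cst => // k n c.
pose e y : C := (trig n c (point y))%:C.
pose v (y : Td) : 'cV[C]_d := \col_j (if j == k then e y else 0).
have be := essbounded_test (@test_function_trig1 R d n c).
have compv j : comp v j = if j == k then e else (fun=> 0).
  by apply/funext => y; rewrite /comp mxE; case: ifP.
have hv : H1v v.
  move=> j; rewrite compv; case: ifP => _; last exact: H1_cst.
  split; first by apply/L2_real/RL2_bounded.
  by move=> i; eexists; exact: is_wderiv_trig.
rewrite -[RHS](pv v hv) (bigD1 k)//= big1 ?addr0 => [|j jk].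
  rewrite compv eqxx.
  rewrite (@eq_ip_ae _ _ p p (wderiv k e) (fun y => (partial k (trig n c) (point y))%:C))//.
  - by congr cint; apply/funext => y; rewrite conjc_real.
  - by have := H1v_wderiv k k hv; rewrite compv eqxx.
  - by have [] := @is_wderiv_trig R d k n c.
  - exact: nearW.
  - by apply: wderivE; exact: is_wderiv_trig.
rewrite compv (negbTE jk).
rewrite (@eq_ip_ae _ _ p p (wderiv j (fun=> 0)) (fun=> 0))//.
- have := @ipZr R d 0 p (fun=> 0) lp (@L2_cst R d 0).
  by under eq_fun do rewrite mul0r; rewrite conjc0 mul0r.
- by apply: L2_wderiv; exact: H1_cst.
- exact: L2_cst.
- exact: nearW.
- exact: wderiv_cst.
Qed.

End weak_forms.

(** * Cell problems and the homogenized tensor *)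

Section cells.
Variables (R : realType) (d : nat).
Local Notation C := R[i].
Local Notation Td := (torus R d).
Local Notation P := (torus_measure d : {measure set Td -> \bar R}).
Local Notation comp := (@Defs.comp R d).
Variables (mu : Td -> R) (chi : 'I_d -> 'I_d -> Td -> 'cV[C]_d) (pi : 'I_d -> 'I_d -> Td -> C).
Hypotheses (bmu : essbounded mu)
  (cell : forall alpha k, cell_solution mu alpha k (chi alpha k) (pi alpha k)).

Definition cgrad (alpha r k l : 'I_d) (y : Td) : C :=
  cell_grad alpha r (chi alpha r) y k l.

Lemma cgradE alpha r k l : cgrad alpha r k l =
  (fun y => wderiv k (comp (chi alpha r) l) y + ((k == alpha) && (l == r))%:R).
Proof. by apply/funext => y; rewrite /cgrad /cell_grad !mxE. Qed.

Lemma L2_cgrad alpha r k l : L2 (cgrad alpha r k l).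
Proof.
rewrite cgradE; apply: L2D; last exact: L2_cst.
by apply: H1v_wderiv; exact: cell_chi_H1 (cell alpha r).
Qed.

Lemma Dcomp0 (v : Td -> 'cV[C]_d) k l : Dcomp 0 v k l = wderiv k (comp v l).
Proof. by apply/funext => y; rewrite /Dcomp mxE mulr0 mul0r addr0. Qed.

Lemma cell_form alpha r v : H1v v -> stokes_form mu (cgrad alpha r) (pi alpha r) v = 0.
Proof.
have c0 k : L2 (comp ((fun=> 0) : Td -> 'cV[C]_d) k).
  rewrite (_ : comp _ k = (fun=> 0)); first exact: L2_cst.
  by apply/funext => y; rewrite /comp mxE.
have ls k l : L2 (fun y => ((mu y)%:C *: cell_grad alpha r (chi alpha r) y) k l).
  rewrite (_ : (fun y => _) = (fun y => (mu y)%:C * cgrad alpha r k l y)).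
    by apply: L2M => //; exact: L2_cgrad.
  by apply/funext => y; rewrite mxE.
move=> hv.
have H := weak_stokesE ls (cell_pi_L2 (cell alpha r)) c0 c0 (cell_momentum (cell alpha r)) hv.
rewrite -[RHS](addIr _ (etrans H (esym (add0r _)))).
congr (_ - _).
  apply: eq_bigr => k _; apply: eq_bigr => l _; rewrite Dcomp0; congr ip.
  by apply/funext => y; rewrite mxE.
by apply: eq_bigr => k _; rewrite Dcomp0.
Qed.

Lemma cell_div alpha r :
  {ae P, forall y, \sum_k wderiv k (comp (chi alpha r) k) y = 0}.
Proof.
apply: filterS (cell_divergence (cell alpha r)) => y H; rewrite -[RHS]H.
by rewrite Ddiv_comp; apply: eq_bigr => k _; rewrite Dcomp0.
Qed.

(** Testing one cell problem with the conjugate of another corrector: the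
    pressure term vanishes by incompressibility, so that in the homogenized
    tensor one of the two correctors drops out. *)
Lemma hom_tensorE k l alpha beta : hom_tensor mu chi k l alpha beta =
  cint (fun y => (mu y)%:C * cgrad beta l alpha k y).
Proof.
rewrite /hom_tensor torus_measure_setT/= invr1 mul1r.
pose v y : 'cV[C]_d := map_mx conjc (chi alpha k y).
have hchi := cell_chi_H1 (cell alpha k).
have compv b : comp v b = (fun y => conjc (comp (chi alpha k) b y)).
  by apply/funext => y; rewrite /comp mxE.
have hv : H1v v by move=> b; rewrite compv; apply: H1_conj; exact: hchi.
have dv a b : {ae P, forall y, wderiv a (comp v b) y = conjc (wderiv a (comp (chi alpha k) b) y)}.
  apply: wderivE; rewrite compv; apply: is_wderivJ; first exact: H1v_L2.
  by apply: wderivP; exact: hchi.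
have ldv a b : L2 (fun y => conjc (wderiv a (comp (chi alpha k) b) y)).
  by apply: L2J; exact: H1v_wderiv.
have lpi := cell_pi_L2 (cell beta l).
have lmc a b : L2 (fun y => (mu y)%:C * cgrad beta l a b y) by apply: L2M => //; exact: L2_cgrad.
have form0 : \sum_a \sum_b cint (fun y => (mu y)%:C * cgrad beta l a b y *
    wderiv a (comp (chi alpha k) b) y) = 0.
  rewrite -[RHS](cell_form beta l hv) /stokes_form.
  rewrite [X in _ = _ - X](_ : _ = 0); last first.
    rewrite -(@ip_sumr _ _ _ _ (fun a => wderiv a (comp v a)))//; last by move=> a; exact: H1v_wderiv.
    have lsum : L2 (fun y => \sum_a wderiv a (comp v a) y).
      by apply: L2_sum => a; exact: H1v_wderiv.
    rewrite (@eq_ip_ae _ _ _ (pi beta l) _ (fun=> 0) lpi lpi lsum (L2_cst _ 0)).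
    - have := @ipZr R d 0 _ (fun=> 0) lpi (@L2_cst R d 0).
      by under eq_fun do rewrite mul0r; rewrite conjc0 mul0r.
    - exact: nearW.
    - have dva : {ae P, forall y, forall a, wderiv a (comp v a) y =
          conjc (wderiv a (comp (chi alpha k) a) y)}.
        by apply: filter_forall => a; exact: dv.
      apply: filterS2 dva (cell_div alpha k) => y dva0 div0.
      transitivity (conjc (\sum_a wderiv a (comp (chi alpha k) a) y)); last by rewrite div0 conjc0.
      by rewrite rmorph_sum; apply: eq_bigr => a _; rewrite dva0.
  rewrite subr0; apply: eq_bigr => a _; apply: eq_bigr => b _.
  rewrite (@eq_ip_ae _ _ _ _ _ _ (lmc a b) (lmc a b) (H1v_wderiv a b hv) (ldv a b))//.
  - by congr cint; apply/funext => y; rewrite conjcK.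
  - exact: nearW.
have lch a b := H1v_wderiv a b hchi.
transitivity (\sum_a \sum_b (cint (fun y => (mu y)%:C * cgrad beta l a b y *
    wderiv a (comp (chi alpha k) b) y) + ((a == alpha) && (b == k))%:R *
    cint (fun y => (mu y)%:C * cgrad beta l a b y))).
  have ii a b : Cintegrable (fun y => (mu y)%:C * cgrad beta l a b y * cgrad alpha k a b y).
    by apply: L2_mul_Cintegrable => //; exact: L2_cgrad.
  transitivity (\sum_a cint (fun y => \sum_b (mu y)%:C * cgrad beta l a b y * cgrad alpha k a b y)).
    rewrite -cint_sum; last by move=> a; exact: Cintegrable_sum.
    congr cint; apply/funext => y; rewrite /ddot mulr_sumr; apply: eq_bigr => a _.
    by rewrite mulr_sumr; apply: eq_bigr => b _; rewrite -mulrA; congr (_ * _); rewrite mulrC.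
  apply: eq_bigr => a _; rewrite cint_sum//; apply: eq_bigr => b _.
  rewrite -cintZ; last exact: L2_Cintegrable.
  rewrite -cintD; last 2 first.
  - exact: L2_mul_Cintegrable.
  - by apply: CintegrableZ; exact: L2_Cintegrable.
  by congr cint; apply/funext => y; rewrite [in LHS](cgradE alpha) mulrDr [X in _ + X]mulrC.
under eq_bigr do rewrite big_split/=.
rewrite big_split/= form0 add0r (bigD1 alpha)//= (bigD1 k)//= !eqxx mul1r.
rewrite big1 ?addr0 => [|b /negbTE ->]; last by rewrite mul0r.
rewrite big1 ?addr0// => a /negbTE ->.
by rewrite big1// => b _; rewrite mul0r.
Qed.

Lemma hom_tensor_sym k l alpha beta :
  hom_tensor mu chi k l alpha beta = hom_tensor mu chi l k beta alpha.
Proof.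
congr (_ * cint _); apply/funext => y; congr (_ * _).
by apply: eq_bigr => a _; apply: eq_bigr => b _; rewrite mulrC.
Qed.

Lemma Mmx_sym (eta : 'cV[R]_d) : (Mmx eta (hom_tensor mu chi))^T = Mmx eta (hom_tensor mu chi).
Proof.
apply/matrixP => k l; rewrite !mxE exchange_big/=.
apply: eq_bigr => a _; apply: eq_bigr => b _.
by rewrite hom_tensor_sym mulrAC.
Qed.

Variables (eta xi : 'cV[R]_d).

Definition corrector (y : Td) : 'cV[C]_d :=
  'i *: (\sum_alpha \sum_r (eta alpha 0 * xi r 0)%:C *: chi alpha r y).

Definition corrector_pressure (y : Td) : C :=
  'i * (\sum_alpha \sum_r (eta alpha 0 * xi r 0)%:C * pi alpha r y).

Lemma H1v_corrector : H1v corrector.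
Proof.
apply: H1vZ; apply: H1v_sum => a; apply: H1v_sum => r; apply: H1vZ.
exact: cell_chi_H1 (cell a r).
Qed.

Lemma comp_corrector l : comp corrector l =
  (fun y => 'i * (\sum_alpha \sum_r (eta alpha 0 * xi r 0)%:C * comp (chi alpha r) l y)).
Proof.
rewrite comp_scale comp_sum; apply/funext => y; congr (_ * _).
by apply: eq_bigr => a _; rewrite comp_sum; apply: eq_bigr => r _; rewrite comp_scale.
Qed.

Lemma wderiv_corrector k l : {ae P, forall y, wderiv k (comp corrector l) y =
  'i * (\sum_alpha \sum_r (eta alpha 0 * xi r 0)%:C * wderiv k (comp (chi alpha r) l) y)}.
Proof.
apply: wderivE; rewrite comp_corrector.
have h a r := cell_chi_H1 (cell a r) l.
apply: is_wderivZ; first by apply: L2_sum => a; apply: L2_sum => r; apply: L2Z; exact: (h a r).1.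
apply: is_wderiv_sum => a; first by apply: L2_sum => r; apply: L2Z; exact: (h a r).1.
apply: is_wderiv_sum => r; first by apply: L2Z; exact: (h a r).1.
by apply: is_wderivZ; [exact: (h a r).1|exact: wderivP].
Qed.

Lemma L2_0_corrector_pressure : L2_0 corrector_pressure.
Proof.
have lpi a r := cell_pi_L2 (cell a r).
have lc a r : L2 (fun y => (eta a 0 * xi r 0)%:C * pi a r y) by exact: L2Z.
have ls a : L2 (fun y => \sum_r (eta a 0 * xi r 0)%:C * pi a r y) by exact: L2_sum.
split; first by apply: L2Z; exact: L2_sum.
rewrite cintZ; last by apply: L2_Cintegrable; exact: L2_sum.
rewrite cint_sum ?big1 ?mulr0// => [a _|a]; last exact: L2_Cintegrable.
rewrite cint_sum ?big1// => [r _|r]; last exact: L2_Cintegrable.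
by rewrite cintZ; [rewrite (cell_pi_mean (cell a r)) mulr0|exact: L2_Cintegrable].
Qed.

Lemma cint_corrector l : cint (comp corrector l) = 0.
Proof.
rewrite comp_corrector.
have lpi a r := (cell_chi_H1 (cell a r) l).1.
have lc a r : L2 (fun y => (eta a 0 * xi r 0)%:C * comp (chi a r) l y) by exact: L2Z.
have ls a : L2 (fun y => \sum_r (eta a 0 * xi r 0)%:C * comp (chi a r) l y) by exact: L2_sum.
rewrite cintZ; last by apply: L2_Cintegrable; exact: L2_sum.
rewrite cint_sum ?big1 ?mulr0// => [a _|a]; last exact: L2_Cintegrable.
rewrite cint_sum ?big1// => [r _|r]; last exact: L2_Cintegrable.
by rewrite cintZ; [rewrite (cell_chi_mean (cell a r)) mulr0|exact: L2_Cintegrable].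
Qed.

(** The affine part y_alpha e_r of each cell problem contributes to this
    gradient. *)
Definition corrector_grad k l (y : Td) : C :=
  'i * (\sum_alpha \sum_r (eta alpha 0 * xi r 0)%:C * cgrad alpha r k l y).

Lemma L2_corrector_grad k l : L2 (corrector_grad k l).
Proof.
by apply: L2Z; apply: L2_sum => a; apply: L2_sum => r; apply: L2Z; exact: L2_cgrad.
Qed.

Lemma corrector_gradE k l : {ae P, forall y, corrector_grad k l y =
  wderiv k (comp corrector l) y + 'i * (eta k 0)%:C * (xi l 0)%:C}.
Proof.
apply: filterS (wderiv_corrector k l) => y ->.
rewrite -mulrA -mulrDr; congr (_ * _).
under eq_bigr do under eq_bigr do rewrite cgradE mulrDr.
under eq_bigr do rewrite big_split/=.
rewrite big_split/=; congr (_ + _).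
rewrite (bigD1 k)//= (bigD1 l)//= !eqxx mulr1.
rewrite big1 ?addr0 => [|r rl]; last by rewrite eq_sym (negbTE rl) mulr0.
rewrite big1 ?addr0 ?realcM// => a ak.
by rewrite big1// => r _; rewrite eq_sym (negbTE ak) mulr0.
Qed.

Lemma corrector_form v : H1v v -> stokes_form mu corrector_grad corrector_pressure v = 0.
Proof.
move=> hv; have lpi a r := cell_pi_L2 (cell a r).
have lc a r k l : L2 (fun y => (eta a 0 * xi r 0)%:C * cgrad a r k l y).
  by apply: L2Z; exact: L2_cgrad.
have lp a r : L2 (fun y => (eta a 0 * xi r 0)%:C * pi a r y) by exact: L2Z.
rewrite (@stokes_formZ R d mu (fun k l y => \sum_a \sum_r (eta a 0 * xi r 0)%:C * cgrad a r k l y)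
  (fun y => \sum_a \sum_r (eta a 0 * xi r 0)%:C * pi a r y))//; last 2 first.
- by move=> k l; apply: L2_sum => a; exact: L2_sum.
- by apply: L2_sum => a; exact: L2_sum.
rewrite (@stokes_form_sum R d mu v d (fun a k l y => \sum_r (eta a 0 * xi r 0)%:C * cgrad a r k l y)
  (fun a y => \sum_r (eta a 0 * xi r 0)%:C * pi a r y))//; last 2 first.
- by move=> a k l; exact: L2_sum.
- by move=> a; exact: L2_sum.
rewrite big1 ?mulr0// => a _.
rewrite (@stokes_form_sum R d mu v d (fun r k l y => (eta a 0 * xi r 0)%:C * cgrad a r k l y)
  (fun r y => (eta a 0 * xi r 0)%:C * pi a r y))//.
rewrite big1// => r _.
rewrite (@stokes_formZ R d mu (cgrad a r) (pi a r) v)// ?cell_form ?mulr0//.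
exact: L2_cgrad.
Qed.

(** By [hom_tensorE], each mean of the stress of a corrector is an entry of the
    homogenized tensor. *)
Lemma mean_corrector_stress l :
  - 'i * (\sum_k (eta k 0)%:C * cint (fun y => (mu y)%:C * corrector_grad k l y)) =
  (Mmx eta (hom_tensor mu chi) *m cplx xi) l 0.
Proof.
have lmc a r k : L2 (fun y => (mu y)%:C * cgrad a r k l y).
  by apply: L2M => //; exact: L2_cgrad.
have E k : cint (fun y => (mu y)%:C * corrector_grad k l y) =
    'i * (\sum_a \sum_r (eta a 0 * xi r 0)%:C * cint (fun y => (mu y)%:C * cgrad a r k l y)).
  under eq_fun do rewrite /corrector_grad mulrCA mulr_sumr.
  under eq_fun do under eq_bigr do rewrite mulr_sumr.
  under eq_fun do under eq_bigr do under eq_bigr do rewrite mulrCA.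
  rewrite cintZ; last by apply: L2_Cintegrable; apply: L2_sum => a; apply: L2_sum => r; exact: L2Z.
  congr (_ * _); rewrite cint_sum; last by move=> a; apply: L2_Cintegrable; apply: L2_sum => r; exact: L2Z.
  apply: eq_bigr => a _; rewrite cint_sum; last by move=> r; apply: L2_Cintegrable; exact: L2Z.
  by apply: eq_bigr => r _; rewrite cintZ//; exact: L2_Cintegrable.
under eq_bigr do rewrite E mulrCA.
rewrite -mulr_sumr mulrA (_ : - 'i * 'i = 1 :> C) ?mul1r; last first.
  by rewrite mulNr -expr2 sqr_i opprK.
rewrite mxE [RHS](eq_bigr (fun r => \sum_k \sum_a (eta k 0)%:C * ((eta a 0 * xi r 0)%:C *
    cint (fun y => (mu y)%:C * cgrad a r k l y)))); last first.
  move=> r _; rewrite !mxE mulr_suml; apply: eq_bigr => k _.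
  rewrite mulr_suml; apply: eq_bigr => a _.
  by rewrite hom_tensorE realcM; ring.
rewrite exchange_big/=; apply: eq_bigr => k _.
rewrite exchange_big/= mulr_sumr; apply: eq_bigr => a _.
by rewrite mulr_sumr.
Qed.

End cells.

(** * Differentiation of a Bloch branch at the origin *)

Section branch.
Variables (R : realType) (d : nat).
Local Notation C := R[i].
Local Notation Td := (torus R d).
Local Notation P := (torus_measure d : {measure set Td -> \bar R}).
Local Notation comp := (@Defs.comp R d).
Local Notation normc := (@ComplexField.Normc.normc R).
Variables (mu : Td -> R) (mu0 : R) (eta : 'cV[R]_d) (delta0 : R).
Variables (lambda : R -> R) (phi : R -> Td -> 'cV[C]_d) (q : R -> Td -> C) (q0 : R -> C).
Variable (phi0 : 'cV[R]_d).
Hypotheses (bmu : essbounded mu) (mu00 : 0 < mu0) (mu0mu : {ae P, forall y, mu0 <= mu y}).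
Hypothesis eta1 : \sum_k eta k 0 ^+ 2 = 1.
Hypothesis delta00 : 0 < delta0.
Hypothesis solution : forall t, `|t| <= delta0 ->
  bloch_solution mu eta t (lambda t) (phi t) (q t) (q0 t).
Hypothesis phi_at0 : {ae P, forall y, phi 0 y = cplx phi0}.
Hypothesis q_at0 : {ae P, forall y, q 0 y = 0}.
Hypothesis lambda_at0 : lambda 0 = 0.
Hypothesis q0_at0 : q0 0 = 0.
Hypothesis phi01 : \sum_k phi0 k 0 * phi0 k 0 = 1.
Hypothesis phi0_eta : \sum_k phi0 k 0 * eta k 0 = 0.
Hypothesis lambda_analytic : analytic_on (V := C) (fun=> True) normc [set t | `|t| <= delta0]
  (fun t => (lambda t)%:C).
Hypothesis phi_analytic : analytic_on (@H1v R d) (@H1norm R d) [set t | `|t| <= delta0] phi.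
Hypothesis q_analytic : analytic_on (V := Td -> C) (@L2_0 R d) (@L2norm R d)
  [set t | `|t| <= delta0] q.
Hypothesis q0_analytic : analytic_on (V := C) (fun=> True) normc [set t | `|t| <= delta0] q0.

Lemma delta0_0 : `|0 : R| <= delta0.
Proof. by rewrite normr0 ltW. Qed.

Lemma H1v_phi t : `|t| <= delta0 -> H1v (phi t).
Proof. by move=> /solution[]. Qed.

Lemma L2_q t : `|t| <= delta0 -> L2 (q t).
Proof. by move=> /solution[_ []]. Qed.

Lemma phi_has_deriv : exists2 a, H1v a & has_deriv (@H1sum R d) phi 0 a.
Proof.
apply: (@analytic_has_deriv R _ (@H1v R d) (@H1sum R d) _ _ _ _ _ delta0) => //.
- exact: H1vD.
- by move=> c u; exact: H1vZ.
- exact: H1sum_ge0.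
- exact: H1sumD.
- exact: H1sumZ.
- exact: H1v_phi.
- apply: analytic_on_le phi_analytic; first exact: H1sum_ge0.
  exact: H1sum_le_H1norm.
Qed.

Lemma q_has_deriv : exists2 b, L2_0 b & has_deriv (V := Td -> C) (@L2norm R d) q 0 b.
Proof.
apply: (@analytic_has_deriv R _ (@L2_0 R d) (@L2norm R d) _ _ _ _ _ delta0) => //.
- move=> u v [lu u0] [lv v0]; split; first exact: L2D.
  by rewrite cintD ?u0 ?v0 ?addr0//; exact: L2_Cintegrable.
- move=> c u [lu u0]; split; first exact: L2Z.
  by rewrite cintZ ?u0 ?mulr0//; exact: L2_Cintegrable.
- exact: L2norm_ge0.
- by move=> u v [lu _] [lv _]; exact: L2normD.
- by move=> c u [lu _]; exact: L2normZ.
- by move=> t /solution[].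
Qed.

Variables (a1 : Td -> 'cV[C]_d) (b1 : Td -> C).
Hypotheses (ha1 : H1v a1) (lb1 : L2_0 b1).
Hypothesis a1_deriv : has_deriv (@H1sum R d) phi 0 a1.
Hypothesis b1_deriv : has_deriv (V := Td -> C) (@L2norm R d) q 0 b1.

Lemma comp_quotient (h : R) (u v w : Td -> 'cV[C]_d) l :
  comp (h%:C *: (u - v) - w) l = (fun y => h%:C * (comp u l y - comp v l y) - comp w l y).
Proof. by apply/funext => y; rewrite /comp !mxE. Qed.

Lemma H1_quotient (h : R) (u v : Td -> 'cV[C]_d) l : H1v u -> H1v v ->
  H1 (fun y => h%:C * (comp u l y - comp v l y)).
Proof.
move=> hu hv; apply: H1Z; apply: H1D; first exact: hu.
rewrite (_ : (fun y => _) = fun y => -1 * comp v l y); first exact: H1Z.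
by apply/funext => y; rewrite mulN1r.
Qed.

(** The derivative in the norm of H^1 gives strong limits for the components and
    for their weak derivatives separately. *)
Lemma quotient_phi l : L2tends (fun t y => (t^-1)%:C * (comp (phi t) l y - (phi0 l 0)%:C))
  (comp a1 l).
Proof.
have hphi0 := H1v_phi delta0_0.
apply: (@L2tends_ae _ _ (fun t y => (t^-1)%:C * (comp (phi t) l y - comp (phi 0) l y))).
  split; last 1 first.
  - move: a1_deriv; rewrite /has_deriv; apply: cvg0_le; apply: nearW => t.
    rewrite L2norm_ge0/= add0r.
    have := L2norm_le_H1sum ((t^-1)%:C *: (phi t - phi 0) - a1) l.
    by rewrite comp_quotient.
  - apply: filterS (dnbhs_le delta00) => t [_ td].
    by apply: L2Z; apply: L2B; apply: H1v_L2 => //; exact: H1v_phi.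
  - exact: H1v_L2.
apply: filterS (dnbhs_le delta00) => t [_ td]; split.
  by apply: L2Z; apply: L2B; [apply: H1v_L2; exact: H1v_phi|exact: L2_cst].
by apply: filterS phi_at0 => y py; rewrite /Defs.comp py mxE.
Qed.

Lemma quotient_wderiv k l : L2tends (fun t y => (t^-1)%:C * wderiv k (comp (phi t) l) y)
  (wderiv k (comp a1 l)).
Proof.
have hphi0 := H1v_phi delta0_0.
have d0 : {ae P, forall y, wderiv k (comp (phi 0) l) y = 0}.
  apply: wderivE; apply: is_wderiv_ae (is_wderiv_cst k (phi0 l 0)%:C).
  - exact: L2_cst.
  - exact: H1v_L2.
  - by apply: filterS phi_at0 => y py; rewrite /Defs.comp py mxE.
apply: (@L2tends_ae _ _ (fun t => wderiv k (fun y => (t^-1)%:C * (comp (phi t) l y - comp (phi 0) l y)))).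
  split; last 1 first.
  - move: a1_deriv; rewrite /has_deriv; apply: cvg0_le.
    apply: filterS (dnbhs_le delta00) => t [_ td]; rewrite L2norm_ge0/= add0r.
    have := wderiv_le_H1sum ((t^-1)%:C *: (phi t - phi 0) - a1) k l.
    rewrite comp_quotient; apply: le_trans; rewrite le_eqVlt; apply/orP; left; apply/eqP.
    have hq := H1_quotient t^-1 l (H1v_phi td) hphi0.
    have hN : H1 (fun y => -1 * comp a1 l y) by apply: H1Z; exact: ha1.
    have E : (fun y => (t^-1)%:C * (comp (phi t) l y - comp (phi 0) l y) - comp a1 l y) =
        (fun y => (t^-1)%:C * (comp (phi t) l y - comp (phi 0) l y) + -1 * comp a1 l y).
      by apply/funext => y; rewrite mulN1r.
    rewrite E; apply: L2norm_ae.
    + by apply: L2B; [exact: L2_wderiv|exact: H1v_wderiv].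
    + by apply: L2_wderiv; exact: H1D.
    + apply: filterS2 (wderivD k hq hN) (wderivZ k (-1) (ha1 l)) => y -> ->.
      by rewrite mulN1r.
  - apply: filterS (dnbhs_le delta00) => t [_ td].
    by apply: L2_wderiv; apply: H1_quotient => //; exact: H1v_phi.
  - exact: H1v_wderiv.
apply: filterS (dnbhs_le delta00) => t [_ td]; have hphit := H1v_phi td.
split; first by apply: L2Z; exact: H1v_wderiv.
have hN : H1 (fun y => -1 * comp (phi 0) l y) by apply: H1Z; exact: hphi0.
have E : (fun y => (t^-1)%:C * (comp (phi t) l y - comp (phi 0) l y)) =
    (fun y => (t^-1)%:C * (comp (phi t) l y + -1 * comp (phi 0) l y)).
  by apply/funext => y; rewrite mulN1r.
rewrite E.
have D : {ae P, forall y, wderiv k (fun y => comp (phi t) l y + -1 * comp (phi 0) l y) y =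
    wderiv k (comp (phi t) l) y}.
  have D1 := wderivD k (hphit l) hN.
  apply: filterS3 D1 (wderivZ k (-1) (hphi0 l)) d0 => y -> -> ->.
  by rewrite mulr0 addr0.
by apply: filterS2 (wderivZ k (t^-1)%:C (H1D (hphit l) hN)) D => y -> ->.
Qed.

Lemma phi_tends l : L2tends (fun t => comp (phi t) l) (fun=> (phi0 l 0)%:C).
Proof.
have := L2tendsD (L2tends_cst (L2_cst _ (phi0 l 0)%:C)) (L2tends_mulX (quotient_phi l)).
under [X in L2tends _ X]eq_fun do rewrite addr0.
move=> /L2tends_ae; apply; apply: filterS (dnbhs_le delta00) => t [t0 td].
split; first by apply: H1v_L2; exact: H1v_phi.
by apply: nearW => y; rewrite mulrA -realcM divff// mul1r addrC subrK.
Qed.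

Lemma quotient_q : L2tends (fun t y => (t^-1)%:C * q t y) b1.
Proof.
have lq0 := L2_q delta0_0.
apply: (@L2tends_ae _ _ (fun t y => (t^-1)%:C * (q t y - q 0 y))).
  split; last 1 first.
  - move: b1_deriv; rewrite /has_deriv; apply: cvg0_le; apply: nearW => t.
    by rewrite L2norm_ge0/= add0r.
  - by apply: filterS (dnbhs_le delta00) => t [_ td]; apply: L2Z; apply: L2B => //; exact: L2_q.
  - exact: lb1.1.
apply: filterS (dnbhs_le delta00) => t [_ td]; split; first by apply: L2Z; exact: L2_q.
by apply: filterS q_at0 => y ->; rewrite subr0.
Qed.

(** The shifted gradient of the eigenfunction is divisible by t because the
    gradient vanishes at t = 0.  Its quotient psi t tends to psi0, the gradient of
    the derivative a1 of the branch plus the contribution of the shift. *)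
Definition psi (t : R) k l (y : Td) : C := (t^-1)%:C * Dcomp (t *: eta) (phi t) k l y.
Definition psi0 k l (y : Td) : C :=
  wderiv k (comp a1 l) y + 'i * (eta k 0)%:C * (phi0 l 0)%:C.

Lemma L2_psi0 k l : L2 (psi0 k l).
Proof. by apply: L2D; [exact: H1v_wderiv|exact: L2_cst]. Qed.

Lemma L2_psi t k l : `|t| <= delta0 -> L2 (psi t k l).
Proof. by move=> td; apply: L2Z; apply: L2_Dcomp; exact: H1v_phi. Qed.

Lemma psi_tends k l : L2tends (fun t => psi t k l) (psi0 k l).
Proof.
apply: (L2tends_ae (L2tendsD (quotient_wderiv k l)
  (L2tendsZ ('i * (eta k 0)%:C) (phi_tends l)))).
apply: filterS (dnbhs_le delta00) => t [t0 td]; split; first exact: L2_psi.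
apply: nearW => y; rewrite /psi /Dcomp mulrDr mxE; congr (_ + _).
rewrite [RHS]mulrA; congr (_ * _); rewrite mulrCA -realcM.
by rewrite mulrA mulVf// mul1r.
Qed.

Lemma ip_mu_swap (f g : Td -> C) :
  ip (fun y => (mu y)%:C * f y) g = ip f (fun y => (mu y)%:C * g y).
Proof. by congr cint; apply/funext => y; rewrite conjcM conjc_real; ring. Qed.

Lemma mu_psi_tends k l g : L2 g ->
  ctends (fun t => ip (fun y => (mu y)%:C * psi t k l y) g)
         (ip (fun y => (mu y)%:C * psi0 k l y) g).
Proof.
move=> lg; under eq_fun do rewrite ip_mu_swap; rewrite ip_mu_swap.
by apply: L2tends_ip (psi_tends k l) _; exact: L2M.
Qed.

Lemma scaled_momentum t v : t != 0 -> `|t| <= delta0 -> H1v v ->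
  \sum_k \sum_l ip (fun y => (mu y)%:C * psi t k l y) (Dcomp (t *: eta) v k l)
  - \sum_k ip (fun y => (t^-1)%:C * q t y) (Dcomp (t *: eta) v k k)
  + ((t^-1)%:C * q0 t) * \sum_k (eta k 0)%:C * ip (fun=> 1) (comp v k)
  = ((t^-1)%:C * (lambda t)%:C) * \sum_k ip (comp (phi t) k) (comp v k).
Proof.
move=> t0 td hv; have hphi := H1v_phi td; have lq := L2_q td.
have lD k l := L2_Dcomp (t *: eta) k l hphi.
have lDv k l := L2_Dcomp (t *: eta) k l hv.
have lv k := H1v_L2 k hv.
have ls k l : L2 (fun y => ((mu y)%:C *: Dgrad (t *: eta) (phi t) y) k l).
  rewrite (_ : (fun y => _) = (fun y => (mu y)%:C * Dcomp (t *: eta) (phi t) k l y)).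
    exact: L2M.
  by apply/funext => y; rewrite mxE Dgrad_comp.
have cg k : comp ((fun=> q0 t *: cplx eta) : Td -> 'cV[C]_d) k =
    (fun y => (q0 t * (eta k 0)%:C) * (fun=> 1) y).
  by apply/funext => y; rewrite /Defs.comp !mxE mulr1.
have cf k : comp (fun y => (lambda t)%:C *: phi t y) k =
    (fun y => (lambda t)%:C * comp (phi t) k y).
  exact: comp_scale.
have lg k : L2 (comp ((fun=> q0 t *: cplx eta) : Td -> 'cV[C]_d) k).
  by rewrite cg; apply: L2Z; exact: L2_cst.
have lf k : L2 (comp (fun y => (lambda t)%:C *: phi t y) k).
  by rewrite cf; apply: L2Z; exact: H1v_L2.
have := weak_stokesE ls lq lg lf (bloch_momentum (solution td)) hv.
move=> /(congr1 (fun z => (t^-1)%:C * z)); rewrite mulrDr mulrBr => H.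
transitivity ((t^-1)%:C * \sum_k ip (comp (fun y => (lambda t)%:C *: phi t y) k) (comp v k)).
  rewrite -H; congr (_ - _ + _).
  - rewrite mulr_sumr; apply: eq_bigr => k _; rewrite mulr_sumr; apply: eq_bigr => l _.
    rewrite -ipZl//; congr ip; apply/funext => y.
    by rewrite mxE Dgrad_comp /psi mulrCA.
  - by rewrite mulr_sumr; apply: eq_bigr => k _; rewrite ipZl.
  - rewrite -mulrA; congr (_ * _); rewrite mulr_sumr; apply: eq_bigr => k _.
    by rewrite cg ipZl ?mulrA//; exact: L2_cst.
rewrite -mulrA; congr (_ * _); rewrite mulr_sumr; apply: eq_bigr => k _.
by rewrite cf ipZl//; exact: H1v_L2.
Qed.

Lemma ip1C (f : Td -> C) (c : C) : L2 f -> ip (fun=> c) f = c * ip (fun=> 1) f.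
Proof.
move=> lf; rewrite -ipZl//; last exact: L2_cst.
by congr ip; apply/funext => y; rewrite mulr1.
Qed.

(** The equation divided by t, in the limit: the derivative of the branch at
    the origin solves a Stokes problem forced by the affine field phi0. *)
Lemma first_order cl cq v : ctends (fun t => (t^-1)%:C * (lambda t)%:C) cl ->
  ctends (fun t => (t^-1)%:C * q0 t) cq -> H1v v ->
  stokes_form mu psi0 b1 v + cq * \sum_k (eta k 0)%:C * ip (fun=> 1) (comp v k)
  = cl * \sum_k (phi0 k 0)%:C * ip (fun=> 1) (comp v k).
Proof.
move=> tl tq hv.
have lv k := H1v_L2 k hv; have lwv k l := H1v_wderiv k l hv.
have zero (F : R -> C) c (x : R) : ctends F c -> ctends (fun t => ('i * (t * x)%:C) * F t) 0.
  move=> Fc; rewrite -(mul0r ('i * x%:C * c)).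
  under eq_fun do rewrite realcM mulrCA -mulrA.
  by apply: ctendsM; [exact: ctends_id|exact: ctendsZ].
apply: (@ctends_unique R (fun t =>
    \sum_k \sum_l (ip (fun y => (mu y)%:C * psi t k l y) (wderiv k (comp v l))
      - 'i * (t * eta k 0)%:C * ip (fun y => (mu y)%:C * psi t k l y) (comp v l))
    - \sum_k (ip (fun y => (t^-1)%:C * q t y) (wderiv k (comp v k))
      - 'i * (t * eta k 0)%:C * ip (fun y => (t^-1)%:C * q t y) (comp v k))
    + ((t^-1)%:C * q0 t) * \sum_k (eta k 0)%:C * ip (fun=> 1) (comp v k))
  (fun t => ((t^-1)%:C * (lambda t)%:C) * \sum_k ip (comp (phi t) k) (comp v k))).
- apply: ctendsD; last by apply: ctendsM => //; exact: ctends_cst.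
  apply: ctendsB.
    apply: ctends_sum => k; apply: ctends_sum => l.
    rewrite -[X in ctends _ X]subr0; apply: ctendsB; first exact: mu_psi_tends.
    by apply: zero; exact: mu_psi_tends.
  apply: ctends_sum => k; rewrite -[X in ctends _ X]subr0.
  by apply: ctendsB; [|apply: zero]; exact: (L2tends_ip quotient_q).
- apply: ctendsM => //; apply: ctends_sum => k; rewrite -ip1C//.
  by apply: L2tends_ip (phi_tends k) _.
- apply: filterS (dnbhs_le delta00) => t [t0 td].
  rewrite -scaled_momentum//; congr (_ - _ + _).
    apply: eq_bigr => k _; apply: eq_bigr => l _; rewrite ip_Dcomp ?mxE//.
    by apply: L2M => //; exact: L2_psi.
  apply: eq_bigr => k _; rewrite ip_Dcomp ?mxE//.
  by apply: L2Z; exact: L2_q.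
Qed.

Lemma ip_wderiv_cst k (f : Td -> C) (c : C) : L2 f -> ip f (wderiv k (fun=> c)) = 0.
Proof.
move=> lf; rewrite (@eq_ip_ae _ _ f f _ (fun=> 0))//.
- have := @ipZr R d 0 _ (fun=> 0) lf (@L2_cst R d 0).
  by under eq_fun do rewrite mul0r; rewrite conjc0 mul0r.
- by apply: L2_wderiv; exact: H1_cst.
- exact: L2_cst.
- exact: nearW.
- exact: wderiv_cst.
Qed.

Lemma cint1 : cint ((fun=> 1) : Td -> C) = 1.
Proof.
rewrite (_ : (fun=> 1) = (fun y : Td => ((fun=> 1 : R) y)%:C))//.
by rewrite cint_real Rintegral_cst//= (probability_setT (torus_measure d)) mulr1.
Qed.

Lemma cint_cst (c : C) : cint ((fun=> c) : Td -> C) = c.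
Proof.
rewrite -[RHS]mulr1 -cint1 -cintZ; last by apply: L2_Cintegrable; exact: L2_cst.
by congr cint; apply/funext => y; rewrite mulr1.
Qed.

Lemma ip_real_cst (f : Td -> C) (x : R) : L2 f -> ip f (fun=> x%:C) = x%:C * cint f.
Proof.
move=> lf; rewrite -cintZ; last exact: L2_Cintegrable.
by congr cint; apply/funext => y; rewrite conjc_real mulrC.
Qed.

Lemma comp_cplx (w : 'cV[R]_d) l : comp ((fun=> cplx w) : Td -> 'cV[C]_d) l = (fun=> (w l 0)%:C).
Proof. by apply/funext => y; rewrite /Defs.comp mxE. Qed.

(** Constant test fields see no viscous force at first order.  The orthonormal
    directions eta and phi0 then force both first derivatives to vanish. *)
Lemma first_derivatives cl cq : ctends (fun t => (t^-1)%:C * (lambda t)%:C) cl ->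
  ctends (fun t => (t^-1)%:C * q0 t) cq -> cl = 0 /\ cq = 0.
Proof.
move=> tl tq.
have H (w : 'cV[R]_d) : cq * (\sum_k eta k 0 * w k 0)%:C = cl * (\sum_k phi0 k 0 * w k 0)%:C.
  have hw : H1v ((fun=> cplx w) : Td -> 'cV[C]_d) by exact: H1v_cst.
  have := first_order tl tq hw.
  have ip1w k : ip (fun=> 1) (comp ((fun=> cplx w) : Td -> 'cV[C]_d) k) = (w k 0)%:C.
    by rewrite comp_cplx ip_real_cst ?cint1 ?mulr1//; exact: L2_cst.
  under eq_bigr do rewrite ip1w -realcM.
  under [X in _ = _ * X -> _]eq_bigr do rewrite ip1w -realcM.
  rewrite -!realc_sum => <-.
  rewrite (_ : stokes_form _ _ _ _ = 0) ?add0r// /stokes_form.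
  rewrite big1 => [|k _].
    rewrite big1 ?subr0// => k _; rewrite comp_cplx ip_wderiv_cst//; exact: lb1.1.
  rewrite big1// => l _; rewrite comp_cplx ip_wderiv_cst//.
  by apply: L2M => //; exact: L2_psi0.
have := H eta; rewrite phi0_eta.
rewrite (_ : \sum_k _ = 1) ?mulr1 ?mulr0; last by under eq_bigr do rewrite -expr2.
move=> cq0; split => //; have := H phi0; rewrite phi01.
rewrite (_ : \sum_k _ = 0); last by rewrite -[RHS]phi0_eta; apply: eq_bigr => k _; rewrite mulrC.
by rewrite mulr0 mulr1.
Qed.

(** Incompressibility and the mean condition pass to the derivative. *)
Lemma div_psi0 : {ae P, forall y, \sum_k psi0 k k y = 0}.
Proof.
have lsum : L2 (fun y => \sum_k psi0 k k y) by apply: L2_sum => k; exact: L2_psi0.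
apply: L2norm_eq0 => //; apply/eqP; rewrite -sqrf_eq0; apply/eqP.
have := ipxx (fun y => \sum_k psi0 k k y).
rewrite (_ : ip _ _ = 0); first by move=> /(congr1 (@complex.Re R)).
have T := L2tends_ip (L2tends_sum (fun k => psi_tends k k)) lsum.
apply: ctends_unique T (ctends_cst 0) _.
apply: filterS (dnbhs_le delta00) => t [t0 td].
rewrite (@eq_ip_ae _ _ _ (fun=> 0) _ (fun y => \sum_k psi0 k k y))//.
- have := @ipZl R d 0 (fun=> 0) _ (@L2_cst R d 0) lsum.
  by under eq_fun do rewrite mul0r; rewrite mul0r.
- by apply: L2_sum => k; exact: L2_psi.
- exact: L2_cst.
- apply: filterS (bloch_divergence (solution td)) => y.
  rewrite Ddiv_comp => D0; transitivity ((t^-1)%:C * \sum_k Dcomp (t *: eta) (phi t) k k y).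
    by rewrite mulr_sumr.
  by rewrite D0 mulr0.
- exact: nearW.
Qed.

Lemma div_a1 : {ae P, forall y, \sum_k wderiv k (comp a1 k) y = 0}.
Proof.
apply: filterS div_psi0 => y; rewrite big_split/=.
rewrite [X in _ + X](_ : _ = 0) ?addr0//.
transitivity ('i * (\sum_k phi0 k 0 * eta k 0)%:C); last by rewrite phi0_eta mulr0.
rewrite realc_sum mulr_sumr; apply: eq_bigr => k _.
by rewrite realcM mulrA mulrAC.
Qed.

Lemma mean_a1 : \sum_k (eta k 0)%:C * cint (comp a1 k) = 0.
Proof.
have l1 : L2 ((fun=> 1) : Td -> C) by exact: L2_cst.
apply: (@ctends_unique R (fun t => \sum_k (eta k 0)%:C *
    ip (fun y => (t^-1)%:C * (comp (phi t) k y - (phi0 k 0)%:C)) (fun=> 1)) (fun=> 0)).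
- apply: ctends_sum => k; apply: ctendsZ; rewrite -ip1r.
  exact: L2tends_ip (quotient_phi k) l1.
- exact: ctends_cst.
- apply: filterS (dnbhs_le delta00) => t [t0 td].
  have lphi k := H1v_L2 k (H1v_phi td).
  have E k : ip (fun y => (t^-1)%:C * (comp (phi t) k y - (phi0 k 0)%:C)) (fun=> 1) =
      (t^-1)%:C * (cint (comp (phi t) k) - (phi0 k 0)%:C).
    have lc : L2 ((fun=> (phi0 k 0)%:C) : Td -> C) by exact: L2_cst.
    rewrite ipZl//; last exact: L2B.
    by rewrite (ipBl (lphi k) lc l1) !ip1r cint_cst.
  under eq_bigr do rewrite E mulrCA mulrBr.
  rewrite -mulr_sumr sumrB (bloch_mean (solution td)) sub0r.
  rewrite (_ : \sum_k _ = (\sum_k phi0 k 0 * eta k 0)%:C); last first.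
    by rewrite realc_sum; apply: eq_bigr => k _; rewrite -realcM mulrC.
  by rewrite phi0_eta oppr0 mulr0.
Qed.

(** The shifted gradient of a constant test field is of order t, and so is that
    of the eigenfunction: the equation can be divided by t ^ 2. *)
Lemma second_order cl cq (w : 'cV[R]_d) :
  ctends (fun t => (t^-1)%:C * ((t^-1)%:C * (lambda t)%:C)) cl ->
  ctends (fun t => (t^-1)%:C * ((t^-1)%:C * q0 t)) cq ->
  - 'i * (\sum_k \sum_l (eta k 0 * w l 0)%:C * cint (fun y => (mu y)%:C * psi0 k l y))
  + cq * \sum_k (eta k 0 * w k 0)%:C
  = cl * \sum_k (w k 0 * phi0 k 0)%:C.
Proof.
move=> tl tq.
have l1 : L2 ((fun=> 1) : Td -> C) by exact: L2_cst.
apply: (@ctends_unique R (fun t =>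
    - 'i * (\sum_k \sum_l (eta k 0 * w l 0)%:C * ip (fun y => (mu y)%:C * psi t k l y) (fun=> 1))
    + ((t^-1)%:C * ((t^-1)%:C * q0 t)) * \sum_k (eta k 0 * w k 0)%:C)
  (fun t => ((t^-1)%:C * ((t^-1)%:C * (lambda t)%:C)) *
    \sum_k (w k 0)%:C * ip (comp (phi t) k) (fun=> 1))).
- apply: ctendsD; last by apply: ctendsM => //; exact: ctends_cst.
  apply: ctendsZ; apply: ctends_sum => k; apply: ctends_sum => l; apply: ctendsZ.
  by rewrite -ip1r; exact: mu_psi_tends.
- apply: ctendsM => //; apply: ctends_sum => k; rewrite realcM; apply: ctendsZ.
  have := L2tends_ip (phi_tends k) l1.
  by rewrite ip1C// ip1r cint1 mulr1.
- apply: filterS (dnbhs_le delta00) => t [t0 td].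
  have hw : H1v ((fun=> cplx w) : Td -> 'cV[C]_d) by exact: H1v_cst.
  have lphi k := H1v_L2 k (H1v_phi td).
  have lmp k l : L2 (fun y => (mu y)%:C * psi t k l y) by apply: L2M => //; exact: L2_psi.
  have lq := L2_q td.
  have ipw (f : Td -> C) k l : L2 f -> ip f (Dcomp (t *: eta) (fun=> cplx w) k l) =
      t%:C * (- 'i * ((eta k 0 * w l 0)%:C * ip f (fun=> 1))).
    move=> lf; rewrite ip_Dcomp// comp_cplx ip_wderiv_cst// sub0r ip_real_cst// ip1r mxE.
    by rewrite !realcM; ring.
  have := scaled_momentum t0 td hw.
  have ip1w k : ip (fun=> 1) (comp ((fun=> cplx w) : Td -> 'cV[C]_d) k) = (w k 0)%:C.
    by rewrite comp_cplx ip_real_cst ?cint1 ?mulr1.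
  rewrite [X in _ - X + _ = _ -> _]big1 ?subr0 => [|k _]; last first.
    rewrite ipw; last exact: L2Z.
    have [_ [_ q00] _ _ _ _] := solution td.
    by rewrite ipZl// ip1r q00 !mulr0.
  under eq_bigr do under eq_bigr do rewrite ipw//.
  under [X in _ + _ * X = _ -> _]eq_bigr do rewrite ip1w -realcM.
  under [X in _ = _ * X -> _]eq_bigr do rewrite comp_cplx ip_real_cst// -ip1r.
  move=> /(congr1 (fun z => (t^-1)%:C * z)); rewrite mulrDr !mulrA => H.
  rewrite -[RHS]H; congr (_ + _).
  rewrite !mulr_sumr; apply: eq_bigr => k _; rewrite !mulr_sumr; apply: eq_bigr => l _.
  by rewrite mulrA -realcM mulVf// mul1r mulrA.
Qed.

(** ** Identification with the correctors *)

Variables (chi : 'I_d -> 'I_d -> Td -> 'cV[C]_d) (pi : 'I_d -> 'I_d -> Td -> C).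
Hypothesis cell : forall alpha k, cell_solution mu alpha k (chi alpha k) (pi alpha k).
Hypothesis tl : ctends (fun t => (t^-1)%:C * (lambda t)%:C) 0.
Hypothesis tq : ctends (fun t => (t^-1)%:C * q0 t) 0.

Local Notation X := (corrector chi eta phi0).
Local Notation Pi := (corrector_pressure pi eta phi0).
Let W (y : Td) := a1 y + -1 *: X y.

Lemma H1v_W : H1v W.
Proof. by apply: H1vD => //; apply: H1vZ; exact: H1v_corrector cell eta phi0. Qed.

Lemma comp_W l : comp W l = (fun y => comp a1 l y + -1 * comp X l y).
Proof. by rewrite comp_add comp_scale. Qed.

Lemma wderiv_W k l : {ae P, forall y,
  wderiv k (comp W l) y = wderiv k (comp a1 l) y - wderiv k (comp X l) y}.
Proof.
have hX := H1v_corrector cell eta phi0 l.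
rewrite comp_W; apply: filterS2 (wderivD k (ha1 l) (H1Z (-1) hX)) (wderivZ k (-1) hX).
by move=> y -> ->; rewrite mulN1r.
Qed.

Lemma W_form v : H1v v ->
  stokes_form mu (fun k l => wderiv k (comp W l)) (fun y => b1 y + -1 * Pi y) v = 0.
Proof.
move=> hv; have lcg := L2_corrector_grad cell eta phi0.
have lPi := (L2_0_corrector_pressure cell eta phi0).1.
have lW k l := H1v_wderiv k l H1v_W.
rewrite (@stokes_form_eq R d mu _ (fun k l y => psi0 k l y + -1 * corrector_grad chi eta phi0 k l y))//.
- rewrite (@stokes_formD R d mu psi0 (fun k l y => -1 * corrector_grad chi eta phi0 k l y)
    b1 (fun y => -1 * Pi y))//.
  + rewrite (@stokes_formZ R d mu (corrector_grad chi eta phi0) Pi)//.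
    rewrite (corrector_form bmu cell)// mulr0 addr0.
    by have := first_order tl tq hv; rewrite !mul0r addr0.
  + by move=> k l; exact: L2_psi0.
  + by move=> k l; exact: L2Z.
  + exact: lb1.1.
  + exact: L2Z.
- by move=> k l; apply: L2D; [exact: L2_psi0|exact: L2Z].
- move=> k l; apply: filterS2 (wderiv_W k l) (corrector_gradE cell eta phi0 k l) => y -> ->.
  by rewrite /psi0 mulN1r opprD addrACA subrr addr0.
Qed.

(** The difference between the derivative of the eigenfunction and the combined
    correctors solves the homogeneous Stokes system. *)
Lemma grad_W k l : {ae P, forall y, wderiv k (comp W l) y = 0}.
Proof.
apply: (stokes_energy bmu mu00 mu0mu _ H1v_W _ (W_form H1v_W)).
  apply: L2D; first exact: lb1.1.
  by apply: L2Z; exact: (L2_0_corrector_pressure cell eta phi0).1.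
have dW : {ae P, forall y, forall k, wderiv k (comp W k) y =
    wderiv k (comp a1 k) y - wderiv k (comp X k) y}.
  by apply: filter_forall => j; exact: wderiv_W.
have dX : {ae P, forall y, forall k, wderiv k (comp X k) y = 'i *
    (\sum_a \sum_r (eta a 0 * phi0 r 0)%:C * wderiv k (comp (chi a r) k) y)}.
  by apply: filter_forall => j; exact: wderiv_corrector.
have divchi : {ae P, forall y, forall a r, \sum_k wderiv k (comp (chi a r) k) y = 0}.
  by apply: filter_forall => a; apply: filter_forall => r; exact: cell_div.
have divX : {ae P, forall y, \sum_k wderiv k (comp X k) y = 0}.
  apply: filterS2 dX divchi => y dXy divy.
  under eq_bigr do rewrite dXy.
  rewrite -mulr_sumr exchange_big/= big1 ?mulr0// => a _.
  rewrite exchange_big/= big1// => r _.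
  by rewrite -mulr_sumr divy mulr0.
apply: filterS3 dW div_a1 divX => y dWy diva divXy.
by under eq_bigr do rewrite dWy; rewrite sumrB diva divXy subrr.
Qed.

Lemma wderiv_a1 k l : {ae P, forall y, wderiv k (comp a1 l) y = wderiv k (comp X l) y}.
Proof.
apply: filterS2 (grad_W k l) (wderiv_W k l) => y -> /esym/eqP.
by rewrite subr_eq0 => /eqP.
Qed.

Lemma comp_a1 l : {ae P, forall y, comp a1 l y = comp X l y + cint (comp a1 l)}.
Proof.
have hX := H1v_corrector cell eta phi0 l.
have := grad0_cst (H1v_W l) (fun k => grad_W k l).
have -> : cint (comp W l) = cint (comp a1 l).
  rewrite comp_W cintD; [|by apply: L2_Cintegrable; exact: (ha1 l).1|].
    rewrite cintZ; last by apply: L2_Cintegrable; exact: hX.1.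
    by rewrite (cint_corrector cell) mulr0 addr0.
  by apply: L2_Cintegrable; apply: L2Z; exact: hX.1.
rewrite comp_W; apply: filterS => y <-.
by rewrite mulN1r addrC subrK.
Qed.

(** Once the gradient of W vanishes, only the pressure terms are left. *)
Lemma pressure_b1 : {ae P, forall y, b1 y = Pi y}.
Proof.
have [lPi Pi0] := L2_0_corrector_pressure cell eta phi0.
have lp : L2 (fun y => b1 y + -1 * Pi y) by apply: L2D; [exact: lb1.1|exact: L2Z].
have : {ae P, forall y, b1 y + -1 * Pi y = 0}.
  apply: pressure_unique.
    split => //; rewrite cintD; last by apply: L2_Cintegrable; exact: L2Z.
      by rewrite cintZ ?lb1.2 ?Pi0 ?mulr0 ?addr0//; exact: L2_Cintegrable.
    by apply: L2_Cintegrable; exact: lb1.1.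
  move=> v hv; have := W_form hv; rewrite /stokes_form.
  rewrite [X in X - _ = _ -> _]big1 ?sub0r => [|k _].
    by move=> /eqP; rewrite oppr_eq0 => /eqP.
  rewrite big1// => l _; have lv := H1v_wderiv k l hv.
  have lW := H1v_wderiv k l H1v_W.
  rewrite (@eq_ip_ae _ _ _ (fun=> 0) _ _ _ _ lv lv)//.
  - have := @ipZl R d 0 (fun=> 0) _ (@L2_cst R d 0) lv.
    by under eq_fun do rewrite mul0r; rewrite mul0r.
  - exact: L2M.
  - exact: L2_cst.
  - by apply: filterS (grad_W k l) => y ->; rewrite mulr0.
  - exact: nearW.
by apply: filterS => y /eqP; rewrite mulN1r subr_eq0 => /eqP.
Qed.

(** The remaining constant is the mean of a1, which is orthogonal to eta. *)
Lemma phi_deriv_corrector : let zeta := \col_l cint (comp a1 l) in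
  \sum_k zeta k 0 * (eta k 0)%:C = 0 /\
  H1v (fun y => X y + zeta) /\ has_deriv (@H1norm R d) phi 0 (fun y => X y + zeta).
Proof.
move=> zeta; have hX := H1v_corrector cell eta phi0.
have hphi' : H1v (fun y => X y + zeta) by apply: H1vD => //; exact: H1v_cst.
split; first by rewrite -[RHS]mean_a1; apply: eq_bigr => k _; rewrite mxE mulrC.
split => //.
pose D := a1 + -1 *: (fun y => X y + zeta).
have hD : H1v D by apply: H1vD => //; exact: H1vZ.
have compphi' l : comp (fun y => X y + zeta) l = (fun y => comp X l y + cint (comp a1 l)).
  by rewrite comp_add; apply/funext => y; rewrite [comp (fun=> zeta) l y]mxE.
have compD l : comp D l = (fun y => comp a1 l y + -1 * comp (fun y => X y + zeta) l y).
  by rewrite (comp_add a1 (-1 *: (fun y => X y + zeta))) (comp_scale (-1) (fun y => X y + zeta)).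
have D0 : H1sum D = 0.
  apply: H1sum_eq0 => // [l|k l]; rewrite compD.
    by rewrite compphi'; apply: filterS (comp_a1 l) => y ->; rewrite mulN1r subrr.
  have dphi' : {ae P, forall y, wderiv k (comp (fun y => X y + zeta) l) y = wderiv k (comp X l) y}.
    rewrite compphi'; apply: filterS2 (wderivD k (hX l) (H1_cst _ (cint (comp a1 l))))
      (wderiv_cst k (cint (comp a1 l))) => y -> ->.
    by rewrite addr0.
  have dD := wderivD k (ha1 l) (H1Z (-1) (hphi' l)).
  apply: filterS3 dD (wderivZ k (-1) (hphi' l)) _ => [y -> ->|]; last first.
    exact: filterS2 (fun y (e1 : _ = _) (e2 : _ = _) => conj e1 e2) dphi' (wderiv_a1 k l).
  by move=> [-> ->]; rewrite mulN1r subrr.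
move: a1_deriv; rewrite /has_deriv; apply: cvg0_le.
apply: filterS (dnbhs_le delta00) => t [t0 td].
rewrite sqrtr_ge0 andTb; apply: le_trans (H1norm_le_H1sum _) _.
rewrite add0r; set Y := _ *: (_ - _).
have hY : H1v (Y - a1).
  have -> : Y - a1 = (t^-1)%:C *: (phi t + -1 *: phi 0) + -1 *: a1 by rewrite !scaleN1r.
  apply: (H1vD (u := (t^-1)%:C *: (phi t + -1 *: phi 0))); last exact: H1vZ.
  apply: H1vZ; apply: (H1vD (H1v_phi td)).
  by apply: H1vZ; apply: H1v_phi; exact: delta0_0.
have -> : Y - (fun y => X y + zeta) = (Y - a1) + D.
  by rewrite /D scaleN1r addrA subrK.
by apply: le_trans (H1sumD hY hD) _; rewrite D0 addr0.
Qed.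

Lemma q_deriv_corrector : has_deriv (V := Td -> C) (@L2norm R d) q 0 Pi.
Proof.
have lPi := (L2_0_corrector_pressure cell eta phi0).1.
move: b1_deriv; rewrite /has_deriv; apply: cvg0_le.
apply: filterS (dnbhs_le delta00) => t [t0 td].
rewrite L2norm_ge0 andTb le_eqVlt; apply/orP; left; apply/eqP.
rewrite add0r.
have lY : L2 ((t^-1)%:C *: (q t - q 0)).
  apply: (@L2Z R d (t^-1)%:C (q t - q 0)); apply: L2B; apply: L2_q => //; exact: delta0_0.
apply: L2norm_ae.
- exact: (L2B lY lPi).
- exact: (L2B lY lb1.1).
- by apply: filterS pressure_b1 => y b1y; congr (_ + _); rewrite [LHS]/(- Pi y) -b1y.
Qed.

(** The test fields are the vectors of the canonical basis, and psi0 is the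
    gradient of the combined correctors with their affine part. *)
Lemma second_derivatives cl cq :
  ctends (fun t => (t^-1)%:C * ((t^-1)%:C * (lambda t)%:C)) cl ->
  ctends (fun t => (t^-1)%:C * ((t^-1)%:C * q0 t)) cq ->
  cl *: cplx phi0 = cq *: cplx eta + Mmx eta (hom_tensor mu chi) *m cplx phi0.
Proof.
move=> tl2 tq2; apply/colP => l.
rewrite [in RHS]mxE -(mean_corrector_stress bmu cell) !mxE.
have := second_order (delta_mx l 0) tl2 tq2.
have pick (F : 'I_d -> C) : \sum_k (F k) * ((delta_mx l 0 : 'cV[R]_d) k 0)%:C = F l.
  rewrite (bigD1 l)//= mxE !eqxx/= mulr1 big1 ?addr0// => k kl.
  by rewrite mxE (negbTE kl)/= mulr0.
have -> : \sum_k (eta k 0 * (delta_mx l 0 : 'cV[R]_d) k 0)%:C = (eta l 0)%:C.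
  by under eq_bigr do rewrite realcM; rewrite (pick (fun k => (eta k 0)%:C)).
have -> : \sum_k ((delta_mx l 0 : 'cV[R]_d) k 0 * phi0 k 0)%:C = (phi0 l 0)%:C.
  by under eq_bigr do rewrite mulrC realcM; rewrite (pick (fun k => (phi0 k 0)%:C)).
move=> <-; rewrite addrC; apply: (congr2 (fun a b : C => a + b)) => //.
congr (_ * _); apply: eq_bigr => k _.
transitivity (\sum_j ((eta k 0)%:C * cint (fun y => (mu y)%:C * psi0 k j y)) *
    ((delta_mx l 0 : 'cV[R]_d) j 0)%:C).
  by apply: eq_bigr => j _; rewrite realcM mulrAC.
rewrite (pick (fun j => (eta k 0)%:C * cint (fun y => (mu y)%:C * psi0 k j y))).
congr (_ * _); apply: cint_ae.
- by apply: L2_Cintegrable; apply: L2M => //; exact: L2_psi0.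
- by apply: L2_Cintegrable; apply: L2M => //; exact: L2_corrector_grad cell eta phi0 k l.
- apply: filterS2 (wderiv_a1 k l) (corrector_gradE cell eta phi0 k l) => y e ->.
  by rewrite /psi0 e.
Qed.

End branch.

Theorem theorem3p1 (R : realType) (d : nat)
    (mu : torus R d -> R) (mu0 : R)
    (eta : 'cV[R]_d) (delta0 : R)
    (lambda : 'I_d.-1 -> R -> R)
    (phi : 'I_d.-1 -> R -> torus R d -> 'cV[R[i]]_d)
    (q : 'I_d.-1 -> R -> torus R d -> R[i])
    (q0 : 'I_d.-1 -> R -> R[i])
    (phi0 : 'I_d.-1 -> 'cV[R]_d)
    (chi : 'I_d -> 'I_d -> torus R d -> 'cV[R[i]]_d)
    (pi : 'I_d -> 'I_d -> torus R d -> R[i]) :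
  mu \in Lfun (torus_measure d) +oo%E ->
  0 < mu0 ->
  {ae torus_measure d, forall y, mu0 <= mu y} ->
  \sum_k eta k 0 ^+ 2 = 1 ->
  rellich_branches mu eta delta0 lambda phi q q0 phi0 ->
  (forall alpha k, cell_solution mu alpha k (chi alpha k) (pi alpha k)) ->
  let M := Mmx eta (hom_tensor mu chi) in
  forall m : 'I_d.-1,
  [/\ lambda m 0 = 0,
      {ae torus_measure d, forall y, q m 0 y = 0},
      q0 m 0 = 0,
      {ae torus_measure d, forall y, phi m 0 y = cplx (phi0 m)} &
      \sum_k phi0 m k 0 ^+ 2 = 1 /\ \sum_k phi0 m k 0 * eta k 0 = 0] /\
  (is_derive (0 : R) 1 (lambda m) 0 /\ is_cderive (q0 m) 0 0) /\
  (exists zeta : 'cV[R[i]]_d,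
     \sum_k zeta k 0 * (eta k 0)%:C = 0 /\
     let phi' y := 'i *: (\sum_alpha \sum_r
       (eta alpha 0 * phi0 m r 0)%:C *: chi alpha r y) + zeta in
     H1v phi' /\ has_deriv (@H1norm R d) (phi m) 0 phi') /\
  (let q' y := 'i * (\sum_alpha \sum_r
     (eta alpha 0 * phi0 m r 0)%:C * pi alpha r y) in
   L2_0 q' /\ has_deriv (V := torus R d -> R[i])
     (@L2norm R d) (q m) 0 q') /\
  (M^T = M /\
   (2^-1 * derive1n 2 (lambda m) 0)%:C *: cplx (phi0 m) =
     (2^-1 * cderive1n 2 (q0 m) 0) *: cplx eta + M *m cplx (phi0 m)).
Proof.
move=> muoo mu00 mu0mu eta1 branches cell M m.
have bmu := essbounded_Lfun muoo.
have delta00 := rellich_delta0 branches.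
have solution := rellich_solution branches m.
have phi_at0 := rellich_phi_at0 branches m.
have q_at0 := rellich_q_at0 branches m.
have lambda_at0 := rellich_lambda_at0 branches m.
have q0_at0 := rellich_q0_at0 branches m.
have phi_analytic := rellich_phi_analytic branches m.
have q_analytic := rellich_q_analytic branches m.
have phi01 : \sum_k phi0 m k 0 * phi0 m k 0 = 1.
  by rewrite (rellich_phi0_orthonormal branches) eqxx.
have phi0_eta := rellich_phi0_eta branches m.
have [a1 ha1 a1_deriv] := phi_has_deriv delta00 solution phi_analytic.
have [b1 lb1 b1_deriv] := q_has_deriv delta00 solution q_analytic.
have [cl [cl1 cl2 /(_ _) cl3 /(_ _) cl4]] :=
  analytic_scalar delta00 (rellich_lambda_analytic branches m).
have [cq [cq1 cq2 cq3 cq4]] := analytic_scalar delta00 (rellich_q0_analytic branches m).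
have l00 : (lambda m 0)%:C = 0 by rewrite lambda_at0.
have tl := cl3 l00; have tq := cq3 q0_at0.
have [cl10 cq10] : cl 1%N = 0 /\ cq 1%N = 0.
  exact: (first_derivatives bmu eta1 delta00 solution phi_at0 q_at0 phi01 phi0_eta ha1 lb1
    a1_deriv b1_deriv tl tq).
have tl2 := cl4 l00 cl10; have tq2 := cq4 q0_at0 cq10.
rewrite cl10 in tl cl1; rewrite cq10 in tq cq1.
split; first by split => //; split=> //; under eq_bigr do rewrite expr2.
split; first by split; [exact: cl1.1|exact: cq1].
split.
  exists (\col_l cint (Defs.comp a1 l)).
  exact: (phi_deriv_corrector bmu mu00 mu0mu delta00 solution phi_at0 q_at0 phi0_eta ha1 lb1
    a1_deriv b1_deriv cell tl tq).
split.
  split; first exact: L2_0_corrector_pressure cell eta (phi0 m).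
  exact: (q_deriv_corrector bmu mu00 mu0mu delta00 solution phi_at0 q_at0 phi0_eta ha1 lb1
    a1_deriv b1_deriv cell tl tq).
split; first exact: Mmx_sym.
have cl2E : cl 2%N = (2^-1 * derive1n 2 (lambda m) 0)%:C.
  have D0 : (fun=> 0 : R)^`()%classic = (fun=> 0 : R).
    by apply/funext => t; rewrite derive1_cst.
  have I0 : derive1n 2 (fun t => complex.Im (lambda m t)%:C) 0 = 0.
    by rewrite derive1nS derive1n1 [X in (X^`()%classic)^`()%classic _ = _](_ : _ = fun=> 0)// !D0.
  have two : 2 = (2 : R)%:C :> R[i] by rewrite rmorph_nat.
  rewrite two in cl2; apply: complexP => /=.
    have /(congr1 (@complex.Re R)) := cl2; rewrite cReM [LHS]/= => ->.
    by rewrite [complex.Im _]/= mul0r subr0 mulKf.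
  have /(congr1 (@complex.Im R)) := cl2; rewrite cImM [complex.Im _%:C]/= mul0r addr0.
  rewrite [LHS]I0 => /esym/eqP; rewrite mulf_eq0 => /orP[|/eqP//].
  by rewrite pnatr_eq0.
have cq2E : cq 2%N = 2^-1 * cderive1n 2 (q0 m) 0.
  by rewrite cq2 mulKf.
rewrite -cl2E -cq2E.
exact: (second_derivatives bmu mu00 mu0mu delta00 solution phi_at0 q_at0 phi0_eta ha1 lb1
    a1_deriv b1_deriv cell tl tq tl2 tq2).
Qed.
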